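(* Let $1\le p\le\infty$, $p^{-1}+q^{-1}=1$, and let $(x,t)$ be an arbitrary point of $\mathbb{R}^n_+\times(0,+\infty)$. For $g\in L^p(\mathbb{R}^{n-1}\times(0,+\infty))$ let $u$ be the solution of the Neumann problem for the heat equation in $\mathbb{R}^n_+\times(0,+\infty)$ with zero initial data and Neumann data $g$, represented by the heat single layer potential $$u(x,t)=-\frac{2a^2}{(4a^2\pi)^{n/2}}\int_0^t\int_{\mathbb{R}^{n-1}}\frac{e^{-\frac{|x-y|^2}{4a^2(t-\tau)}}}{(t-\tau)^{n/2}}\,g(y',\tau)\,dy'\,d\tau,\qquad y=(y',0),\ y'\in\mathbb{R}^{n-1}.$$ Then the sharp coefficient $\mathcal{N}_p(x,t)$ in the inequality $$|\nabla_x u(x,t)|\le\mathcal{N}_p(x,t)\,\|g\|_{p,t}$$ is given by $$\mathcal{N}_p(x,t)=\frac{k_{n,p}}{x_n^{\frac{n+1}{p}}}\max_{|\boldsymbol z|=1}\left\{\int_{\mathbb{S}^{n-1}}\omega_{\kappa,\lambda}\big((\boldsymbol e_\sigma,\boldsymbol e_n)\big)\,|(\boldsymbol e_\sigma,\boldsymbol e_n)|^{\frac{n-p+2}{p-1}}\,|(\boldsymbol e_\sigma,\boldsymbol z)|^{\frac{p}{p-1}}\,d\sigma\right\}^{\frac{p-1}{p}},$$ where $$k_{n,p}=\frac{2^{(3-p)/p}a^{2/p}}{\pi^{n/2}q^{\frac n2+\frac1p}},\qquad \kappa=\frac{qx_n^2}{4a^2t}=\frac{px_n^2}{4a^2(p-1)t},\qquad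 \lambda=\frac{(n+2)q}{2}-2=\frac{(n-2)p+4}{2(p-1)}.$$ In particular, for $2\le p\le (n+4)/2$, $$\mathcal{N}_p(x,t)=\frac{k_{n,p}}{x_n^{\frac{n+1}{p}}}\left\{2\omega_{n-1}\int_0^{\pi/2}\left\{\int_{\frac{qx_n^2}{4a^2t\cos^2\vartheta}}^\infty\xi^{\frac{(n-2)p+4}{2(p-1)}}e^{-\xi}\,d\xi\right\}\cos^{\frac{n+2}{p-1}}\vartheta\,\sin^{n-2}\vartheta\,d\vartheta\right\}^{\frac{p-1}{p}}.$$ As a special case of the last formula, $$\mathcal{N}_2(x,t)=\frac{b_n}{x_n^{\frac{n+1}{2}}}\left\{\int_0^{\pi/2}\left\{\int_{\frac{x_n^2}{2a^2t\cos^2\vartheta}}^\infty\xi^n e^{-\xi}\,d\xi\right\}\cos^{n+2}\vartheta\,\sin^{n-2}\vartheta\,d\vartheta\right\}^{1/2},\qquad b_n=\frac{a}{2^{\frac{n-1}{2}}\pi^{\frac{n+1}{4}}\sqrt{\Gamma\left(\frac{n-1}{2}\right)}}.$$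
   Context: Notation: $\mathbb{R}^n_+=\{x=(x',x_n): x'\in\mathbb{R}^{n-1},\ x_n>0\}$. The Neumann problem is $\partial u/\partial t=a^2\Delta u$ in $\mathbb{R}^n_+\times(0,+\infty)$, $u|_{t=0}=0$, $\frac{\partial u}{\partial x_n}\big|_{x_n=0}=g(x',t)$; throughout, $u$ is the function given by the single layer potential formula in the claim. $\nabla_x$ is the gradient in the variables $x_1,\dots,x_n$. The norm is $\|g\|_{p,t}=\left\{\int_0^t\int_{\mathbb{R}^{n-1}}|g(x',\tau)|^p\,dx'\,d\tau\right\}^{1/p}$ for $1\le p<\infty$, and $\|g\|_{\infty,t}=\operatorname{ess\,sup}\{|g(x',\tau)|: x'\in\mathbb{R}^{n-1},\ \tau\in(0,t)\}$. ''Sharp coefficient'' means the best (smallest) coefficient for which the inequality holds at the point $(x,t)$ for all such $g$. $\mathbb{S}^{n-1}$ is the unit sphere in $\mathbb{R}^n$ with surface measure $d\sigma$; $\omega_n$ (one subscript) is the area of $\mathbb{S}^{n-1}$, so $\omega_{n-1}$ is the area of the unit sphere in $\mathbb{R}^{n-1}$. $\boldsymbol e_\sigma$ is the unit vector joining the origin to $\sigma\in\mathbb{S}^{n-1}$, $\boldsymbol e_n$ is the unit vector of the $x_n$-axis, $(\cdot,\cdot)$ is the Euclidean inner product, and the maximum is over unit vectors $\boldsymbol z\in\mathbb{R}^n$. The function $\omega_{\kappa,\lambda}$ (two subscripts) is $$\omega_{\kappa,\lambda}(u)=\int_{\kappa/u^2}^\infty \xi^\lambda e^{-\xi}\,d\xi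 .$$ For $p=\infty$ one has $q=1$, $1/p=0$, and expressions depending on $p$ are understood as their limits as $p\to\infty$.
   Formalization: The printed b_n is too small by a factor √2 (it contradicts the formula it specializes): 2^{(n-1)/2} is corrected to 2^{(n-2)/2}. For p=1, where q and the exponents are undefined, the formula for N_p is read as its limit as p→1+. *)

(* Defs.v *)
From HB Require Import structures.
From mathcomp Require Import all_boot all_order all_algebra.
From mathcomp Require Import ring lra.
From mathcomp Require Import all_classical all_reals all_analysis.
From mathcomp Require Import measurable_realfun.

Set Implicit Arguments.
Unset Strict Implicit.
Unset Printing Implicit Defensive.

Import Order.TTheory GRing.Theory Num.Theory.
Import numFieldNormedType.Exports.

Local Open Scope classical_set_scope.
Local Open Scope ring_scope.

Section tuple_cons_measure.
Context d (T : measurableType d) (R : realType).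
Variable m : {sigma_finite_measure set T -> \bar R}.
Variables (n : nat) (mn : {sigma_finite_measure set (n.-tuple T) -> \bar R}).

Definition cons_pair (z : T * n.-tuple T) : n.+1.-tuple T :=
  [the n.+1.-tuple T of z.1 :: z.2].

Lemma measurable_cons_pair : measurable_fun [set: T * n.-tuple T] cons_pair.
Proof. exact: measurable_cons. Qed.

Definition tuple_cons_measure : set (n.+1.-tuple T) -> \bar R :=
  pushforward (m \x mn)%E cons_pair.

Let pf0 : tuple_cons_measure set0 = 0%E.
Proof. by rewrite /tuple_cons_measure /pushforward preimage_set0 measure0. Qed.

Let mpre (A : set (n.+1.-tuple T)) : measurable A ->
  measurable (cons_pair @^-1` A).
Proof.
by move=> mA; rewrite -[X in measurable X]setTI; exact: measurable_cons_pair.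
Qed.

Let pf_ge0 A : (0 <= tuple_cons_measure A)%E.
Proof. by rewrite /tuple_cons_measure /pushforward; apply: measure_ge0. Qed.

Let pf_sigma : semi_sigma_additive tuple_cons_measure.
Proof.
move=> F mF tF mUF; rewrite /tuple_cons_measure /pushforward preimage_bigcup.
apply: measure_semi_sigma_additive.
- by move=> k; exact: mpre.
- apply/trivIsetP => /= i j _ _ ij; rewrite -preimage_setI.
  by move/trivIsetP : tF => /(_ _ _ _ _ ij) ->//; rewrite preimage_set0.
- by rewrite -preimage_bigcup; exact: mpre.
Qed.

HB.instance Definition _ := isMeasure.Build _ _ _ tuple_cons_measure
  pf0 pf_ge0 pf_sigma.

Let pf_sigma_finite : sigma_finite setT tuple_cons_measure.
Proof.
have /sigma_finiteP[F [TF ndF Foo]] := sigma_finiteT m.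
have /sigma_finiteP[G [TG ndG Goo]] := sigma_finiteT mn.
pose h (y : n.+1.-tuple T) : T * n.-tuple T := (thead y, [tuple of behead y]).
have hK : cancel cons_pair h.
  by move=> [a s]; rewrite /h /cons_pair /=; congr pair; apply: val_inj.
have Kh : cancel h cons_pair.
  by move=> y; apply: val_inj => /=; rewrite [in RHS](tuple_eta y).
have mh : measurable_fun setT h.
  by apply: measurable_fun_pair; [exact: measurable_tnth|exact: measurable_behead].
exists (fun i => h @^-1` (F i `*` G i)).
  rewrite -preimage_bigcup (_ : \bigcup_i (F i `*` G i) = setT) ?preimage_setT//.
  rewrite -setXTT TF TG predeqE => -[y z]; split.
    by move=> [i _ []/= ? ?]; split; exists i.
  move=> [/= [i _ Fiy] [k _ Gkz]]; exists (maxn i k) => //; split.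
  - by move: y Fiy; exact/subsetPset/ndF/leq_maxl.
  - by move: z Gkz; exact/subsetPset/ndG/leq_maxr.
move=> i; have [mF Fi] := Foo i; have [mG Gi] := Goo i; split.
  by rewrite -[X in measurable X]setTI; apply: mh => //; exact: measurableX.
rewrite /tuple_cons_measure /pushforward -comp_preimage.
rewrite (_ : h \o cons_pair = id) ?preimage_id; last by apply/funext => z /=.
by rewrite product_measure1E// lte_mul_pinfty// ge0_fin_numE.
Qed.

HB.instance Definition _ := Measure_isSigmaFinite.Build _ _ _ tuple_cons_measure
  pf_sigma_finite.

End tuple_cons_measure.

Section lebesgue_tuple.
Variable R : realType.

Let pt : 0.-tuple (measurableTypeR R) := [tuple].

Fixpoint lebesgue_tuple (n : nat) :
    {sigma_finite_measure set (n.-tuple (measurableTypeR R)) -> \bar R} :=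
  match n with
  | 0 => [the {sigma_finite_measure set _ -> \bar R} of \d_ pt]
  | k.+1 => [the {sigma_finite_measure set _ -> \bar R} of
              tuple_cons_measure (@lebesgue_measure R) (lebesgue_tuple k)]
  end.

End lebesgue_tuple.

Lemma lebesgue_tuple_box (R : realType) n (A : 'I_n -> set (measurableTypeR R)) :
  (forall i, measurable (A i)) ->
  lebesgue_tuple R n [set s | forall i, A i (tnth s i)] =
  (\prod_(i < n) lebesgue_measure (A i))%E.
Proof.
elim: n A => [|n IH] A mA.
  rewrite big_ord0 /= diracE mem_set//= => -[] //.
rewrite big_ord_recl /= /tuple_cons_measure /pushforward.
rewrite (_ : _ @^-1` _ =
    A ord0 `*` [set s | forall i, A (lift ord0 i) (tnth s i)]); last first.
  apply/seteqP; split => -[a s] /=.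
    move=> H; split; first exact: (H ord0).
    by move=> i /=; have := H (lift ord0 i); rewrite tnthS.
  move=> [H0 H1] i; case: (unliftP ord0 i) => [j|] -> //.
  by rewrite tnthS.
rewrite product_measure1E//.
  by rewrite (IH (fun i => A (lift ord0 i))).
rewrite (_ : [set s | _] = \bigcap_(i in [set: 'I_n])
    (fun s : n.-tuple (measurableTypeR R) => tnth s i) @^-1` A (lift ord0 i)).
  apply: fin_bigcap_measurable => // i _; rewrite -[X in measurable X]setTI.
  by apply: measurable_tnth.
by apply/seteqP; split => s /= H i; [move=> _|]; apply: H.
Qed.

Section euclidean.
Context {R : realType}.

Definition dotp n (x y : 'rV[R]_n) : R := \sum_(i < n) x 0 i * y 0 i.

(* The library norm on ['rV[R]_n] is the sup norm. *)
Definition enorm n (x : 'rV[R]_n) : R := Num.sqrt (dotp x x).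

Definition to_rV n (s : n.-tuple (measurableTypeR R)) : 'rV[R]_n :=
  \row_(i < n) tnth s i.

Definition normalize n (s : n.-tuple (measurableTypeR R)) :
    n.-tuple (measurableTypeR R) :=
  [tuple tnth s i / enorm (to_rV s) | i < n].

Definition unit_ball n : set (n.-tuple (measurableTypeR R)) :=
  [set s | enorm (to_rV s) < 1].

Definition unit_sphere n : set (n.-tuple (measurableTypeR R)) :=
  [set s | enorm (to_rV s) = 1].

Lemma measurable_enorm n :
  measurable_fun [set: n.-tuple (measurableTypeR R)] (fun s => enorm (to_rV s)).
Proof.
apply: (@measurableT_comp _ _ _ _ _ _ (@Num.sqrt R)).
  apply: open_continuous_measurable_fun; first exact: openT.
  by move=> y _; exact: sqrt_continuous.
rewrite /dotp.
apply: measurable_sum => i; apply: measurable_funM => /=.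
  by under eq_fun do rewrite mxE; exact: measurable_tnth.
by under eq_fun do rewrite mxE; exact: measurable_tnth.
Qed.

Lemma measurable_unit_ball n : measurable (@unit_ball n).
Proof.
rewrite (_ : @unit_ball n = (fun s => enorm (to_rV s)) @^-1` `]-oo, 1[%classic).
  rewrite -[X in measurable X]setTI; exact: measurable_enorm.
by apply/seteqP; split=> s; rewrite /unit_ball /= in_itv.
Qed.

Lemma measurable_normalize n :
  measurable_fun [set: n.-tuple (measurableTypeR R)] (@normalize n).
Proof.
apply/measurable_fun_tnthP => i.
rewrite (_ : _ \o _ = fun s => tnth s i * enorm (to_rV s) `^ (-1)); last first.
  by apply/funext => s /=; rewrite tnth_mktuple powR_inv1 ?sqrtr_ge0.
apply: measurable_funM; first exact: measurable_tnth.
apply: (@measurableT_comp _ _ _ _ _ _ (fun x : R => x `^ (-1))).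
  exact: measurable_powR.
exact: measurable_enorm.
Qed.

End euclidean.
Arguments unit_ball {R} n.
Arguments unit_sphere {R} n.

Section surface_measure.
Context {R : realType}.
Variable n : nat.

(* Surface measure by polar coordinates: the area of a Borel subset A of the
   unit sphere is n times the volume of {r s | s in A, 0 < r < 1}.  It is a
   measure on the whole of R^n, concentrated on the unit sphere for n > 0. *)
Definition surface_measure (A : set (n.-tuple (measurableTypeR R))) : \bar R :=
  (n%:R%:E * lebesgue_tuple R n (unit_ball n `&` @normalize R n @^-1` A))%E.

Let sm0 : surface_measure set0 = 0%E.
Proof. by rewrite /surface_measure preimage_set0 setI0 measure0 mule0. Qed.

Let mpre (A : set (n.-tuple (measurableTypeR R))) : measurable A ->
  measurable (unit_ball n `&` @normalize R n @^-1` A).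
Proof.
move=> mA; apply: measurableI; first exact: measurable_unit_ball.
by rewrite -[X in measurable X]setTI; exact: measurable_normalize.
Qed.

Let sm_ge0 A : (0 <= surface_measure A)%E.
Proof. by rewrite /surface_measure mule_ge0// lee_fin. Qed.

Let sm_sigma : semi_sigma_additive surface_measure.
Proof.
move=> F mF tF mUF; rewrite /surface_measure preimage_bigcup setI_bigcupr.
rewrite [X in X @ _ --> _](_ : _ = fun k => n%:R%:E *
    \sum_(0 <= i < k) lebesgue_tuple R n
      (unit_ball n `&` @normalize R n @^-1` F i))%E; last first.
  by apply/funext => k; rewrite ge0_sume_distrr.
apply: cvgeZl => //; apply: measure_semi_sigma_additive.
- by move=> k; exact: mpre.
- apply/trivIsetP => /= i j _ _ ij; rewrite setIACA setIid -preimage_setI.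
  by move/trivIsetP : tF => /(_ _ _ _ _ ij) ->//; rewrite preimage_set0 setI0.
- by rewrite -setI_bigcupr -preimage_bigcup; exact: mpre.
Qed.

HB.instance Definition _ := isMeasure.Build _ _ _ surface_measure
  sm0 sm_ge0 sm_sigma.

Definition sphere_area : R := fine (surface_measure (unit_sphere n)).

End surface_measure.
Arguments surface_measure {R} n.
Arguments sphere_area {R} n.

(* Throughout, the dimension of the half-space is n = m.+1; the boundary
   variable y' ranges over m-tuples and x_n is the last coordinate of x. *)
Section heat_potential.
Context {R : realType}.
Variable m : nat.
Local Notation RT := (measurableTypeR R).
Local Notation n := (m.+1%:R : R).
Implicit Types (a t : R) (x : 'rV[R]_m.+1) (p : \bar R).
Implicit Types g : m.-tuple RT * RT -> R.

(* y = (y', 0): y' has size m, so the last coordinate takes the default 0. *)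
Definition bdry_pt (y : m.-tuple RT) : 'rV[R]_m.+1 := \row_(i < m.+1) nth 0 y i.

Definition spacetime_measure : {measure set (m.-tuple RT * RT) -> \bar R} :=
  [the {measure set _ -> \bar R} of
    (lebesgue_tuple R m \x @lebesgue_measure R)%E].

Definition strip t : set (m.-tuple RT * RT) := setT `*` `]0, t[.

Definition half_spacetime : set (m.-tuple RT * RT) := setT `*` `]0, +oo[.

Definition single_layer a g x t : R :=
  - (2 * a ^+ 2 / (4 * a ^+ 2 * pi) `^ (n / 2)) *
  \int[spacetime_measure]_(z in strip t)
    (expR (- (enorm (x - bdry_pt z.1) ^+ 2 / (4 * a ^+ 2 * (t - z.2))))
       / (t - z.2) `^ (n / 2) * g z).

Definition gradient (f : 'rV[R]_m.+1 -> R) x : 'rV[R]_m.+1 :=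
  \row_(i < m.+1) 'D_(delta_mx 0 i) f x.

Definition Lp_data p g : Prop := g \_ half_spacetime \in Lfun spacetime_measure p.

Definition data_norm p t g : \bar R :=
  'N[spacetime_measure]_p[EFin \o (g \_ (strip t))]%E.

Definition gradient_bound a p x t (C : R) : Prop :=
  forall g, Lp_data p g ->
    ((enorm (gradient (fun y => single_layer a g y t) x))%:E
       <= C%:E * data_norm p t g)%E.

Definition sharp_coefficient a p x t (C : R) : Prop :=
  gradient_bound a p x t C /\
  forall C', gradient_bound a p x t C' -> C <= C'.

Definition upper_gamma (lambda s : R) : R :=
  \int[@lebesgue_measure R]_(xi in `[s, +oo[) (xi `^ lambda * expR (- xi)).

Definition Gamma (s : R) : R := upper_gamma (s - 1) 0.

(* For u = 0 the lower limit kappa / u^2 is +oo. *)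
Definition omega (kappa lambda u : R) : R :=
  if u == 0 then 0 else upper_gamma lambda (kappa / u ^+ 2).

(* Value at p of an expression in the exponent, as a limit when p = +oo. *)
Definition at_exponent (f : R -> R) p : R :=
  match p with
  | r%:E => f r
  | +oo%E => lim (f r @[r --> +oo])
  | -oo%E => lim (f r @[r --> -oo])
  end.

Definition conj_exponent p : R := fine (hoelder_conjugate p).

Definition k_coef a p : R :=
  at_exponent (fun r => 2 `^ ((3 - r) / r)) p
  * at_exponent (fun r => a `^ (2 / r)) p
  / (pi `^ (n / 2) * conj_exponent p `^ (n / 2 + at_exponent (fun r => r^-1) p)).

Definition kappa a p x t : R :=
  conj_exponent p * x 0 ord_max ^+ 2 / (4 * a ^+ 2 * t).

Definition lambda p : R := (n + 2) * conj_exponent p / 2 - 2.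

Definition sphere_functional a p x t (z : 'rV[R]_m.+1) : R :=
  let e_n : 'rV[R]_m.+1 := delta_mx 0 ord_max in
  (\int[surface_measure m.+1]_(s in unit_sphere m.+1)
     (omega (kappa a p x t) (lambda p) (dotp (to_rV s) e_n)
      * `|dotp (to_rV s) e_n| `^ at_exponent (fun r => (n - r + 2) / (r - 1)) p
      * `|dotp (to_rV s) z| `^ at_exponent (fun r => r / (r - 1)) p))
  `^ at_exponent (fun r => (r - 1) / r) p.

(* The greatest element of A, and 0 if there is none. *)
Definition max_val (A : set R) : R := xget 0 (A `&` ubound A).

Definition N_formula a p x t : R :=
  k_coef a p / x 0 ord_max `^ at_exponent (fun r => (n + 1) / r) p
  * max_val [set sphere_functional a p x t z | z in [set z | enorm z = 1]].

Definition N_special a (p : R) x t : R :=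
  k_coef a p%:E / x 0 ord_max `^ ((n + 1) / p)
  * (2 * sphere_area m
     * \int[@lebesgue_measure R]_(theta in `[0, pi / 2])
         (upper_gamma (((n - 2) * p + 4) / (2 * (p - 1)))
            (conj_exponent p%:E * x 0 ord_max ^+ 2
               / (4 * a ^+ 2 * t * cos theta ^+ 2))
          * cos theta `^ ((n + 2) / (p - 1)) * sin theta ^+ (m.+1 - 2)))
    `^ ((p - 1) / p).

(* b_n = k_(n,2) (2 omega_(n-1))^(1/2), where
   omega_(n-1) = 2 pi^((n-1)/2) / Gamma((n-1)/2). *)
Definition b_coef a : R :=
  a / (2 `^ ((n - 2) / 2) * pi `^ ((n + 1) / 4) * Num.sqrt (Gamma ((n - 1) / 2))).

Definition N_two a x t : R :=
  b_coef a / x 0 ord_max `^ ((n + 1) / 2)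
  * Num.sqrt (\int[@lebesgue_measure R]_(theta in `[0, pi / 2])
      (upper_gamma n
         (x 0 ord_max ^+ 2 / (2 * a ^+ 2 * t * cos theta ^+ 2))
       * cos theta ^+ (m.+1 + 2) * sin theta ^+ (m.+1 - 2))).

Lemma conj_exponentE r : 1 < r -> conj_exponent r%:E = r / (r - 1).
Proof.
move=> r1; rewrite /conj_exponent /hoelder_conjugate /= eqe gt_eqF; last first.
  exact: lt_trans r1.
by rewrite -EFinB inver subr_eq0 gt_eqF.
Qed.

Lemma kappaE a r x t : 1 < r ->
  kappa a r%:E x t = r * x 0 ord_max ^+ 2 / (4 * a ^+ 2 * (r - 1) * t).
Proof.
move=> r1; rewrite /kappa conj_exponentE//.
by rewrite (mulrAC r) -[_ / _ / _]mulrA -invfM; congr (_ / _); ring.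
Qed.

Lemma lambdaE r : 1 < r -> lambda r%:E = ((n - 2) * r + 4) / (2 * (r - 1)).
Proof.
move=> r1; rewrite /lambda conj_exponentE//; field.
by rewrite subr_eq0 gt_eqF.
Qed.

End heat_potential.

(* Main.v *)
(* Differentiating under the integral sign, (grad u(x,t), z) is the pairing of g
   with a kernel K_z that is linear in z, so by Hoelder duality the sharp constant
   is the maximum over unit z of the L^q norm of K_z on the strip; the maximum is
   attained because z |-> ||K_z||_q is a norm on R^n.  Integrating out the time
   variable leaves an incomplete Gamma function of the distance |x - y|, and the
   gnomonic projection from x carries the boundary hyperplane to the unit sphere.
   For p = 1 the constant is the supremum over z of the essential suprema of |K_z|,
   which is the limit of the maximal L^q norms as q -> oo.
   For 2 <= p <= (n + 4) / 2, Young's inequality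
     |(s,z)|^q <= (q/2) (s,z)^2 |s_n|^(q-2) + (1 - q/2) |s_n|^q
   bounds the sphere integral by a quadratic form in z whose weight is a
   nondecreasing function of |s_n| exactly because p <= (n + 4) / 2.  Coordinate
   reflections make this form diagonal, and exchanging two coordinates shows that
   its largest eigenvalue is attained at e_n. *)
Require Import Defs.
From HB Require Import structures.
From mathcomp Require Import all_boot all_order all_algebra all_fingroup.
From mathcomp Require Import ring lra.
From mathcomp Require Import all_classical all_reals all_analysis.
From mathcomp Require Import measurable_realfun ess_sup_inf.
Set Implicit Arguments.
Unset Strict Implicit.
Unset Printing Implicit Defensive.
Import Order.TTheory GRing.Theory Num.Theory.
Import numFieldNormedType.Exports.
Local Open Scope classical_set_scope.
Local Open Scope ring_scope.

(** * Lebesgue measure on tuples *)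

Section tuple_boxes.
Context {R : realType}.
Local Notation RT := (measurableTypeR R).
Local Notation mu := (@lebesgue_measure R).

Definition box n (A : 'I_n -> set RT) : set (n.-tuple RT) :=
  [set s | forall i, A i (tnth s i)].

Lemma measurable_box n (A : 'I_n -> set RT) :
  (forall i, measurable (A i)) -> measurable (box A).
Proof.
move=> mA; rewrite (_ : box A = \bigcap_(i in [set: 'I_n])
    (fun s : n.-tuple RT => tnth s i) @^-1` A i).
  apply: fin_bigcap_measurable => // i _; rewrite -[X in measurable X]setTI.
  by apply: measurable_tnth.
by apply/seteqP; split => s /= H i; [move=> _|]; apply: H.
Qed.

Lemma lebesgue_tuple_boxE n (A : 'I_n -> set RT) :
  (forall i, measurable (A i)) ->
  lebesgue_tuple R n (box A) = (\prod_(i < n) mu (A i))%E.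
Proof. exact: lebesgue_tuple_box. Qed.

Lemma lebesgue_tuple_unique n (nu : {measure set (n.-tuple RT) -> \bar R}) :
  (forall A : 'I_n -> set RT, (forall i, measurable (A i)) ->
    nu (box A) = (\prod_(i < n) mu (A i))%E) ->
  forall X, measurable X -> nu X = lebesgue_tuple R n X.
Proof.
move=> nuE X mX.
pose G : set (set (n.-tuple RT)) :=
  [set B | exists2 A : 'I_n -> set RT, (forall i, measurable (A i)) & B = box A].
pose g (k : nat) : set (n.-tuple RT) :=
  box (fun=> `]- k%:R, k%:R]%classic).
have mI (k : nat) : measurable (`]- k%:R, k%:R]%classic : set RT).
  exact: measurable_itv.
apply: (measure_unique G g) => //.
- apply/seteqP; split.
    apply: smallest_sub; first exact: smallest_sigma_algebra.
    move=> B; rewrite -bigcup_seq => -[i _ [C mC <-]]; apply: sub_sigma_algebra.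
    exists (fun j => if j == i then C else setT); first by move=> j; case: ifP.
    rewrite setTI; apply/seteqP; split => s /=.
      by move=> Cs j; case: eqP => // ->.
    by move=> /(_ i); rewrite eqxx.
  apply: smallest_sub; first exact: sigma_algebra_measurable.
  by move=> _ [A mA ->]; exact: measurable_box.
- move=> _ _ [A mA ->] [B mB ->]; exists (fun i => A i `&` B i).
    by move=> i; exact: measurableI.
  apply/seteqP; split => s /=; first by move=> [sA sB] i; split; [apply: sA|apply: sB].
  by move=> sAB; split => i; have [] := sAB i.
- by move=> k; exists (fun=> `]- k%:R, k%:R]%classic).
- rewrite -subTset => s _.
  have [k sk] : exists k : nat, forall i, `|tnth s i| < k%:R.
    have [k Hk] : exists k : nat, \sum_(i < n) `|tnth s i| < k%:R.
      exists (Num.trunc (\sum_(i < n) `|tnth s i|)).+1.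
      exact: truncnS_gt.
    exists k => i; apply: le_lt_trans Hk.
    by rewrite (bigD1 i)//= lerDl sumr_ge0.
  exists k => // i; rewrite /= in_itv/=.
  by have := sk i; rewrite ltr_norml => /andP[-> /ltW].
- by move=> _ [A mA ->]; rewrite nuE//; apply/esym; exact: lebesgue_tuple_boxE.
- move=> k; rewrite nuE//; rewrite (eq_bigr (fun=> (k%:R + k%:R)%:E)); last first.
    move=> i _; rewrite lebesgue_measure_itv/= lte_fin.
    case: ltP => [_|]; first by rewrite -EFinB opprK.
    by move=> k0; congr EFin; apply/eqP; rewrite eq_le addr_ge0//= -lerBrDr sub0r.
  by rewrite prodEFin ltry.
Qed.
End tuple_boxes.

Section affine_change.
Context {R : realType}.
Local Notation RT := (measurableTypeR R).
Local Notation mu := (@lebesgue_measure R).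

Definition image_measure d d' (T : measurableType d) (T' : measurableType d')
    (m : {measure set T -> \bar R}) (f : T -> T')
    (mf : measurable_fun setT f) : {measure set T' -> \bar R} :=
  measure_function_pushforward__canonical__measure_function_Measure m mf.

Lemma measurable_affine (c d : R) :
  measurable_fun [set: RT] (fun x : RT => c * x + d : RT).
Proof. by apply: measurable_funD => //; apply: measurable_funM. Qed.

Lemma lebesgue_measure_affine (c d : R) (A : set RT) : c != 0 -> measurable A ->
  (`|c|%:E * mu ((fun x : RT => c * x + d : RT)%R @^-1` A))%E = mu A.
Proof.
move=> c0 mA.
pose nu := mscale (NngNum (normr_ge0 c)) (image_measure mu (measurable_affine c d)).
rewrite -[LHS]/(nu A); apply/esym/lebesgue_measure_unique => // _ [[a b]] _ <- /=.
rewrite -[RHS]/(`|c|%:E * mu ((fun x : RT => c * x + d : RT)%R @^-1` `]a, b]%classic))%E.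
have [cneg|cpos|c00] := ltgtP c 0; last by rewrite c00 eqxx in c0.
- rewrite (_ : _ @^-1` _ = `[(b - d) / c, (a - d) / c[%classic); last first.
    apply/seteqP; split => x /=; rewrite !in_itv/= ler_ndivrMr// ltr_ndivlMr//;
    by rewrite (mulrC c) -ltrBlDr -lerBrDr andbC.
  rewrite !lebesgue_measure_itv/= !lte_fin ltr_ndivrMr// mulfVK//.
  rewrite ltrBlDr subrK; case: ifPn => // _; last by rewrite mule0.
  by rewrite -!EFinD -EFinM ltr0_norm//; congr EFin; field.
- rewrite (_ : _ @^-1` _ = `](a - d) / c, (b - d) / c]%classic); last first.
    apply/seteqP; split => x /=; rewrite !in_itv/= ler_pdivlMr// ltr_pdivrMr//;
    by rewrite (mulrC c) -lerBrDr ltrBlDr.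
  rewrite !lebesgue_measure_itv/= !lte_fin ltr_pdivrMr// mulfVK//.
  rewrite ltrBlDr subrK; case: ifPn => // _; last by rewrite mule0.
  by rewrite -!EFinD -EFinM gtr0_norm//; congr EFin; field.
Qed.

Definition affine n (c d : 'I_n -> R) (s : n.-tuple RT) : n.-tuple RT :=
  [tuple c i * tnth s i + d i | i < n].

Lemma measurable_affine_tuple n (c d : 'I_n -> R) :
  measurable_fun setT (affine c d).
Proof.
apply/measurable_fun_tnthP => i.
rewrite (_ : _ \o _ = (fun x : RT => c i * x + d i : RT) \o (@tnth n RT ^~ i)).
  apply: measurableT_comp; [exact: measurable_affine|exact: measurable_tnth].
by apply/funext => s /=; rewrite tnth_mktuple.
Qed.

Lemma integral_affine n (c d : 'I_n -> R) (f : n.-tuple RT -> \bar R) :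
  (forall i, c i != 0) -> measurable_fun setT f -> (forall s, 0 <= f s)%E ->
  ((\prod_(i < n) `|c i|)%:E * \int[lebesgue_tuple R n]_s f (affine c d s) =
   \int[lebesgue_tuple R n]_s f s)%E.
Proof.
move=> c0 mf f0.
have P0 : 0 <= \prod_(i < n) `|c i| by apply: prodr_ge0.
pose nu := mscale (NngNum P0)
  (image_measure (lebesgue_tuple R n) (measurable_affine_tuple c d)).
transitivity (\int[nu]_s f s)%E.
  rewrite ge0_integral_mscale//=.
  by rewrite ge0_integral_pushforward//=; exact: measurable_affine_tuple.
apply: eq_measure_integral => A mA _; apply: lebesgue_tuple_unique => // B mB.
rewrite -[LHS]/((\prod_(i < n) `|c i|)%:E *
  lebesgue_tuple R n (affine c d @^-1` box B))%E.
rewrite (_ : _ @^-1` _ = box (fun i => (fun x : RT => c i * x + d i : RT) @^-1` B i)).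
  rewrite lebesgue_tuple_boxE; last first.
    by move=> i; rewrite -[X in measurable X]setTI; exact: measurable_affine.
  rewrite -prodEFin -big_split/=; apply: eq_bigr => i _.
  exact: lebesgue_measure_affine.
by apply/seteqP; split => s /= H i; have := H i; rewrite /= tnth_mktuple.
Qed.

Definition permute n (p : {perm 'I_n}) (s : n.-tuple RT) : n.-tuple RT :=
  [tuple tnth s (p i) | i < n].

Lemma measurable_permute n (p : {perm 'I_n}) : measurable_fun setT (permute p).
Proof.
apply/measurable_fun_tnthP => i.
rewrite (_ : _ \o _ = @tnth n RT ^~ (p i)); first exact: measurable_tnth.
by apply/funext => s /=; rewrite tnth_mktuple.
Qed.

Lemma integral_permute n (p : {perm 'I_n}) (f : n.-tuple RT -> \bar R) :
  measurable_fun setT f -> (forall s, 0 <= f s)%E ->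
  (\int[lebesgue_tuple R n]_s f (permute p s) = \int[lebesgue_tuple R n]_s f s)%E.
Proof.
move=> mf f0.
pose nu := image_measure (lebesgue_tuple R n) (measurable_permute p).
transitivity (\int[nu]_s f s)%E.
  by rewrite ge0_integral_pushforward//=; exact: measurable_permute.
apply: eq_measure_integral => A mA _; apply: lebesgue_tuple_unique => // B mB.
rewrite -[LHS]/(lebesgue_tuple R n (permute p @^-1` box B)).
rewrite (_ : _ @^-1` _ = box (fun i => B (p^-1%g i))).
  by rewrite lebesgue_tuple_boxE// (reindex_inj (@perm_inj _ p))/=;
    apply: eq_bigr => i _; rewrite permK.
apply/seteqP; split => s /= H i; first by have := H (p^-1%g i); rewrite /= tnth_mktuple permKV.
by have := H (p i); rewrite /= tnth_mktuple permK.
Qed.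

Definition snoc n (z : n.-tuple RT * RT) : n.+1.-tuple RT :=
  [tuple of rcons z.1 z.2].

Lemma tnth_snoc_max n (z : n.-tuple RT * RT) : tnth (snoc z) ord_max = z.2.
Proof. by rewrite (tnth_nth z.2)/= nth_rcons size_tuple ltnn eqxx. Qed.

Lemma tnth_snoc_widen n (z : n.-tuple RT * RT) (i : 'I_n) :
  tnth (snoc z) (widen_ord (leqnSn n) i) = tnth z.1 i.
Proof. by rewrite !(tnth_nth z.2)/= nth_rcons size_tuple ltn_ord. Qed.

Lemma ord_max_or_widen n (i : 'I_n.+1) :
  i = ord_max \/ exists j : 'I_n, i = widen_ord (leqnSn n) j.
Proof.
have [ilt|ige] := ltnP i n.
  by right; exists (Ordinal ilt); apply: val_inj.
by left; apply: val_inj; apply/eqP; rewrite eqn_leq ige -ltnS ltn_ord.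
Qed.

Lemma measurable_snoc n : measurable_fun setT (@snoc n).
Proof.
apply/measurable_fun_tnthP => i; have [->|[j ->]] := ord_max_or_widen i.
  by rewrite (_ : _ \o _ = snd)//; apply/funext => z /=; rewrite tnth_snoc_max.
rewrite (_ : _ \o _ = (@tnth n RT ^~ j) \o fst).
  by apply: measurableT_comp => //; exact: measurable_tnth.
by apply/funext => z /=; rewrite tnth_snoc_widen.
Qed.

Lemma integral_snoc n (f : n.+1.-tuple RT -> \bar R) :
  measurable_fun setT f -> (forall s, 0 <= f s)%E ->
  (\int[lebesgue_tuple R n.+1]_s f s =
   \int[lebesgue_tuple R n \x mu]_z f (snoc z))%E.
Proof.
move=> mf f0.
pose nu := image_measure (lebesgue_tuple R n \x mu)%E (@measurable_snoc n).
transitivity (\int[nu]_s f s)%E; last first.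
  by rewrite ge0_integral_pushforward//=; exact: measurable_snoc.
apply: eq_measure_integral => A mA _; apply/esym; apply: lebesgue_tuple_unique => // B mB.
rewrite -[LHS]/((lebesgue_tuple R n \x mu)%E (@snoc n @^-1` box B)).
rewrite (_ : _ @^-1` _ = box (fun i => B (widen_ord (leqnSn n) i)) `*` B ord_max).
  rewrite product_measure1E//; last exact: measurable_box.
  by rewrite big_ord_recr/= lebesgue_tuple_boxE.
apply/seteqP; split => z /=.
  move=> H; split => [i|]; first by have := H (widen_ord (leqnSn n) i); rewrite tnth_snoc_widen.
  by have := H ord_max; rewrite tnth_snoc_max.
move=> [H0 H1] i; have [->|[j ->]] := ord_max_or_widen i.
  by rewrite tnth_snoc_max.
by rewrite tnth_snoc_widen; exact: H0.
Qed.

Lemma integral_tuple_cons n (f : n.+1.-tuple RT -> \bar R) :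
  measurable_fun setT f -> (forall s, 0 <= f s)%E ->
  (\int[lebesgue_tuple R n.+1]_s f s =
   \int[mu \x lebesgue_tuple R n]_z f (cons_pair z))%E.
Proof.
move=> mf f0.
transitivity (\int[image_measure (mu \x lebesgue_tuple R n)%E
  (@measurable_cons_pair _ RT n)]_s f s)%E; first by apply: eq_measure_integral.
by rewrite ge0_integral_pushforward//=; exact: measurable_cons_pair.
Qed.

End affine_change.

(** * One-dimensional substitutions *)

Section substitution.
Context {R : realType}.
Local Notation mu := (@lebesgue_measure R).
Implicit Types (I J : set R) (u v : R^nat) (phi dphi G : R -> R).

Lemma ge0_substitution I J u v phi dphi G :
  open I -> is_interval I -> is_interval J ->
  nonincreasing_seq u -> nondecreasing_seq v ->
  (forall n, I (u n) /\ I (v n)) -> (forall n, u n <= v n) ->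
  (forall x, I x -> exists n, u n <= x <= v n) ->
  phi @` I = J ->
  (forall x y, I x -> I y -> x < y -> phi x < phi y) ->
  (forall x, I x -> is_derive x 1 phi (dphi x)) ->
  (forall x, I x -> {for x, continuous dphi}) ->
  (forall x, I x -> 0 <= dphi x) ->
  (forall y, J y -> {for y, continuous G}) ->
  (forall y, J y -> 0 <= G y) -> measurable_fun setT G ->
  (\int[mu]_(y in J) (G y)%:E = \int[mu]_(x in I) (G (phi x) * dphi x)%:E)%E.
Proof.
move=> oI iI iJ du iv Iuv uv cov phiI phim phid dphic dphi0 cG G0 mG.
have subI n x : x \in `[u n, v n] -> I x.
  by rewrite in_itv/= => xuv; have [] := Iuv n => Iu Iv; exact: (iI _ _ Iu Iv).
have Jphi x : I x -> J (phi x) by move=> Ix; rewrite -phiI; exists x.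
have subJ n y : y \in `[phi (u n), phi (v n)] -> J y.
  rewrite in_itv/= => yuv; have [/Jphi Iu /Jphi Iv] := Iuv n.
  exact: (iJ _ _ Iu Iv).
have phile x y : I x -> I y -> x <= y -> phi x <= phi y.
  move=> Ix Iy; rewrite le_eqVlt => /predU1P[->//|xy]; exact/ltW/phim.
have cphi x : I x -> {for x, continuous phi}.
  move=> Ix; apply: differentiable_continuous; apply/derivable1_diffP.
  by have [] := phid _ Ix.
have IE : I = \bigcup_n `[u n, v n]%classic.
  apply/seteqP; split => x; first by move=> /cov[n xn]; exists n => //=; rewrite in_itv.
  by move=> [n _ /subI].
have JE : J = \bigcup_n `[phi (u n), phi (v n)]%classic.
  apply/seteqP; split => y.
    rewrite -phiI => -[x Ix <-]; have [n /andP[xn1 xn2]] := cov _ Ix.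
    have [Iu Iv] := Iuv n.
    by exists n => //=; rewrite in_itv/= !phile.
  by move=> [n _ /subJ].
have d1E x : I x -> derive1 phi x = dphi x.
  by move=> Ix; have [_ <-] := phid _ Ix; rewrite derive1E.
have cd1 x : I x -> {for x, continuous (derive1 phi)}.
  move=> Ix; have cdx := dphic _ Ix.
  apply: (cvg_trans _ (_ : dphi @ x --> derive1 phi x)); last by rewrite d1E.
  apply: near_eq_cvg; have : \forall z \near x, I z by exact: open_nbhs_nbhs.
  by apply: filterS => z Iz; rewrite d1E.
have mGphi : measurable_fun I (fun x => G (phi x) * dphi x).
  apply: open_continuous_measurable_fun => // x /[!inE] Ix.
  apply: cvgM; last exact: dphic.
  by apply: continuous_comp; [exact: cphi|exact/cG/Jphi].
pose FI n := `[u n, v n]%classic : set R.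
pose FJ n := `[phi (u n), phi (v n)]%classic : set R.
have nI : nondecreasing_seq FI.
  move=> n k nk; rewrite subsetEset; apply: subset_itv; rewrite bnd_simp.
    exact: du.
  exact: iv.
have nJ : nondecreasing_seq FJ.
  move=> n k nk; rewrite subsetEset; have [? ?] := Iuv n; have [? ?] := Iuv k.
  apply: subset_itv; rewrite bnd_simp; apply: phile => //; [exact: du|exact: iv].
have cI : (\int[mu]_(x in FI n) (G (phi x) * dphi x)%:E @[n --> \oo] -->
    \int[mu]_(x in I) (G (phi x) * dphi x)%:E)%E.
  rewrite [in X in _ --> X]IE; apply: ge0_nondecreasing_set_cvg_integral => //.
  - by move=> n; exact: measurable_itv.
  - move=> n; apply/measurable_EFinP; apply: measurable_funS mGphi => //.
      exact: open_measurable.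
    by move=> x /subI.
  - by move=> n x /subI Ix; rewrite lee_fin mulr_ge0 ?dphi0// G0//; exact: Jphi.
have cJ : (\int[mu]_(y in FJ n) (G y)%:E @[n --> \oo] --> \int[mu]_(y in J) (G y)%:E)%E.
  rewrite [in X in _ --> X]JE; apply: ge0_nondecreasing_set_cvg_integral => //.
  - by move=> n; exact: measurable_itv.
  - by move=> n; apply/measurable_EFinP; apply: measurable_funTS.
  - by move=> n x /subJ Jx; rewrite lee_fin G0.
have EIJ n : (\int[mu]_(y in FJ n) (G y)%:E = \int[mu]_(x in FI n) (G (phi x) * dphi x)%:E)%E.
  rewrite /FJ integration_by_substitution_increasing//.
  - by apply: eq_integral => x; rewrite inE => /subI Ix; rewrite /= !fctE d1E.
  - by move=> x y /subI Ix /subI Iy; exact: phim.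
  - by move=> x xuv; apply/cd1/(subI n); exact: subset_itv_oo_cc.
  - apply/cvg_ex; exists (derive1 phi (u n)); apply: cvg_at_right_filter.
    by apply: cd1; have [] := Iuv n.
  - apply/cvg_ex; exists (derive1 phi (v n)); apply: cvg_at_left_filter.
    by apply: cd1; have [] := Iuv n.
  - split.
    + by move=> x xuv; have [] := phid x (subI n _ (subset_itv_oo_cc xuv)).
    + by apply: cvg_at_right_filter; apply: cphi; have [] := Iuv n.
    + by apply: cvg_at_left_filter; apply: cphi; have [] := Iuv n.
  - by apply: continuous_in_subspaceT => y; rewrite inE => /subJ; exact: cG.
by move: cJ; rewrite (funext EIJ) => cJ; exact: (cvg_unique _ cJ cI).
Qed.

End substitution.

Section substitution_instances.
Context {R : realType}.
Local Notation mu := (@lebesgue_measure R).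

Lemma measurable_invr : measurable_fun setT (@GRing.inv R).
Proof.
rewrite (_ : @GRing.inv R = fun x => x * (x ^+ 2) `^ (-1)).
  apply: measurable_funM => //.
  apply: (@measurableT_comp _ _ _ _ _ _ (fun x : R => x `^ (-1))).
    exact: measurable_powR.
  exact: measurable_funX.
apply/funext => x; rewrite powR_inv1 ?sqr_ge0//.
have [->|x0] := eqVneq x 0; first by rewrite mul0r invr0.
by rewrite expr2 invfM mulVKf.
Qed.

Lemma continuous_powR (c x : R) : 0 < x -> {for x, continuous (fun y : R => y `^ c)}.
Proof.
move=> x0; apply: differentiable_continuous; apply/derivable1_diffP.
by have [] := is_derive1_powR c x0.
Qed.

Definition gamma_density (l xi : R) : R := xi `^ l * expR (- xi).

Lemma gamma_density_ge0 l xi : 0 <= gamma_density l xi.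
Proof. by rewrite mulr_ge0 ?powR_ge0 ?expR_ge0. Qed.

Lemma measurable_gamma_density l : measurable_fun setT (gamma_density l).
Proof.
apply: measurable_funM; first exact: measurable_powR.
by apply: measurableT_comp => //; exact: measurable_expR.
Qed.

Lemma continuous_gamma_density l x : 0 < x -> {for x, continuous (gamma_density l)}.
Proof.
move=> x0; apply: cvgM; first exact: continuous_powR.
by apply: continuous_comp; [exact: continuousN|exact: continuous_expR].
Qed.

Lemma integral_gamma_density_inv (al A t : R) : 0 < A -> 0 < t ->
  (\int[mu]_(s in `]0%R, t[) ((t - s) `^ (- al) * expR (- (A / (t - s))))%:E =
   (A `^ (1 - al))%:E * \int[mu]_(xi in `](A / t)%R, +oo[) (gamma_density (al - 2) xi)%:E)%E.
Proof.
move=> A0 t0.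
pose phi s : R := A / (t - s).
pose dphi s : R := A / (t - s) ^+ 2.
have n20 (n : nat) : (0 : R) < n.+2%:R by rewrite ltr0n.
have n21 (n : nat) : n.+2%:R^-1 <= (2^-1 : R) by rewrite lef_pV2 ?posrE// ler_nat.
transitivity ((A `^ (1 - al))%:E * \int[mu]_(s in `]0%R, t[)
    (gamma_density (al - 2) (phi s) * dphi s)%:E)%E; last first.
  congr (_ * _)%E; apply/esym; apply: (@ge0_substitution _ `]0, t[%classic _
    (fun n => t / n.+2%:R) (fun n => t - t / n.+2%:R)).
  - exact: interval_open.
  - exact: interval_is_interval.
  - exact: interval_is_interval.
  - by move=> n k nk; rewrite ler_pM2l// lef_pV2 ?posrE// ler_nat.
  - by move=> n k nk; rewrite lerD2l lerN2 ler_pM2l// lef_pV2 ?posrE// ler_nat.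
  - move=> n; rewrite /= !in_itv/=.
    have tn : t / n.+2%:R < t by rewrite gtr_pMr// invf_lt1// ltr1n.
    have tn0 : 0 < t / n.+2%:R by rewrite divr_gt0.
    by rewrite tn0 tn subr_gt0 tn ltrBlDr ltrDl tn0; split.
  - move=> n; rewrite lerBrDr -mulrDr ger_pMr//.
    by rewrite [leRHS](splitr 1) mul1r lerD.
  - move=> x /=; rewrite in_itv/= => /andP[x0 xt].
    have [n Hn] : exists n : nat, t / n.+2%:R <= Num.min x (t - x).
      have m0 : 0 < Num.min x (t - x) by rewrite lt_min x0 subr_gt0.
      exists (Num.trunc (t / Num.min x (t - x))).
      rewrite ler_pdivrMr// mulrC -ler_pdivrMr//.
      apply/ltW/(lt_trans (truncnS_gt _)); rewrite ltr_nat//.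
    exists n; move: Hn; rewrite le_min => /andP[-> /=].
    by rewrite !lerBrDr addrC.
  - apply/seteqP; split => y /=.
      move=> [x]; rewrite !in_itv/= => /andP[x0 xt] <-; rewrite andbT /phi.
      rewrite ltr_pM2l// ltf_pV2 ?posrE ?subr_gt0//.
      by rewrite ltrBlDr ltrDl.
    rewrite in_itv/= andbT => Aty.
    have y0 : 0 < y by apply: lt_trans Aty; rewrite divr_gt0.
    exists (t - A / y); last first.
      by rewrite /phi opprB addrCA subrr addr0 invf_div mulrCA divff ?mulr1// gt_eqF.
    rewrite in_itv/= subr_gt0 ltrBlDr ltrDl divr_gt0// andbT.
    by move: Aty; rewrite !ltr_pdivrMr// mulrC.
  - move=> x y /=; rewrite !in_itv/= => /andP[x0 xt] /andP[y0 yt] xy.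
    rewrite /phi ltr_pM2l// ltf_pV2 ?posrE ?subr_gt0//.
    by rewrite ltrD2l ltrN2.
  - move=> x /=; rewrite in_itv/= => /andP[x0 xt].
    have tx0 : t - x != 0 by rewrite subr_eq0 gt_eqF.
    rewrite /phi; apply: is_derive_eq.
    by rewrite add0r mul1r /GRing.scale/= mulrN1 opprK.
  - move=> x /=; rewrite in_itv/= => /andP[x0 xt].
    apply: cvgM; first exact: cvg_cst.
    apply: cvgV; first by rewrite expf_neq0// subr_eq0 gt_eqF.
    by apply: (@cvg_comp _ _ _ (fun s => t - s) (fun s => s ^+ 2));
      [apply: cvgB; [exact: cvg_cst|exact: cvg_id]|exact: exprn_continuous].
  - by move=> x _; rewrite divr_ge0 ?sqr_ge0// ltW.
  - move=> y /=; rewrite in_itv/= andbT => Aty; apply: continuous_gamma_density.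
    by apply: lt_trans Aty; rewrite divr_gt0.
  - by move=> y _; exact: gamma_density_ge0.
  - exact: measurable_gamma_density.
rewrite -ge0_integralZl//=; last 3 first.
- apply/measurable_EFinP; apply: measurable_funTS; apply: measurable_funM.
    apply: measurableT_comp; first exact: measurable_gamma_density.
    apply: measurable_funM => //; apply: measurableT_comp => //=.
      exact: measurable_invr.
    exact: measurable_funB.
  apply: measurable_funM => //; apply: measurableT_comp => //=.
    exact: measurable_invr.
  by apply: measurable_funX; exact: measurable_funB.
- by move=> x _; rewrite lee_fin mulr_ge0 ?gamma_density_ge0// divr_ge0 ?sqr_ge0// ltW.
- by rewrite lee_fin powR_ge0.
apply: eq_integral => x; rewrite inE/= in_itv/= => /andP[x0 xt].
have tx0 : 0 < t - x by rewrite subr_gt0.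
rewrite -EFinM; congr EFin; rewrite /gamma_density /phi /dphi.
set e := expR _; set s := t - x in tx0 *.
have s0 : s != 0 by rewrite gt_eqF.
have A0' : A != 0 by rewrite gt_eqF.
have -> : (A / s) `^ (al - 2) = A `^ (al - 2) * s `^ (2 - al).
  rewrite powRM ?invr_ge0 ?(ltW A0) ?(ltW tx0)//.
  by rewrite -powR_inv1 ?(ltW tx0)// -powRrM mulN1r opprB.
have EA : A `^ (1 - al) * A `^ (al - 2) * A = 1.
  rewrite -[X in _ * X]powRr1 ?(ltW A0)// -!powRD ?A0' ?implybT//.
  by rewrite (_ : _ + _ = 0) ?powRr0//; ring.
have Es : s `^ (- al) = s `^ (2 - al) / s ^+ 2.
  rewrite -(powR_mulrn 2 (ltW tx0)) -powRN -powRD ?s0 ?implybT//.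
  by congr (_ `^ _); ring.
transitivity ((A `^ (1 - al) * A `^ (al - 2) * A) * (s `^ (2 - al) / s ^+ 2 * e)).
  by rewrite EA mul1r Es.
by ring.
Qed.

Lemma integral_gamma_density_sqr (m : nat) :
  (\int[mu]_(xi in `]0%R, +oo[) (gamma_density (m.+1%:R / 2 - 1) xi)%:E =
   2%:E * \int[mu]_(r in `]0%R, +oo[) (r ^+ m * expR (- r ^+ 2))%:E)%E.
Proof.
have mG := measurable_gamma_density.
transitivity (\int[mu]_(r in `]0%R, +oo[)
    (gamma_density (m.+1%:R / 2 - 1) (r ^+ 2) * (2 * r))%:E)%E.
  apply: (@ge0_substitution _ _ _ (fun n => n.+1%:R^-1) (fun n => n.+1%:R)).
  - exact: interval_open.
  - exact: interval_is_interval.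
  - exact: interval_is_interval.
  - by move=> n k nk; rewrite lef_pV2 ?posrE// ler_nat.
  - by move=> n k nk; rewrite ler_nat.
  - by move=> n; rewrite /= !in_itv/= invr_gt0 !ltr0Sn.
  - move=> n; apply: (@le_trans _ _ 1); last by rewrite ler1n.
    by rewrite invf_le1 ?ltr0Sn// ler1n.
  - move=> x /=; rewrite in_itv/= andbT => x0.
    exists (Num.trunc (Num.max x x^-1)).
    have := truncnS_gt (Num.max x x^-1).
    rewrite gt_max => /andP[/ltW -> xn]; rewrite andbT.
    by rewrite invf_ple ?posrE// ltW.
  - apply/seteqP; split => y /=.
      by move=> [x]; rewrite !in_itv/= !andbT => x0 <-; rewrite exprn_gt0.
    rewrite in_itv/= andbT => y0; exists (Num.sqrt y).
      by rewrite in_itv/= andbT sqrtr_gt0.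
    by rewrite sqr_sqrtr// ltW.
  - move=> x y /=; rewrite !in_itv/= !andbT => x0 y0 xy.
    by rewrite ltrXn2r// ltW.
  - move=> x _; apply: is_derive_eq.
    by rewrite /GRing.scale/= mulr1 mulr_natl.
  - move=> x _; apply: cvgM; [exact: cvg_cst|exact: cvg_id].
  - by move=> x /=; rewrite in_itv/= andbT => x0; rewrite mulr_ge0// ltW.
  - by move=> y /=; rewrite in_itv/= andbT; exact: continuous_gamma_density.
  - by move=> y _; exact: gamma_density_ge0.
  - exact: mG.
rewrite -ge0_integralZl//=; last 2 first.
- apply/measurable_EFinP/measurable_funTS; apply: measurable_funM.
    exact: measurable_funX.
  apply: measurableT_comp; first exact: measurable_expR.
  by apply: measurableT_comp => //; exact: measurable_funX.
- move=> x /=; rewrite in_itv/= andbT => x0.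
  by rewrite lee_fin mulr_ge0 ?expR_ge0// exprn_ge0// ltW.
apply: eq_integral => x; rewrite inE/= in_itv/= andbT => x0.
rewrite -EFinM; congr EFin; rewrite /gamma_density.
rewrite -(powR_mulrn 2 (ltW x0)) -powRrM.
have -> : 2 * (m.+1%:R / 2 - 1) = m%:R - 1 :> R by rewrite -natr1; field.
have -> : x ^+ m = x `^ (m%:R - 1) * x.
  rewrite -[X in _ * X]powRr1 ?(ltW x0)// -powRD ?(gt_eqF x0) ?implybT//.
  by rewrite subrK powR_mulrn// ltW.
rewrite powR_mulrn ?(ltW x0)//; ring.
Qed.

Lemma integral_tan (h : R -> R) : measurable_fun setT h ->
  (forall r, 0 < r -> {for r, continuous h}) -> (forall r, 0 < r -> 0 <= h r) ->
  (\int[mu]_(r in `]0%R, +oo[) (h r)%:E =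
   \int[mu]_(theta in `]0%R, (pi / 2)%R[) (h (tan theta) / cos theta ^+ 2)%:E)%E.
Proof.
move=> mh ch h0.
have p0 : 0 < pi / 2 :> R by rewrite divr_gt0// pi_gt0.
have n20 (n : nat) : (0 : R) < n.+2%:R by rewrite ltr0n.
have n21 (n : nat) : n.+2%:R^-1 <= (2^-1 : R) by rewrite lef_pV2 ?posrE// ler_nat.
set t : R := pi / 2 in p0 *.
have cp x : 0 < x -> x < t -> 0 < cos x.
  by move=> x0 xt; apply: cos_gt0_pihalf; rewrite xt (lt_trans _ x0)// oppr_lt0.
have ItI x : 0 < x -> x < t -> x \in `](- t), t[.
  by move=> x0 xt; rewrite in_itv/= xt (lt_trans _ x0)// oppr_lt0.
have I0 : (0 : R) \in `](- t), t[ by rewrite in_itv/= p0 oppr_lt0 p0.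
apply: (@ge0_substitution _ `]0, t[%classic _
    (fun n => t / n.+2%:R) (fun n => t - t / n.+2%:R)).
- exact: interval_open.
- exact: interval_is_interval.
- exact: interval_is_interval.
- by move=> n k nk; rewrite ler_pM2l// lef_pV2 ?posrE// ler_nat.
- by move=> n k nk; rewrite lerD2l lerN2 ler_pM2l// lef_pV2 ?posrE// ler_nat.
- move=> n; rewrite /= !in_itv/=.
  have tn : t / n.+2%:R < t by rewrite gtr_pMr// invf_lt1// ltr1n.
  have tn0 : 0 < t / n.+2%:R by rewrite divr_gt0.
  by rewrite tn0 tn subr_gt0 tn ltrBlDr ltrDl tn0; split.
- move=> n; rewrite lerBrDr -mulrDr ger_pMr//.
  by rewrite [leRHS](splitr 1) mul1r lerD.
- move=> x /=; rewrite in_itv/= => /andP[x0 xt].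
  have [n Hn] : exists n : nat, t / n.+2%:R <= Num.min x (t - x).
    have m0 : 0 < Num.min x (t - x) by rewrite lt_min x0 subr_gt0.
    exists (Num.trunc (t / Num.min x (t - x))).
    rewrite ler_pdivrMr// mulrC -ler_pdivrMr//.
    apply/ltW/(lt_trans (truncnS_gt _)); rewrite ltr_nat//.
  exists n; move: Hn; rewrite le_min => /andP[-> /=].
  by rewrite !lerBrDr addrC.
- apply/seteqP; split => y /=.
    move=> [x]; rewrite !in_itv/= => /andP[x0 xt] <-; rewrite andbT.
    by rewrite -[X in X < _](@tan0 R) (ltr_tan I0) ?ItI.
  rewrite in_itv/= andbT => y0; exists (atan y); last by rewrite atanK.
  rewrite in_itv/= atan_ltpi2.
  rewrite andbT -(ltr_tan I0) ?tan0 ?atanK//.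
  by rewrite in_itv/= atan_gtNpi2 atan_ltpi2.
- move=> x y /=; rewrite !in_itv/= => /andP[x0 xt] /andP[y0 yt] xy.
  by rewrite ltr_tan ?ItI.
- move=> x /=; rewrite in_itv/= => /andP[x0 xt].
  by apply: is_derive_tan; rewrite gt_eqF// cp.
- move=> x /=; rewrite in_itv/= => /andP[x0 xt].
  apply: cvgV; first by rewrite expf_neq0// gt_eqF// cp.
  by apply: (@cvg_comp _ _ _ cos (fun s => s ^+ 2));
    [exact: continuous_cos|exact: exprn_continuous].
- by move=> x _; rewrite invr_ge0 sqr_ge0.
- by move=> y /=; rewrite in_itv/= andbT; exact: ch.
- by move=> y /=; rewrite in_itv/= andbT; exact: h0.
- exact: mh.
Qed.

End substitution_instances.

(** * Polar coordinates *)

Section euclidean_facts.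
Context {R : realType}.
Local Notation RT := (measurableTypeR R).
Implicit Types n : nat.

Lemma dotpC n (x y : 'rV[R]_n) : dotp x y = dotp y x.
Proof. by apply: eq_bigr => i _; rewrite mulrC. Qed.

Lemma dotpDl n (x y z : 'rV[R]_n) : dotp (x + y) z = dotp x z + dotp y z.
Proof. by rewrite -big_split/=; apply: eq_bigr => i _; rewrite mxE mulrDl. Qed.

Lemma dotpZl n c (x y : 'rV[R]_n) : dotp (c *: x) y = c * dotp x y.
Proof. by rewrite mulr_sumr; apply: eq_bigr => i _; rewrite mxE mulrA. Qed.

Lemma dotpDr n (x y z : 'rV[R]_n) : dotp z (x + y) = dotp z x + dotp z y.
Proof. by rewrite dotpC dotpDl !(dotpC _ z). Qed.

Lemma dotpZr n c (x y : 'rV[R]_n) : dotp y (c *: x) = c * dotp y x.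
Proof. by rewrite dotpC dotpZl (dotpC y). Qed.

Lemma dotp_delta n (x : 'rV[R]_n) i : dotp x (delta_mx 0 i) = x 0 i.
Proof.
rewrite /dotp (bigD1 i)//= mxE !eqxx mulr1 big1 ?addr0// => j ji.
by rewrite mxE (negbTE ji) andbF mulr0.
Qed.

Lemma dotp_ge0 n (x : 'rV[R]_n) : 0 <= dotp x x.
Proof. by apply: sumr_ge0 => i _; rewrite -expr2 sqr_ge0. Qed.

Lemma enorm_ge0 n (x : 'rV[R]_n) : 0 <= enorm x.
Proof. exact: sqrtr_ge0. Qed.

Lemma enorm_sqr n (x : 'rV[R]_n) : enorm x ^+ 2 = dotp x x.
Proof. by rewrite sqr_sqrtr// dotp_ge0. Qed.

Lemma enormZ n c (x : 'rV[R]_n) : enorm (c *: x) = `|c| * enorm x.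
Proof. by rewrite /enorm dotpZl dotpZr mulrA -expr2 sqrtrM ?sqr_ge0// sqrtr_sqr. Qed.

Lemma ler_coord_enorm n (x : 'rV[R]_n) i : `|x 0 i| <= enorm x.
Proof.
rewrite -sqrtr_sqr ler_wsqrtr// /dotp (bigD1 i)//= expr2 lerDl.
by apply: sumr_ge0 => j _; rewrite -expr2 sqr_ge0.
Qed.

Lemma enorm_eq0 n (x : 'rV[R]_n) : (enorm x == 0) = (x == 0).
Proof.
apply/eqP/eqP => [x0|->]; last first.
  by rewrite /enorm /dotp big1 ?sqrtr0// => i _; rewrite mxE mul0r.
apply/rowP => i; rewrite mxE; apply/eqP; rewrite -normr_le0 -x0.
exact: ler_coord_enorm.
Qed.

Lemma cauchy_schwarz n (x y : 'rV[R]_n) : `|dotp x y| <= enorm x * enorm y.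
Proof.
have [->|y0] := eqVneq y 0.
  rewrite (_ : dotp x 0 = 0) ?normr0 ?mulr_ge0 ?enorm_ge0//.
  by rewrite /dotp big1// => i _; rewrite mxE mulr0.
have y2 : 0 < dotp y y by rewrite -enorm_sqr exprn_gt0// lt0r enorm_eq0 y0 enorm_ge0.
rewrite -sqrtr_sqr -sqrtrM ?dotp_ge0// ler_wsqrtr//.
have := dotp_ge0 (dotp y y *: x + (- dotp x y) *: y).
rewrite !(dotpDl, dotpDr, dotpZl, dotpZr) (dotpC y x).
rewrite (_ : _ + _ = dotp y y * (dotp x x * dotp y y - dotp x y ^+ 2)); last by ring.
by rewrite pmulr_rge0// subr_ge0.
Qed.

Lemma ler_enormD n (x y : 'rV[R]_n) : enorm (x + y) <= enorm x + enorm y.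
Proof.
rewrite -(ler_pXn2r (_ : (0 < 2)%N)) ?nnegrE ?addr_ge0 ?enorm_ge0//.
rewrite enorm_sqr dotpDl !dotpDr (dotpC y x) sqrrD !enorm_sqr.
have := cauchy_schwarz x y; have := ler_norm (dotp x y); lra.
Qed.

Lemma enorm_to_rV_sqr n (s : n.-tuple RT) :
  enorm (to_rV s) ^+ 2 = \sum_(i < n) tnth s i ^+ 2.
Proof. by rewrite enorm_sqr; apply: eq_bigr => i _; rewrite !mxE expr2. Qed.

Lemma to_rV_normalize n (s : n.-tuple RT) :
  to_rV (normalize s) = (enorm (to_rV s))^-1 *: to_rV s.
Proof. by apply/rowP => i; rewrite !mxE tnth_mktuple mulrC. Qed.

Lemma to_rV_scale n c (s : n.-tuple RT) :
  to_rV (affine (fun=> c) (fun=> 0) s) = c *: to_rV s.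
Proof. by apply/rowP => i; rewrite !mxE tnth_mktuple addr0. Qed.

Lemma enorm_normalize n (s : n.-tuple RT) : enorm (to_rV s) != 0 ->
  enorm (to_rV (normalize s)) = 1.
Proof.
move=> s0; rewrite to_rV_normalize enormZ ger0_norm ?invr_ge0 ?enorm_ge0//.
by rewrite mulVf.
Qed.

Lemma measurable_dotp n (z : 'rV[R]_n) :
  measurable_fun setT (fun s : n.-tuple RT => dotp (to_rV s) z).
Proof.
apply: measurable_sum => i; apply: measurable_funM => //=.
by under eq_fun do rewrite mxE; exact: measurable_tnth.
Qed.

Lemma measurable_ltr_nat d (T : measurableType d) (f g : T -> R) :
  measurable_fun setT f -> measurable_fun setT g ->
  measurable_fun setT (fun x => (f x < g x)%R%:R : R).
Proof.
move=> mf mg.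
rewrite (_ : (fun _ => _) = fun x => if f x < g x then 1 else 0 : R); last first.
  by apply/funext => x; case: ifP.
by apply: measurable_fun_ifT => //; exact: measurable_fun_ltr.
Qed.

Lemma integral_affine1 (c d : R) (f : RT -> \bar R) : c != 0 ->
  measurable_fun setT f -> (forall x, 0 <= f x)%E ->
  (`|c|%:E * \int[@lebesgue_measure R]_x f (c * x + d)%R =
   \int[@lebesgue_measure R]_x f x)%E.
Proof.
move=> c0 mf f0.
pose nu := mscale (NngNum (normr_ge0 c))
  (image_measure (@lebesgue_measure R) (measurable_affine c d)).
transitivity (\int[nu]_x f x)%E.
  rewrite ge0_integral_mscale//=.
  by rewrite ge0_integral_pushforward//=; exact: measurable_affine.
by apply: eq_measure_integral => A mA _; exact: lebesgue_measure_affine.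
Qed.

Lemma lebesgue_tuple_singleton n (s : n.+1.-tuple RT) :
  lebesgue_tuple R n.+1 [set s] = 0%E.
Proof.
rewrite (_ : [set s] = box (fun i => [set tnth s i])).
  by rewrite lebesgue_tuple_boxE// big_ord_recl lebesgue_measure_set1 mul0e.
apply/seteqP; split => [x -> //|x xs] /=.
by apply: eq_from_tnth => i; exact: xs.
Qed.

Lemma lebesgue_unit_ball_lty n : (lebesgue_tuple R n (unit_ball n) < +oo)%E.
Proof.
apply: (@le_lt_trans _ _ (lebesgue_tuple R n (box (fun=> `[-1, 1]%classic)))).
  apply: le_measure; rewrite ?inE; [exact: measurable_unit_ball|exact: measurable_box|].
  move=> s /= s1 i; rewrite /= in_itv/= -ler_norml.
  apply: le_trans (ltW s1); have := ler_coord_enorm (to_rV s) i.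
  by rewrite mxE.
rewrite lebesgue_tuple_boxE// (eq_bigr (fun=> 2%:E)) ?prodEFin ?ltry//.
move=> i _; rewrite lebesgue_measure_itv/= lte_fin ifT; last by lra.
by rewrite -EFinB; congr EFin; ring.
Qed.

End euclidean_facts.

Section radial.
Context {R : realType}.
Local Notation RT := (measurableTypeR R).
Local Notation mu := (@lebesgue_measure R).

Definition ball_volume n : R := fine (lebesgue_tuple R n (unit_ball n)).

Lemma ball_volumeE n : (ball_volume n)%:E = lebesgue_tuple R n (unit_ball n).
Proof.
by rewrite fineK// ge0_fin_numE ?measure_ge0//; exact: lebesgue_unit_ball_lty.
Qed.

Lemma integral_scale n (c : R) (f : n.-tuple RT -> \bar R) : c != 0 ->
  measurable_fun setT f -> (forall s, 0 <= f s)%E ->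
  ((`|c| ^+ n)%:E * \int[lebesgue_tuple R n]_s f (affine (fun=> c) (fun=> 0%R) s) =
   \int[lebesgue_tuple R n]_s f s)%E.
Proof.
move=> c0 mf f0; rewrite -(@integral_affine R n (fun=> c) (fun=> 0) f)//.
by rewrite prodr_const card_ord.
Qed.

Lemma integral_pos_exprn n (b : R) : 0 < b ->
  (\int[mu]_(r in `[0%R, b]) (r ^+ n)%:E = (b ^+ n.+1 / n.+1%:R)%:E)%E.
Proof.
move=> b0.
pose F (r : R) : R := n.+1%:R^-1 * r ^+ n.+1.
have dF (x : R) : is_derive x 1 F (x ^+ n).
  have dX : is_derive x 1 (fun r : R => r ^+ n.+1) (n.+1%:R * x ^+ n).
    apply: DeriveDef; first exact: exprn_derivable.
    by rewrite exp_derive /GRing.scale/= mulr1.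
  apply: (is_derive_eq (is_deriveZ n.+1%:R^-1 dX)).
  by rewrite /GRing.scale/= mulKf// pnatr_eq0.
rewrite (@continuous_FTC2 _ _ F)//.
- by rewrite /F expr0n/= mulr0 -EFinB subr0 mulrC.
- by apply: continuous_subspaceT => x; exact: exprn_continuous.
- have cF (x : R) : {for x, continuous F}.
    apply: differentiable_continuous; apply/derivable1_diffP.
    by have [] := dF x.
  split; first by move=> x _; have [] := dF x.
    by apply: cvg_at_right_filter; exact: cF.
  by apply: cvg_at_left_filter; exact: cF.
- by move=> x _; rewrite derive1E; have [_ ->] := dF x.
Qed.

(* The exterior of the unit ball is weighted by the radial function
   [|v|^(-m-1)]: inserting [1 = int_0^oo 1(s < |w|) / |w| ds] and substituting
   [w = s v], [r = s |v|] separates the radial and angular variables. *)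
Definition radial_const m : \bar R :=
  (\int[lebesgue_tuple R m]_v
    ((1 < enorm (to_rV v))%R%:R * (enorm (to_rV v) ^+ m.+1)^-1)%:E)%E.

Lemma integral_radial_const m (h : R -> R) :
  measurable_fun setT h -> (forall r, 0 <= h r) ->
  (\int[lebesgue_tuple R m.+1]_w (h (enorm (to_rV w)))%:E =
   radial_const m.+1 * \int[mu]_(r in `]0%R, +oo[) (h r * r ^+ m)%:E)%E.
Proof.
move=> mh h0.
set L := lebesgue_tuple R m.+1.
pose N (w : m.+1.-tuple RT) := enorm (to_rV w).
have mN : measurable_fun setT N by exact: measurable_enorm.
have N0 w : 0 <= N w by exact: enorm_ge0.
pose f (z : m.+1.-tuple RT * RT) : R :=
  h (N z.1) * (N z.1)^-1 * ((0 < z.2)%R%:R * (z.2 < N z.1)%R%:R).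
have mf : measurable_fun setT f.
  apply: measurable_funM.
    apply: measurable_funM.
      by apply: measurableT_comp => //; apply: measurableT_comp.
    by apply: (measurableT_comp measurable_invr); apply: measurableT_comp.
  apply: measurable_funM; apply: measurable_ltr_nat => //.
  by apply: measurableT_comp.
have f0 z : 0 <= f z by rewrite !mulr_ge0 ?invr_ge0.
pose g (z : m.+1.-tuple RT * RT) : R :=
  ((1 < N z.1)%R%:R * (N z.1)^-1) * ((0 < z.2)%R%:R * (z.2 ^+ m * h (z.2 * N z.1))).
have mg : measurable_fun setT g.
  apply: measurable_funM.
    apply: measurable_funM.
      by apply: measurable_ltr_nat => //; apply: measurableT_comp.
    by apply: (measurableT_comp measurable_invr); apply: measurableT_comp.
  apply: measurable_funM; first exact: measurable_ltr_nat.
  apply: measurable_funM; first exact: measurable_funX.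
  apply: measurableT_comp => //; apply: measurable_funM => //.
  by apply: measurableT_comp.
have g0 z : 0 <= g z.
  rewrite /g; have [s0|s0] := ltP 0 z.2; last by rewrite mul0r mulr0.
  by rewrite !mulr_ge0 ?invr_ge0 ?exprn_ge0// ltW.
pose H (r : R) : R := (0 < r)%R%:R * (r ^+ m * h r).
have mH : measurable_fun setT H.
  apply: measurable_funM; first exact: measurable_ltr_nat.
  by apply: measurable_funM => //; exact: measurable_funX.
have H0 r : 0 <= H r.
  rewrite /H; have [s0|s0] := ltP 0 r; last by rewrite mul0r.
  by rewrite !mulr_ge0 ?exprn_ge0// ltW.
have HE : (\int[mu]_(r in `]0%R, +oo[) (h r * r ^+ m)%:E = \int[mu]_r (H r)%:E)%E.
  rewrite integral_mkcond; apply: eq_integral => r _.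
  rewrite patchE /H (mulrC (r ^+ m)).
  have [r0|r0] := ltP 0 r; first by rewrite mem_set ?mul1r//= in_itv/= r0.
  rewrite memNset ?mul0r//= in_itv/= andbT.
  by apply/negP; rewrite -leNgt.
have E1 : (\int[L]_w (h (N w))%:E = \int[L]_w \int[mu]_s (f (w, s))%:E)%E.
  have mO : measurable [set w | N w = 0].
    rewrite (_ : [set w | _] = N @^-1` [set 0])//.
    by rewrite -[X in measurable X]setTI; exact: mN.
  have O0 : L [set w | N w = 0] = 0%E.
    rewrite (_ : [set w | _] = [set [tuple 0 | i < m.+1]]).
      exact: lebesgue_tuple_singleton.
    apply/seteqP; split => w /=.
      move=> /eqP; rewrite /N enorm_eq0 => /eqP/rowP w0.
      by apply: eq_from_tnth => i; have := w0 i; rewrite !mxE tnth_mktuple.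
    move=> ->; apply/eqP; rewrite /N enorm_eq0; apply/eqP/rowP => i.
    by rewrite !mxE tnth_mktuple.
  rewrite (ge0_negligible_integral mO)//; last 2 first.
  - by apply/measurable_EFinP; apply: measurableT_comp.
  - by move=> w _; rewrite lee_fin.
  rewrite [RHS](ge0_negligible_integral mO)//; last 2 first.
  - by apply: (@measurable_fun_fubini_tonelli_F _ _ _ _ _ mu (EFin \o f)) => //; exact/measurable_EFinP.
  - by move=> w _; apply: integral_ge0 => s _; rewrite lee_fin.
  apply: eq_integral => w; rewrite inE/= => -[_ /eqP w0].
  have Nw : 0 < N w by rewrite lt0r w0 N0.
  rewrite (_ : (fun s => _) = fun s => ((h (N w) / N w)%:E * (\1_(`]0, N w[) s)%:E))%E; last first.
    apply/funext => s; rewrite -EFinM; congr EFin; congr (_ * _).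
    rewrite indicE (_ : (s \in _) = (0 < s) && (s < N w)); last first.
      by apply/idP/idP; rewrite inE/= in_itv.
    by case: (0 < s); case: (s < N w); rewrite /= ?mulr0 ?mul0r ?mulr1.
  rewrite ge0_integralZl//; last 2 first.
  - by apply/measurable_EFinP; exact: measurable_indic.
  - by rewrite lee_fin divr_ge0.
  have muE : mu (`]0, N w[%classic : set RT) = (N w)%:E.
    by rewrite lebesgue_measure_itv/= lte_fin Nw sube0.
  rewrite integral_indic// setIT; apply: (eq_trans _ (congr1 _ (esym muE))).
  by rewrite -EFinM divfK ?gt_eqF.
have E2 : (\int[L]_w \int[mu]_s (f (w, s))%:E = \int[mu]_s \int[L]_w (f (w, s))%:E)%E.
  by apply: (@fubini_tonelli _ _ _ _ _ L mu (EFin \o f)) => //; exact/measurable_EFinP.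
have E3 : (\int[mu]_s \int[L]_w (f (w, s))%:E = \int[mu]_s \int[L]_w (g (w, s))%:E)%E.
  apply: eq_integral => s _; have [s0|s0] := ltP 0 s; last first.
    apply: eq_integral => w _; rewrite /f /g /= [(0 < s)%R]ltNge s0/=.
    by rewrite !mul0r !mulr0.
  rewrite -(@integral_scale m.+1 s (fun w => (f (w, s))%:E)) ?gt_eqF//; last 2 first.
  - by apply/measurable_EFinP; exact: measurable_fun_pair1.
  - by move=> w; rewrite lee_fin.
  rewrite -ge0_integralZl//; last 2 first.
  - apply/measurable_EFinP.
    apply: (@measurableT_comp _ _ _ _ _ _ f _ (fun w => (affine (fun=> s) (fun=> 0) w, s))) => //.
    by apply: measurable_fun_pair => //; exact: measurable_affine_tuple.
  - by move=> w _; rewrite lee_fin.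
  apply: eq_integral => w _; rewrite -EFinM; congr EFin.
  rewrite /f /g /= /N to_rV_scale enormZ gtr0_norm// s0 mul1r.
  rewrite ltr_pMr// invfM exprS.
  rewrite [true%:R]mulr1n mul1r; set N' := enorm _; set b := (1 < N')%R%:R; set c := h _.
  rewrite (_ : s * s ^+ m * _ = (s * s^-1) * (s ^+ m * c * N'^-1 * b)); last by ring.
  by rewrite divff ?gt_eqF// mul1r; ring.
have E4 : (\int[mu]_s \int[L]_w (g (w, s))%:E = \int[L]_w \int[mu]_s (g (w, s))%:E)%E.
  by apply/esym; apply: (@fubini_tonelli _ _ _ _ _ L mu (EFin \o g)) => //; exact/measurable_EFinP.
rewrite E1 E2 E3 E4 HE /radial_const -ge0_integralZr//; last 3 first.
- apply/measurable_EFinP; apply: measurable_funM; first exact: measurable_ltr_nat.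
  by apply: (measurableT_comp measurable_invr); exact: measurable_funX.
- by move=> v _; rewrite lee_fin mulr_ge0// invr_ge0 exprn_ge0// enorm_ge0.
- by apply: integral_ge0 => r _; rewrite lee_fin.
apply: eq_integral => v _; rewrite -/(N v).
have [v1|v1] := ltP 1 (N v); last first.
  rewrite mul0r mul0e integral0_eq// => s _.
  by rewrite /g/= ltNge v1 !mul0r.
have Nv0 : 0 < N v by apply: lt_trans v1.
have Nv1 : N v != 0 by rewrite gt_eqF.
rewrite -(@integral_affine1 _ (N v) 0 (fun r => (H r)%:E))//; last exact/measurable_EFinP.
rewrite muleA -EFinM -ge0_integralZl//; last 3 first.
- apply/measurable_EFinP; apply: (measurableT_comp mH); exact: measurable_affine.
- by move=> r _; rewrite lee_fin.
- by rewrite lee_fin !mulr_ge0// invr_ge0 exprn_ge0.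
apply: eq_integral => s _; rewrite -EFinM; congr EFin.
rewrite /g /H /= v1 addr0 pmulr_rgt0// exprMn gtr0_norm// (mulrC s).
rewrite [true%:R]mulr1n; set b := (0 < s)%R%:R; set c := h _.
rewrite !exprS; have : N v ^+ m != 0 by rewrite expf_neq0.
move: (N v ^+ m) (s ^+ m) (N v) Nv1 b c => X Y Z Z0 b c X0.
by field; rewrite X0 Z0.
Qed.

Lemma radial_constE m : radial_const m.+1 = (m.+1%:R * ball_volume m.+1)%:E.
Proof.
have := @integral_radial_const m (fun r => (r < 1)%R%:R).
rewrite (_ : (\int[mu]_(r in _) _)%E = (m.+1%:R^-1)%:E); last first.
  rewrite (_ : _^-1 = 1 ^+ m.+1 / m.+1%:R); last by rewrite expr1n mul1r.
  rewrite -(integral_pos_exprn _ (ltr01))//.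
  rewrite -integral_itv_bndo_bndc//; last first.
    by apply/measurable_EFinP/measurable_funTS; exact: measurable_funX.
  rewrite -integral_itv_obnd_cbnd//; last first.
    by apply/measurable_EFinP/measurable_funTS; exact: measurable_funX.
  rewrite integral_mkcond [RHS]integral_mkcond; apply: eq_integral => r _.
  rewrite !patchE !mem_setE !in_itv/= andbT.
  by case: (0 < r) => //=; case: (r < 1); rewrite ?mul1r ?mul0r.
rewrite (_ : (\int[lebesgue_tuple R _]_w _)%E = (ball_volume m.+1)%:E); last first.
  rewrite ball_volumeE -[RHS]mul1e -integral_cst.
  rewrite [RHS]integral_mkcond; apply: eq_integral => w _.
  rewrite patchE (_ : (w \in _) = (enorm (to_rV w) < 1)).
    by case: (_ < 1).
  by apply/idP/idP; rewrite inE.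
  exact: measurable_unit_ball.
move=> H; have {H} : ((ball_volume m.+1)%:E = radial_const m.+1 * (m.+1%:R^-1)%:E)%E.
  by apply: H => //; exact: measurable_ltr_nat.
move=> /(congr1 (fun z => z * m.+1%:R%:E)%E).
by rewrite -muleA -!EFinM mulVf ?mule1 ?pnatr_eq0// mulrC => ->.
Qed.

Lemma integral_radial m (h : R -> R) :
  measurable_fun setT h -> (forall r, 0 <= h r) ->
  (\int[lebesgue_tuple R m.+1]_w (h (enorm (to_rV w)))%:E =
   (m.+1%:R * ball_volume m.+1)%:E * \int[mu]_(r in `]0%R, +oo[) (h r * r ^+ m)%:E)%E.
Proof. by move=> mh h0; rewrite integral_radial_const// radial_constE. Qed.

Lemma integral_gauss_tuple n :
  (\int[lebesgue_tuple R n]_w (expR (- enorm (to_rV w) ^+ 2))%:E =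
   (Num.sqrt pi ^+ n)%:E)%E.
Proof.
have mg k : measurable_fun [set: k.-tuple RT] (fun w => expR (- enorm (to_rV w) ^+ 2)).
  apply: (measurableT_comp (@measurable_expR R)).
  apply: (@measurableT_comp _ _ _ _ _ _ (fun x : R => - x ^+ 2)).
    by apply: measurableT_comp => //; exact: measurable_funX.
  exact: measurable_enorm.
elim: n => [|n IH].
  rewrite integral_dirac//; last by apply/measurable_EFinP; exact: mg.
  by rewrite diracT mul1e enorm_to_rV_sqr big_ord0 oppr0 expR0.
rewrite (@integral_tuple_cons R n (fun w => (expR (- enorm (to_rV w) ^+ 2))%:E))//; last first.
  by apply/measurable_EFinP; exact: mg.
rewrite fubini_tonelli1//; last first.
  apply/measurable_EFinP; apply: (measurableT_comp (mg n.+1)).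
  exact: measurable_cons_pair.
transitivity (\int[mu]_x ((gauss_fun x)%:E * (Num.sqrt pi ^+ n)%:E))%E.
  apply: eq_integral => x _; rewrite -IH /fubini_F -ge0_integralZl//; last 2 first.
  - by apply/measurable_EFinP; exact: mg.
  - by rewrite lee_fin expR_ge0.
  apply: eq_integral => w _; rewrite -EFinM -expRD; congr (expR _)%:E.
  rewrite !enorm_to_rV_sqr big_ord_recl/= opprD; congr (_ - _).
  by apply: eq_bigr => i _; rewrite tnthS.
rewrite ge0_integralZr//.
- by rewrite integralT_gauss -EFinM exprS.
- by apply/measurable_EFinP; exact: measurable_gauss_fun.
- by move=> x _; rewrite lee_fin gauss_fun_ge0.
Qed.

End radial.

(** * The incomplete Gamma function and the unit sphere *)

Section gamma_function.
Context {R : realType}.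
Local Notation RT := (measurableTypeR R).
Local Notation mu := (@lebesgue_measure R).

Lemma gauss_radial m :
  ((m.+1%:R * ball_volume m.+1)%:E *
   \int[mu]_(xi in `]0%R, +oo[) (gamma_density (m.+1%:R / 2 - 1) xi)%:E =
   (2 * Num.sqrt (pi : R) ^+ m.+1)%:E)%E.
Proof.
have mh : measurable_fun setT (fun r : R => expR (- r ^+ 2)).
  apply: (measurableT_comp (@measurable_expR R)).
  by apply: measurableT_comp => //; exact: measurable_funX.
rewrite integral_gamma_density_sqr [RHS]EFinM -integral_gauss_tuple.
rewrite (integral_radial m mh); last by move=> r; exact: expR_ge0.
rewrite [RHS]muleCA; congr (_ * (_ * _))%E.
by apply: eq_integral => r _; rewrite mulrC.
Qed.

Lemma integral_gamma_density_ge0 (D : set R) l : (0 <= \int[mu]_(xi in D) (gamma_density l xi)%:E)%E.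
Proof. by apply: integral_ge0 => x _; rewrite lee_fin gamma_density_ge0. Qed.

Lemma ball_volume_gt0 m : 0 < ball_volume m.+1 :> R.
Proof.
have V0 : 0 <= ball_volume m.+1 :> R by rewrite fine_ge0.
rewrite lt0r V0 andbT; apply/eqP => VE.
have P0 : 0 < 2 * Num.sqrt pi ^+ m.+1 :> R.
  by rewrite mulr_gt0// exprn_gt0// sqrtr_gt0 pi_gt0.
have := gauss_radial m; rewrite VE mulr0 mul0e => /esym [] E.
by rewrite E ltxx in P0.
Qed.

Lemma gamma_half_lty m :
  (\int[mu]_(xi in `]0%R, +oo[) (gamma_density (m.+1%:R / 2 - 1) xi)%:E < +oo)%E.
Proof.
rewrite ltey; apply/eqP => E; have := gauss_radial m; rewrite E.
by rewrite gt0_muley// lte_fin mulr_gt0// ball_volume_gt0.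
Qed.

Lemma gamma_density_lty (l : R) : 0 <= l ->
  (\int[mu]_(xi in `[0%R, +oo[) (gamma_density l xi)%:E < +oo)%E.
Proof.
move=> l0; have mg := measurable_gamma_density.
rewrite -integral_itv_obnd_cbnd; last by apply/measurable_EFinP/measurable_funTS; exact: mg.
set k := Num.trunc l.
have lk : l <= k.+1%:R by rewrite ltW// truncnS_gt.
apply: (@le_lt_trans _ _ (\int[mu]_(xi in `]0%R, +oo[)
   ((gamma_density (2%:R / 2 - 1) xi)%:E + (gamma_density ((k.+1.*2.+2)%:R / 2 - 1) xi)%:E))%E).
  apply: ge0_le_integral => //.
  - by move=> x _; rewrite lee_fin gamma_density_ge0.
  - by apply/measurable_EFinP/measurable_funTS; exact: mg.
  - by apply: emeasurable_funD; apply/measurable_EFinP/measurable_funTS; exact: mg.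
  - move=> x /=; rewrite in_itv/= andbT => x0; rewrite -EFinD lee_fin.
    rewrite divff// subrr (_ : _ / 2 - 1 = k.+1%:R); last first.
      by rewrite -[in LHS]mul2n -addn2 natrD natrM; field.
    rewrite /gamma_density powRr0 -mulrDl ler_wpM2r ?expR_ge0//.
    have [x1|x1] := leP x 1.
      rewrite (@le_trans _ _ 1)//; last by rewrite lerDl powR_ge0.
      rewrite (_ : 1 = 1 `^ l); last by rewrite powR1.
      by rewrite ge0_ler_powR// nnegrE ltW.
    by rewrite (@le_trans _ _ (x `^ k.+1%:R))// ?lerDr// ler_powR// ltW.
rewrite ge0_integralD//.
- by rewrite lte_add_pinfty//; exact: gamma_half_lty.
- by move=> x _; rewrite lee_fin gamma_density_ge0.
- by apply/measurable_EFinP/measurable_funTS; exact: mg.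
- by move=> x _; rewrite lee_fin gamma_density_ge0.
- by apply/measurable_EFinP/measurable_funTS; exact: mg.
Qed.

Lemma upper_gammaE (l s : R) : 0 <= l -> 0 <= s ->
  (upper_gamma l s)%:E = (\int[mu]_(xi in `]s, +oo[) (gamma_density l xi)%:E)%E.
Proof.
move=> l0 s0; have mg := measurable_gamma_density.
rewrite integral_itv_obnd_cbnd; last by apply/measurable_EFinP/measurable_funTS; exact: mg.
rewrite /upper_gamma /Rintegral fineK// ge0_fin_numE ?integral_gamma_density_ge0//.
apply: le_lt_trans (gamma_density_lty l0); apply: ge0_subset_integral => //.
- by apply/measurable_EFinP/measurable_funTS; exact: mg.
- by move=> x _; rewrite lee_fin gamma_density_ge0.
- by apply: subset_itvr; rewrite bnd_simp.
Qed.

Lemma upper_gamma_ge0 (l s : R) : 0 <= upper_gamma l s.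
Proof. by apply: Rintegral_ge0 => x _; exact: gamma_density_ge0. Qed.

Lemma upper_gamma_anti (l s1 s2 : R) : 0 <= l -> 0 <= s1 -> s1 <= s2 ->
  upper_gamma l s2 <= upper_gamma l s1.
Proof.
move=> l0 s10 s12; rewrite -lee_fin (upper_gammaE l0 (le_trans s10 s12)) (upper_gammaE l0 s10).
apply: ge0_subset_integral => //.
- by apply/measurable_EFinP/measurable_funTS; exact: measurable_gamma_density.
- by move=> x _; rewrite lee_fin gamma_density_ge0.
- by apply: subset_itvr; rewrite bnd_simp.
Qed.

Lemma measurable_upper_gamma (l : R) : 0 <= l ->
  measurable_fun setT (fun s : R => upper_gamma l (Num.max s 0)).
Proof.
move=> l0; apply: nonincreasing_measurable => // s1 s2 s12.
apply: upper_gamma_anti => //; first by rewrite le_max lexx orbT.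
by rewrite ge_max !le_max s12 lexx !orbT.
Qed.

Lemma measurable_omega (k l : R) : 0 <= k -> 0 <= l -> measurable_fun setT (omega k l : R -> R).
Proof.
move=> k0 l0.
rewrite (_ : omega k l = fun u => if u == 0 then 0 else
    upper_gamma l (Num.max (k / u ^+ 2) 0)); last first.
  apply/funext => u; rewrite /omega; case: ifP => // _.
  by rewrite max_l// divr_ge0// sqr_ge0.
apply: measurable_fun_ifT => //; first exact: measurable_fun_eqr.
apply: (measurableT_comp (measurable_upper_gamma l0)).
apply: measurable_funM => //; apply: (measurableT_comp measurable_invr).
exact: measurable_funX.
Qed.

Lemma Gamma_half m : m.+1%:R * ball_volume m.+1 * Gamma (m.+1%:R / 2) = 2 * Num.sqrt (pi : R) ^+ m.+1.
Proof.
have mg := measurable_gamma_density.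
apply: EFin_inj; rewrite -gauss_radial EFinM; congr (_ * _)%E.
rewrite /Gamma /upper_gamma /Rintegral fineK.
  by rewrite -integral_itv_obnd_cbnd//; apply/measurable_EFinP/measurable_funTS; exact: mg.
rewrite ge0_fin_numE ?integral_gamma_density_ge0// -integral_itv_obnd_cbnd.
  exact: gamma_half_lty.
by apply/measurable_EFinP/measurable_funTS; exact: mg.
Qed.

Lemma continuous_upper_gamma (l s : R) : 0 <= l -> 0 < s -> {for s, continuous (upper_gamma l)}.
Proof.
move=> l0 s0; have mg := @measurable_gamma_density R.
have iy : mu.-integrable (`[0, +oo[%classic : set R) (EFin \o gamma_density l).
  apply/integrableP; split; first by apply/measurable_EFinP/measurable_funTS; exact: mg.
  under eq_integral do rewrite /= ger0_norm ?gamma_density_ge0//.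
  exact: gamma_density_lty.
pose F (x : R) : R := \int[mu]_(xi in [set` `[0, x]]) gamma_density l xi.
have nbhs_gt0 : 0 < s -> \forall x \near s, 0 < x.
  by move=> ?; apply: open_nbhs_nbhs; split; [exact: open_gt|].
have dF : derivable F s 1.
  have [] := @continuous_FTC1 R (gamma_density l) (BLeft 0) s (s + 1) _ _ _ _ => //.
  - by rewrite ltrDl.
  - by apply: integrableS iy => // x /=; rewrite !in_itv/= andbT => /andP[].
  - exact: continuous_gamma_density.
have cF : F x @[x --> s] --> F s.
  by apply: differentiable_continuous; apply/derivable1_diffP.
have UE x : 0 < x -> upper_gamma l x = upper_gamma l 0 - F x.
  move=> x0; rewrite /upper_gamma (@Rintegral_itvB _ (gamma_density l) (BLeft 0) +oo%O).
  - rewrite Rintegral_itv_obnd_cbnd//; apply: integrableS iy => // z /=.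
    by rewrite !in_itv/= !andbT => xz; rewrite ltW// (lt_trans x0).
  - exact: iy.
  - by rewrite bnd_simp ltW.
  - by rewrite bnd_simp.
apply: (@cvg_trans _ ((fun x => upper_gamma l 0 - F x) @ s)).
  apply: near_eq_cvg; near=> x; rewrite [RHS]UE//.
  by near: x; exact: (nbhs_gt0 s0).
by rewrite (UE s s0); exact: (cvgB (cvg_cst _) cF).
Unshelve. all: by end_near. Qed.

End gamma_function.

Section sphere.
Context {R : realType}.
Local Notation RT := (measurableTypeR R).
Local Notation mu := (@lebesgue_measure R).

Lemma measurable_unit_sphere n : measurable (unit_sphere n : set (n.-tuple RT)).
Proof.
rewrite (_ : unit_sphere n = (fun s => enorm (to_rV s)) @^-1` [set 1])//.
rewrite -[X in measurable X]setTI; exact: measurable_enorm.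
Qed.

Lemma integral_sphere m (F : m.+1.-tuple RT -> R) :
  measurable_fun setT F -> (forall s, 0 <= F s) ->
  (\int[surface_measure m.+1]_(s in unit_sphere m.+1) (F s)%:E =
   m.+1%:R%:E * \int[lebesgue_tuple R m.+1]_(v in unit_ball m.+1) (F (normalize v))%:E)%E.
Proof.
move=> mF F0; set L := lebesgue_tuple R m.+1.
pose O : m.+1.-tuple RT := [tuple 0 | i < m.+1].
have NO : enorm (to_rV O) = 0.
  by apply/eqP; rewrite enorm_eq0; apply/eqP/rowP => i; rewrite !mxE tnth_mktuple.
have NE v : enorm (to_rV v) = 0 -> v = O.
  move/eqP; rewrite enorm_eq0 => /eqP/rowP v0.
  by apply: eq_from_tnth => i; have := v0 i; rewrite !mxE tnth_mktuple.
pose N' v := if (enorm (to_rV v) < 1)%R then normalize v else O.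
have mN' : measurable_fun setT N'.
  apply: measurable_fun_ifT => //; last exact: measurable_normalize.
  by apply: measurable_fun_ltr => //; exact: measurable_enorm.
have n0 : (0 : R) <= m.+1%:R by [].
transitivity (\int[mscale (NngNum n0) (image_measure L mN')]_(s in unit_sphere m.+1) (F s)%:E)%E.
  apply: eq_measure_integral => A mA AS.
  rewrite -[RHS]/(m.+1%:R%:E * L (N' @^-1` A))%E; congr (_ * L _)%E.
  apply/seteqP; split => v; rewrite /unit_ball /N'/=; first by move=> [-> Av].
  case: ifPn => // _ /AS; rewrite /unit_sphere/= NO => /esym/eqP.
  by rewrite oner_eq0.
have mS := @measurable_unit_sphere m.+1.
have mFE : measurable_fun (unit_sphere m.+1) (fun s => (F s)%:E).
  by apply/measurable_EFinP; exact: measurable_funTS.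
have F0' (s : m.+1.-tuple RT) : unit_sphere m.+1 s -> (0 <= (F s)%:E)%E.
  by rewrite lee_fin.
have mFN : measurable_fun setT (fun v => (F (normalize v))%:E).
  by apply/measurable_EFinP; apply: measurableT_comp => //; exact: measurable_normalize.
have key : (\int[L]_(v in N' @^-1` unit_sphere m.+1) ((fun s => (F s)%:E) \o N') v =
    \int[L]_(v in unit_ball m.+1) (F (normalize v))%:E)%E; last first.
  rewrite (@ge0_integral_mscale _ _ R (image_measure L mN') _ mS (NngNum n0) _ mFE F0').
  rewrite (ge0_integral_pushforward mN' L mS mFE); last by move=> y _; rewrite lee_fin.
  by rewrite key.
rewrite [RHS](@ge0_negligible_integral _ _ _ _ _ [set O])//; first last.
- exact: lebesgue_tuple_singleton.
- by move=> v _; rewrite lee_fin.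
- exact: measurable_funTS.
- exact: measurable_unit_ball.
- rewrite (_ : [set O] = (fun v => enorm (to_rV v)) @^-1` [set 0]).
    rewrite -[X in measurable X]setTI; exact: measurable_enorm.
  by apply/seteqP; split => v /=; [move=> ->|exact: NE].
rewrite (_ : _ @^-1` _ = unit_ball m.+1 `\ O).
  apply: eq_integral => v; rewrite inE => -[v1 _].
  by rewrite /N' /= v1.
apply/seteqP; split => v; rewrite /unit_ball /unit_sphere /N' /=.
  case: ifPn => [v1 Nv|_]; last by rewrite NO => /esym/eqP; rewrite oner_eq0.
  split=> // vO; move: Nv; rewrite vO to_rV_normalize NO invr0 scale0r.
  move=> /esym/eqP; have /eqP -> : enorm (0 : 'rV[R]_m.+1) == 0 by rewrite enorm_eq0.
  by rewrite oner_eq0.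
move=> [v1 vO]; rewrite v1 enorm_normalize//; apply/eqP => /NE; exact: vO.
Qed.

Lemma sphere_areaE m : sphere_area m.+1 = m.+1%:R * ball_volume m.+1 :> R.
Proof.
apply: EFin_inj; rewrite EFinM ball_volumeE.
have mS := @measurable_unit_sphere m.+1.
have mB := @measurable_unit_ball R m.+1.
have E : (surface_measure m.+1 (unit_sphere m.+1) =
    m.+1%:R%:E * lebesgue_tuple R m.+1 (unit_ball m.+1))%E.
  have := @integral_sphere m (fun=> 1); rewrite !(integral_cst _ mS) !(integral_cst _ mB).
  by rewrite !mul1e; apply.
rewrite fineK// E -ball_volumeE -EFinM//.
Qed.

Lemma sphere_area_Gamma m :
  sphere_area m.+1 * Gamma (m.+1%:R / 2) = 2 * Num.sqrt (pi : R) ^+ m.+1.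
Proof. by rewrite sphere_areaE Gamma_half. Qed.

End sphere.

Section gnomonic.
Context {R : realType}.
Local Notation RT := (measurableTypeR R).
Local Notation mu := (@lebesgue_measure R).

Lemma integral_abs_exprn m (b : R) : 0 < b ->
  (\int[mu]_h (`|h| ^+ m * (`|h| * b < 1)%R%:R)%:E = (2 / m.+1%:R / b ^+ m.+1)%:E)%E.
Proof.
move=> b0; pose f (h : R) : R := `|h| ^+ m * (`|h| * b < 1)%R%:R.
have mf : measurable_fun setT (EFin \o f).
  apply/measurable_EFinP; apply: measurable_funM.
    by apply: measurable_funX; exact: normr_measurable.
  by apply: measurable_ltr_nat => //; apply: measurable_funM.
have f0 h : (0 <= (f h)%:E)%E by rewrite lee_fin mulr_ge0.
have half : (\int[mu]_(h in `[0%R, +oo[) (f h)%:E = (b^-1 ^+ m.+1 / m.+1%:R)%:E)%E.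
  rewrite -integral_pos_exprn ?invr_gt0//.
  rewrite -[RHS]integral_itv_bndo_bndc//; last first.
    by apply/measurable_EFinP/measurable_funTS; exact: measurable_funX.
  rewrite integral_mkcond [RHS]integral_mkcond; apply: eq_integral => r _.
  rewrite !patchE !mem_setE !in_itv/= andbT /f.
  have [r0|//] := leP 0 r; rewrite /= ger0_norm//.
  rewrite -(@ltr_pdivlMr _ b)// mul1r.
  by case: ifP => _; rewrite ?mulr1 ?mulr0.
rewrite -/(f _) (_ : [set: _] = `]-oo, 0%R[%classic `|` `[0%R, +oo[%classic); last first.
  by apply/seteqP; split => // x _ /=; rewrite !in_itv/= andbT; case: (ltP x 0); [left|right].
rewrite (@ge0_integral_setU _ _ _ mu _ _ _ _ (EFin \o f))//=; last 2 first.
- exact: measurable_funTS.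
- apply/disj_setPS => y [/=]; rewrite !in_itv/= andbT => y1 y2.
  by move: y1; rewrite ltNge y2.
rewrite integral_itv_bndo_bndc; last exact: measurable_funTS.
have -> : (\int[mu]_(x in `]-oo, 0%R]) (f x)%:E =
    \int[mu]_(x in `]-oo, 0%R]) (EFin \o f) (- x)%R)%E.
  by apply: eq_integral => x _; rewrite /f /= normrN.
rewrite -(ge0_integration_by_substitution0 mf)// half -EFinD; congr EFin.
rewrite exprVn; move: (b ^+ _)^-1 (m.+1%:R^-1) => X Y.
by ring.
Qed.

Lemma ge0_integral_eq_off0 (f g : RT -> \bar R) :
  measurable_fun setT f -> measurable_fun setT g ->
  (forall h, 0 <= f h)%E -> (forall h, 0 <= g h)%E ->
  (forall h : R, h != 0 -> f h = g h) -> (\int[mu]_h f h = \int[mu]_h g h)%E.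
Proof.
move=> mf mg f0 g0 fg; apply: ge0_ae_eq_integral => //.
exists [set (0 : R)]; split; [exact: measurable_set1|exact: lebesgue_measure_set1|].
move=> h; apply: contra_notP => /eqP h0 _; exact: fg.
Qed.

Lemma normalize_scale n (c : R) (s : n.-tuple RT) : c != 0 ->
  normalize (affine (fun=> c) (fun=> 0) s) =
  affine (fun=> Num.sg c) (fun=> 0) (normalize s).
Proof.
move=> c0; apply: eq_from_tnth => i; rewrite !tnth_mktuple !addr0.
rewrite to_rV_scale enormZ invfM mulrACA; congr (_ * _).
by rewrite {1}[c]numEsg mulfK// normr_eq0.
Qed.

Lemma snoc_scale n (c : R) (w : n.-tuple RT) :
  snoc (affine (fun=> c) (fun=> 0) w, c : RT) = affine (fun=> c) (fun=> 0) (snoc (w, 1 : RT)).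
Proof.
apply: eq_from_tnth => i; rewrite [RHS]tnth_mktuple addr0.
have [->|[j ->]] := ord_max_or_widen i; first by rewrite !tnth_snoc_max mulr1.
by rewrite !tnth_snoc_widen tnth_mktuple addr0.
Qed.

Definition lift1 n (w : n.-tuple RT) : n.+1.-tuple RT := snoc (w, 1 : RT).

Lemma measurable_lift1 n : measurable_fun setT (@lift1 n).
Proof.
by apply: (measurableT_comp (@measurable_snoc R n)); exact: measurable_fun_pair.
Qed.

Lemma enorm_lift1_sqr n (w : n.-tuple RT) :
  enorm (to_rV (lift1 w)) ^+ 2 = enorm (to_rV w) ^+ 2 + 1.
Proof.
rewrite !enorm_to_rV_sqr big_ord_recr/= tnth_snoc_max expr1n; congr (_ + _).
by apply: eq_bigr => i _; rewrite tnth_snoc_widen.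
Qed.

Lemma enorm_lift1_ge1 n (w : n.-tuple RT) : 1 <= enorm (to_rV (lift1 w)).
Proof.
rewrite -(ler_pXn2r (_ : (0 < 2)%N)) ?nnegrE ?enorm_ge0// expr1n enorm_lift1_sqr.
by rewrite lerDr sqr_ge0.
Qed.

(* The substitution [v = h * (w, 1)] has Jacobian [|h| ^+ m], and [v] lies in the unit
   ball when [|h| * |(w, 1)| < 1]. *)
Lemma integral_gnomonic m (F : m.+1.-tuple RT -> R) :
  measurable_fun setT F -> (forall s, 0 <= F s) ->
  (forall s, F (affine (fun=> -1) (fun=> 0) s) = F s) ->
  (\int[surface_measure m.+1]_(s in unit_sphere m.+1) (F s)%:E =
   \int[lebesgue_tuple R m]_w
     (2 * (F (normalize (lift1 w)) / enorm (to_rV (lift1 w)) ^+ m.+1))%:E)%E.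
Proof.
move=> mF F0 Feven; rewrite integral_sphere//.
set L := lebesgue_tuple R m.+1; set L' := lebesgue_tuple R m.
have Fscale c s : c != 0 -> F (normalize (affine (fun=> c) (fun=> 0) s)) = F (normalize s).
  move=> c0; rewrite normalize_scale//; case: (ltgtP c 0) c0 => // c0 _.
    by rewrite ltr0_sg.
  rewrite gtr0_sg//; congr F; apply: eq_from_tnth => i.
  by rewrite tnth_mktuple mul1r addr0.
pose rho (w : m.-tuple RT) := enorm (to_rV (lift1 w)).
have rho1 w : 1 <= rho w by exact: enorm_lift1_ge1.
have rho_gt0 w : 0 < rho w by exact: lt_le_trans (rho1 w).
have mrho : measurable_fun setT rho.
  by apply: (measurableT_comp (@measurable_enorm R m.+1)); exact: measurable_lift1.
pose P w := F (normalize (lift1 w)).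
have mFN : measurable_fun setT (F \o @normalize R m.+1).
  by apply: measurableT_comp => //; exact: measurable_normalize.
have mP : measurable_fun setT P.
  by apply: (measurableT_comp mFN); exact: measurable_lift1.
pose Fb (v : m.+1.-tuple RT) : R := (enorm (to_rV v) < 1)%R%:R * F (normalize v).
have mFb : measurable_fun setT Fb.
  apply: measurable_funM => //; apply: measurable_ltr_nat => //; exact: measurable_enorm.
have Fb0 v : 0 <= Fb v by rewrite mulr_ge0.
rewrite (_ : (\int[L]_(v in _) _)%E = \int[L]_v (Fb v)%:E)%E; last first.
  rewrite integral_mkcond; apply: eq_integral => v _; rewrite patchE /Fb.
  rewrite (_ : (v \in unit_ball m.+1) = (enorm (to_rV v) < 1)).
    by case: (_ < 1); rewrite ?mul1r ?mul0r.
  by apply/idP/idP; rewrite inE.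
have mFbE : measurable_fun setT (EFin \o Fb) by exact/measurable_EFinP.
pose g (z : m.-tuple RT * RT) : R := P z.1 * (`|z.2| ^+ m * (`|z.2| * rho z.1 < 1)%R%:R).
have mg : measurable_fun setT (EFin \o g).
  apply/measurable_EFinP; apply: measurable_funM; first exact: measurableT_comp.
  have mn : measurable_fun setT (fun z : m.-tuple RT * RT => `|z.2|).
    by apply: measurableT_comp => //; exact: normr_measurable.
  apply: measurable_funM; first exact: measurable_funX.
  apply: measurable_ltr_nat => //; apply: measurable_funM => //.
  exact: measurableT_comp.
have g0 z : (0 <= (EFin \o g) z)%E by rewrite lee_fin !mulr_ge0// /P.
rewrite (integral_snoc mFbE); last by move=> s; rewrite lee_fin.
have mFbs : measurable_fun setT (fun z => (EFin \o Fb) (@snoc R m z)).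
  by apply: (measurableT_comp mFbE); exact: measurable_snoc.
rewrite (@fubini_tonelli2 _ _ _ _ _ L' mu _ mFbs); last by move=> z; rewrite lee_fin.
have E1 : (\int[mu]_h fubini_G L' (fun z => (EFin \o Fb) (@snoc R m z)) h =
    \int[mu]_h \int[L']_w (EFin \o g) (w, h))%E.
  apply: ge0_integral_eq_off0.
  - by apply: measurable_fun_fubini_tonelli_G => // z; rewrite lee_fin.
  - exact: (@measurable_fun_fubini_tonelli_G _ _ _ _ _ L' (EFin \o g)).
  - by move=> h; apply: integral_ge0 => w _; rewrite lee_fin.
  - by move=> h; apply: integral_ge0.
  move=> h h0.
  have ms : measurable_fun setT (fun w => (EFin \o Fb) (snoc (w, h : RT))).
    exact: (measurable_fun_pair1 _ mFbs).
  have s0 w : (0 <= (EFin \o Fb) (snoc (w, h : RT)))%E by rewrite lee_fin.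
  rewrite /fubini_G -(integral_scale h0 ms s0) -ge0_integralZl//; last first.
    by apply: (measurableT_comp ms); exact: measurable_affine_tuple.
  apply: eq_integral => w _; rewrite -EFinM; congr EFin.
  rewrite /Fb /g snoc_scale Fscale// to_rV_scale enormZ.
  by rewrite [RHS]mulrC -mulrA.
rewrite E1 -(@fubini_tonelli _ _ _ _ _ L' mu _ mg g0).
have mG : measurable_fun setT (fun w => \int[mu]_h (EFin \o g) (w, h))%E.
  exact: (@measurable_fun_fubini_tonelli_F _ _ _ _ _ mu (EFin \o g)).
have G0 w : (0 <= \int[mu]_h (EFin \o g) (w, h))%E by apply: integral_ge0.
have m0 : (0 <= m.+1%:R%:E :> \bar R)%E by rewrite lee_fin.
rewrite -(ge0_integralZl _ measurableT mG (fun w _ => G0 w) m0).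
apply: eq_integral => w _; rewrite /g /=.
have mb : measurable_fun setT (fun h : R => (`|h| ^+ m * (`|h| * rho w < 1)%R%:R)%:E).
  apply/measurable_EFinP; apply: measurable_funM.
    by apply: measurable_funX; exact: normr_measurable.
  by apply: measurable_ltr_nat => //; apply: measurable_funM.
have b0 (h : R) : (0 <= (`|h| ^+ m * (`|h| * rho w < 1)%R%:R)%:E)%E.
  by rewrite lee_fin mulr_ge0.
have P0 : (0 <= (P w)%:E)%E by rewrite lee_fin /P.
under eq_integral do rewrite EFinM.
rewrite (@ge0_integralZl _ RT R mu _ measurableT _ mb _ (fun h _ => b0 h) P0).
rewrite integral_abs_exprn// -!EFinM; congr EFin.
rewrite -/(P w) -/(rho w); have : m.+1%:R != 0 :> R by rewrite pnatr_eq0.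
move: (m.+1%:R) (rho w ^+ _)^-1 => X Y X0.
by field.
Qed.

End gnomonic.

(** * The kernel of the gradient *)

Section gradient_kernel.
Context {R : realType}.
Variable m : nat.
Local Notation RT := (measurableTypeR R).
Local Notation mu := (@lebesgue_measure R).
Local Notation n := (m.+1%:R : R).
Local Notation ST := (@spacetime_measure R m).
Implicit Types (a t q : R) (x v : 'rV[R]_m.+1).

Definition kernel_const a : R := ((4 * a ^+ 2 * pi) `^ (n / 2))^-1.

Definition grad_weight a x t (z : m.-tuple RT * RT) : R :=
  kernel_const a * (expR (- (enorm (x - bdry_pt z.1) ^+ 2 / (4 * a ^+ 2 * (t - z.2))))
    / (t - z.2) `^ (n / 2 + 1)).

Definition grad_kernel a x t v (z : m.-tuple RT * RT) : R :=
  grad_weight a x t z * dotp (x - bdry_pt z.1) v.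

Lemma kernel_const_gt0 a : 0 < a -> 0 < kernel_const a.
Proof. by move=> a0; rewrite invr_gt0 powR_gt0// !mulr_gt0// ?exprn_gt0// pi_gt0. Qed.

Lemma bdry_pt_widen (y : m.-tuple RT) (i : 'I_m) :
  bdry_pt y 0 (widen_ord (leqnSn m) i) = tnth y i.
Proof. by rewrite mxE (tnth_nth 0). Qed.

Lemma bdry_pt_max (y : m.-tuple RT) : bdry_pt y 0 ord_max = 0.
Proof. by rewrite mxE nth_default// size_tuple. Qed.

Lemma measurable_bdry_coord i : measurable_fun setT (fun y : m.-tuple RT => bdry_pt y 0 i).
Proof.
have [->|[j ->]] := ord_max_or_widen i.
  rewrite (_ : (fun _ => _) = cst 0); first exact: measurable_cst.
  by apply/funext => y; rewrite bdry_pt_max.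
by under eq_fun do rewrite bdry_pt_widen; exact: measurable_tnth.
Qed.

Lemma measurable_dotp_bdry x v :
  measurable_fun setT (fun y : m.-tuple RT => dotp (x - bdry_pt y) v).
Proof.
apply: measurable_sum => i; apply: measurable_funM => //.
under eq_fun do rewrite mxE [(- bdry_pt _) _ _]mxE.
by apply: measurable_funB => //; exact: measurable_bdry_coord.
Qed.

Lemma measurable_rho x : measurable_fun setT (fun y : m.-tuple RT => enorm (x - bdry_pt y)).
Proof.
apply: (@measurableT_comp _ _ _ _ _ _ (@Num.sqrt R)).
  apply: open_continuous_measurable_fun; first exact: openT.
  by move=> y _; exact: sqrt_continuous.
apply: measurable_sum => i.
under eq_fun do rewrite mxE [(- bdry_pt _) _ _]mxE.
by apply: measurable_funM; apply: measurable_funB => //; exact: measurable_bdry_coord.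
Qed.

Lemma measurable_divr d (T : measurableType d) (f g : T -> R) :
  measurable_fun setT f -> measurable_fun setT g ->
  measurable_fun setT (fun z => f z / g z).
Proof.
move=> mf mg; apply: measurable_funM => //.
exact: (measurableT_comp (@measurable_invr R)).
Qed.

Lemma measurable_heat (b c t : R) x : measurable_fun setT
  (fun z : m.-tuple RT * RT =>
    expR (- (enorm (x - bdry_pt z.1) ^+ 2 / (b * (t - z.2)))) / (t - z.2) `^ c).
Proof.
have mt : measurable_fun setT (fun z : m.-tuple RT * RT => t - z.2).
  exact: measurable_funB.
apply: measurable_divr.
  apply: (measurableT_comp (@measurable_expR R)); apply: measurableT_comp => //.
  apply: measurable_divr; last exact: measurable_funM.
  apply: measurable_funX; apply: (measurableT_comp (measurable_rho x)).
  exact: measurable_fst.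
exact: (measurableT_comp (measurable_powR c) mt).
Qed.

Lemma measurable_grad_weight a x t : measurable_fun setT (grad_weight a x t).
Proof. by apply: measurable_funM => //; exact: measurable_heat. Qed.

Lemma measurable_grad_kernel a x t v : measurable_fun setT (grad_kernel a x t v).
Proof.
apply: measurable_funM; first exact: measurable_grad_weight.
by apply: (measurableT_comp (measurable_dotp_bdry x v)); exact: measurable_fst.
Qed.

Lemma measurable_strip t : measurable (@strip R m t).
Proof. by apply: measurableX => //; exact: measurable_itv. Qed.

Lemma integral_strip t (f : m.-tuple RT * RT -> R) :
  measurable_fun setT f -> (forall z, 0 <= f z) ->
  (\int[ST]_(z in strip t) (f z)%:E =
   \int[lebesgue_tuple R m]_y \int[mu]_(s in `]0%R, t[) (f (y, s))%:E)%E.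
Proof.
move=> mf f0; rewrite integral_mkcond.
have mE : measurable_fun setT ((EFin \o f) \_ (strip t)).
  apply/(measurable_restrictT _ (measurable_strip t)).
  by apply/measurable_EFinP; exact: measurable_funTS.
rewrite /spacetime_measure/=.
rewrite (@fubini_tonelli1 _ _ _ _ _ (lebesgue_tuple R m) mu _ mE); last first.
  by move=> z; rewrite patchE; case: ifP => // _; rewrite lee_fin.
apply: eq_integral => y _; rewrite /fubini_F [RHS]integral_mkcond.
apply: eq_integral => s _; rewrite !patchE.
rewrite (_ : ((y, s) \in strip t) = (s \in `]0, t[%classic))//.
by apply/idP/idP; rewrite !inE /strip/= => H; [case: H|split].
Qed.

Lemma rho_ge_xn x (y : m.-tuple RT) : 0 < x 0 ord_max -> x 0 ord_max <= enorm (x - bdry_pt y).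
Proof.
move=> x0; have := ler_coord_enorm (x - bdry_pt y) ord_max.
by rewrite mxE [(- bdry_pt _) _ _]mxE bdry_pt_max subr0 gtr0_norm.
Qed.

Lemma bdry_affine x (w : m.-tuple RT) :
  x - bdry_pt (affine (fun=> - x 0 ord_max) (fun i => x 0 (widen_ord (leqnSn m) i)) w) =
  x 0 ord_max *: to_rV (lift1 w).
Proof.
apply/rowP => i; rewrite mxE [(- bdry_pt _) _ _]mxE [RHS]mxE [to_rV _ _ _]mxE.
have [->|[j ->]] := ord_max_or_widen i.
  by rewrite bdry_pt_max tnth_snoc_max subr0 mulr1.
by rewrite bdry_pt_widen tnth_snoc_widen tnth_mktuple opprD mulNr opprK addrCA subrr addr0.
Qed.

Lemma powR_ln (b r : R) : 0 < b -> b `^ r = expR (r * ln b).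
Proof. by move=> b0; rewrite /powR gt_eqF. Qed.

Lemma integral_time_gradient a x t q v (y : m.-tuple RT) :
  (0 < m)%N -> 0 < a -> 0 < x 0 ord_max -> 0 < t -> 1 <= q ->
  let A := q * enorm (x - bdry_pt y) ^+ 2 / (4 * a ^+ 2) in
  (\int[mu]_(s in `]0%R, t[) (`|grad_kernel a x t v (y, s)| `^ q)%:E =
   (`|dotp (x - bdry_pt y) v| `^ q * kernel_const a `^ q
     * A `^ (1 - q * (n / 2 + 1))
     * upper_gamma ((n + 2) * q / 2 - 2) (A / t))%:E)%E.
Proof.
move=> m0 a0 x0 t0 q1 A; set D := `|dotp _ v|; set al := q * (n / 2 + 1).
have r0 : 0 < enorm (x - bdry_pt y) by apply: lt_le_trans (rho_ge_xn y x0).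
have q0 : 0 < q by apply: lt_le_trans q1.
have A0 : 0 < A by rewrite divr_gt0 ?mulr_gt0// exprn_gt0.
have l0 : 0 <= (n + 2) * q / 2 - 2.
  have n2 : 2 <= n by rewrite ler_nat.
  by nra.
transitivity (\int[mu]_(s in `]0%R, t[)
   ((D `^ q * kernel_const a `^ q)%:E * ((t - s) `^ (- al) * expR (- (A / (t - s))))%:E))%E.
  apply: eq_integral => s; rewrite inE/= in_itv/= => /andP[s0 st].
  have ts0 : 0 < t - s by rewrite subr_gt0.
  have k0 := kernel_const_gt0 a0.
  rewrite -EFinM /grad_kernel /grad_weight /= normrM -/D; congr EFin.
  set E := expR _; set S := (t - s) `^ _.
  have E0 : 0 < E by exact: expR_gt0.
  have S0 : 0 < S by rewrite powR_gt0.
  rewrite gtr0_norm; last by rewrite mulr_gt0// divr_gt0.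
  have ES : (E / S) `^ q = expR (- (A / (t - s))) * (t - s) `^ (- al).
    rewrite powRM ?invr_ge0 ?ltW// -[S^-1]powR_inv1 ?ltW// /S -!powRrM.
    congr (_ * _); last by congr (_ `^ _); rewrite /al; ring.
    rewrite /E powR_ln ?expR_gt0// expRK; congr expR; rewrite /A.
    by field; rewrite !gt_eqF.
  have ES0 : 0 <= E / S by rewrite divr_ge0// ltW.
  rewrite (powRM _ (mulr_ge0 (ltW k0) ES0) (normr_ge0 _)) (powRM _ (ltW k0) ES0) ES.
  by ring.
rewrite ge0_integralZl//; first last.
- by rewrite lee_fin mulr_ge0// powR_ge0.
- by move=> s _; rewrite lee_fin mulr_ge0 ?powR_ge0 ?expR_ge0.
- apply/measurable_EFinP; apply: measurable_funTS.
  have mts : measurable_fun setT (fun s : R => t - s) by exact: measurable_funB.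
  apply: measurable_funM; first exact: (measurableT_comp (measurable_powR (- al)) mts).
  apply: (measurableT_comp (@measurable_expR R)); apply: measurableT_comp => //.
  exact: measurable_divr.
rewrite integral_gamma_density_inv// muleA -EFinM [RHS]EFinM upper_gammaE//; last first.
  by rewrite divr_ge0 ?(ltW t0) ?(ltW A0).
congr (_ * _)%E.
apply: eq_integral => xi _; congr (gamma_density _ xi)%:E.
by rewrite /al; field.
Qed.

End gradient_kernel.

Section gradient_kernel_norm.
Context {R : realType}.
Variable m : nat.
Local Notation RT := (measurableTypeR R).
Local Notation mu := (@lebesgue_measure R).
Local Notation n := (m.+1%:R : R).
Local Notation ST := (@spacetime_measure R m).
Implicit Types (a t q : R) (x v : 'rV[R]_m.+1).

Definition sphere_integrand (kap lam bet q : R) v (s : m.+1.-tuple RT) : R :=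
  omega kap lam (dotp (to_rV s) (delta_mx 0 ord_max))
  * `|dotp (to_rV s) (delta_mx 0 ord_max)| `^ bet * `|dotp (to_rV s) v| `^ q.

Lemma omega_ge0 (kap lam u : R) : 0 <= omega kap lam u.
Proof. by rewrite /omega; case: ifP => // _; exact: upper_gamma_ge0. Qed.

Lemma omegaN (kap lam u : R) : omega kap lam (- u) = omega kap lam u.
Proof. by rewrite /omega oppr_eq0 sqrrN. Qed.

Lemma sphere_integrand_ge0 kap lam bet q v s : 0 <= sphere_integrand kap lam bet q v s.
Proof. by rewrite !mulr_ge0 ?powR_ge0 ?omega_ge0. Qed.

Lemma measurable_sphere_integrand kap lam bet q v : 0 <= kap -> 0 <= lam ->
  measurable_fun setT (sphere_integrand kap lam bet q v).
Proof.
move=> k0 l0.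
have mpow (c : R) w : measurable_fun setT
    (fun s : m.+1.-tuple RT => `|dotp (to_rV s) w| `^ c).
  apply: (measurableT_comp (measurable_powR c)).
  by apply: (measurableT_comp (@normr_measurable R setT)); exact: measurable_dotp.
apply: measurable_funM => //; apply: measurable_funM => //.
by apply: (measurableT_comp (measurable_omega k0 l0)); exact: measurable_dotp.
Qed.

Lemma sphere_integrand_even kap lam bet q v s :
  sphere_integrand kap lam bet q v (affine (fun=> -1) (fun=> 0) s) =
  sphere_integrand kap lam bet q v s.
Proof. by rewrite /sphere_integrand to_rV_scale !dotpZl !mulN1r omegaN !normrN. Qed.

Lemma conj_lambda_ge0 q : (0 < m)%N -> 1 <= q -> 0 <= (n + 2) * q / 2 - 2.
Proof.
move=> m0 q1; rewrite subr_ge0 ler_pdivlMr//.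
have n2 : 2 <= n by rewrite ler_nat.
by nra.
Qed.

Lemma integral_grad_kernel a x t q v :
  (0 < m)%N -> 0 < a -> 0 < x 0 ord_max -> 0 < t -> 1 <= q ->
  let xn := x 0 ord_max in
  (\int[ST]_(z in strip t) (`|grad_kernel a x t v z| `^ q)%:E =
   (kernel_const m a `^ q * (q / (4 * a ^+ 2)) `^ (1 - q * (n / 2 + 1))
     * xn `^ (- ((n + 1) * (q - 1))) / 2)%:E *
   \int[surface_measure m.+1]_(s in unit_sphere m.+1)
     (sphere_integrand (q * xn ^+ 2 / (4 * a ^+ 2 * t)) ((n + 2) * q / 2 - 2)
        ((n + 1) * (q - 1) - 1) q v s)%:E)%E.
Proof.
move=> m0 a0 x0 t0 q1 xn.
have q0 : 0 < q by apply: lt_le_trans q1.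
have l0 := conj_lambda_ge0 m0 q1.
set kap := q * xn ^+ 2 / _; set lam := (n + 2) * q / 2 - 2.
set bet := (n + 1) * (q - 1) - 1; set al := 1 - q * (n / 2 + 1).
have k0 : 0 <= kap by rewrite divr_ge0// !mulr_ge0// ?sqr_ge0// ltW.
have mF := @measurable_sphere_integrand kap lam bet q v k0 l0.
have mG : measurable_fun setT (fun z => `|grad_kernel a x t v z| `^ q).
  apply: (measurableT_comp (measurable_powR q)).
  by apply: (measurableT_comp (@normr_measurable R setT)); exact: measurable_grad_kernel.
rewrite (integral_gnomonic mF); last 2 first.
- by move=> s; exact: sphere_integrand_ge0.
- by move=> s; exact: sphere_integrand_even.
rewrite (integral_strip t mG); last by move=> z; exact: powR_ge0.
pose A (y : m.-tuple RT) := q * enorm (x - bdry_pt y) ^+ 2 / (4 * a ^+ 2).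
have A0 y : 0 <= A y by apply: divr_ge0; apply: mulr_ge0; rewrite ?sqr_ge0 ?(ltW q0).
pose H (y : m.-tuple RT) : R := `|dotp (x - bdry_pt y) v| `^ q * kernel_const m a `^ q
     * A y `^ al * upper_gamma lam (Num.max (A y / t) 0).
have H0 y : (0 <= (H y)%:E)%E.
  by rewrite lee_fin !mulr_ge0 ?powR_ge0 ?upper_gamma_ge0.
transitivity (\int[lebesgue_tuple R m]_y (H y)%:E)%E.
  apply: eq_integral => y _; rewrite integral_time_gradient//.
  by rewrite /H max_l//; apply: divr_ge0 => //; exact: ltW.
have mA : measurable_fun setT A.
  apply: measurable_funM => //; apply: measurable_funM => //.
  by apply: measurable_funX; exact: measurable_rho.
have mH : measurable_fun setT (fun y => (H y)%:E).
  apply/measurable_EFinP; apply: measurable_funM; last first.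
    apply: (measurableT_comp (measurable_upper_gamma l0)).
    exact: measurable_funM.
  apply: measurable_funM; last exact: (measurableT_comp (measurable_powR al) mA).
  apply: measurable_funM => //; apply: (measurableT_comp (measurable_powR q)).
  by apply: (measurableT_comp (@normr_measurable R setT)); exact: measurable_dotp_bdry.
pose c (i : 'I_m) : R := - xn.
pose d (i : 'I_m) := x 0 (widen_ord (leqnSn m) i).
have c0 i : c i != 0 by rewrite oppr_eq0 gt_eqF.
rewrite -(integral_affine d c0 mH H0) /c prodr_const card_ord normrN (gtr0_norm x0).
have xm0 : (0 <= (xn ^+ m)%:E)%E by rewrite lee_fin exprn_ge0// ltW.
have mHa : measurable_fun setT (fun w => (H (affine c d w))%:E).
  by apply: (measurableT_comp mH); exact: measurable_affine_tuple.
rewrite -(@ge0_integralZl _ _ _ _ _ measurableT _ mHa _ (fun w _ => H0 _) xm0).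
set P := fun w => (2 * _)%:E; set C := (_ * _ / 2)%R.
have mP : measurable_fun setT P.
  apply/measurable_EFinP; apply: measurable_funM => //; apply: measurable_divr.
    apply: (measurableT_comp mF); apply: (measurableT_comp (@measurable_normalize R m.+1)).
    exact: measurable_lift1.
  apply: measurable_funX; apply: (measurableT_comp (@measurable_enorm R m.+1)).
  exact: measurable_lift1.
have P0 w : (0 <= P w)%E.
  by rewrite lee_fin mulr_ge0// divr_ge0 ?sphere_integrand_ge0// exprn_ge0// enorm_ge0.
have C0 : (0 <= C%:E)%E by rewrite lee_fin divr_ge0// !mulr_ge0// powR_ge0.
rewrite -(@ge0_integralZl _ _ _ _ _ measurableT _ mP _ (fun w _ => P0 _) C0).
apply: eq_integral => w _; rewrite /P -!EFinM; congr EFin.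
set r := enorm (to_rV (lift1 w)).
have r0 : 0 < r by apply: lt_le_trans (enorm_lift1_ge1 w).
have ri0 : 0 < r^-1 by rewrite invr_gt0.
rewrite /H /A /c /d bdry_affine enormZ (gtr0_norm x0) dotpZl normrM (gtr0_norm x0) -/r.
rewrite /sphere_integrand to_rV_normalize -/r !dotpZl dotp_delta.
have -> : to_rV (lift1 w) 0 ord_max = 1 by rewrite mxE tnth_snoc_max.
rewrite mulr1 normrM (gtr0_norm ri0) -/xn; set D := `|dotp _ v|.
have D0 : 0 <= D by exact: normr_ge0.
rewrite /omega invr_eq0 gt_eqF//.
have -> : kap / r^-1 ^+ 2 = kap * r ^+ 2 by rewrite exprVn invrK.
have -> : q * (xn * r) ^+ 2 / (4 * a ^+ 2) / t = kap * r ^+ 2.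
  by rewrite /kap; field; rewrite !gt_eqF.
have kr0 : 0 <= kap * r ^+ 2 by apply: mulr_ge0 => //; exact: sqr_ge0.
rewrite (max_l kr0); set U := upper_gamma _ _.
have -> : q * (xn * r) ^+ 2 / (4 * a ^+ 2) = (q / (4 * a ^+ 2)) * (xn `^ 2 * r `^ 2).
  by rewrite !powR_mulrn ?(ltW x0) ?(ltW r0)// exprMn; ring.
have qa0 : 0 <= q / (4 * a ^+ 2).
  by apply: divr_ge0; rewrite ?(ltW q0)//; apply: mulr_ge0; rewrite ?sqr_ge0.
rewrite (powRM _ qa0 (mulr_ge0 (powR_ge0 _ _) (powR_ge0 _ _))) (powRM al (powR_ge0 xn 2) (powR_ge0 r 2)) -!powRrM.
rewrite (powRM _ (ltW x0) D0) (powRM _ (ltW ri0) D0).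
rewrite -(powR_mulrn m (ltW x0)) -(powR_mulrn m.+1 (ltW r0)) -powRN.
rewrite -(powR_inv1 (ltW r0)) -!powRrM.
have Ex : xn `^ m%:R * xn `^ q * xn `^ (2 * al) = xn `^ (- ((n + 1) * (q - 1))).
  rewrite !powR_ln// -!expRD; congr expR.
  by rewrite /al -[m.+1%:R]natr1; field.
have Er : r `^ (2 * al) = r `^ (- 1 * bet) * r `^ (- 1 * q) * r `^ (- m.+1%:R).
  rewrite !powR_ln// -!expRD; congr expR.
  by rewrite /al /bet -[m.+1%:R]natr1; field.
rewrite /C -Ex Er; move: (_ `^ m%:R) (xn `^ q) (xn `^ (2 * al)) => X1 X2 X3.
by field.
Qed.

End gradient_kernel_norm.

(** * Differentiation under the integral sign *)

Section decay.
Context {R : realType}.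
Local Notation RT := (measurableTypeR R).
Local Notation mu := (@lebesgue_measure R).

Lemma powR_expR_bound (N b : R) : 0 <= N -> 0 < b ->
  exists2 C, 0 <= C & forall u, 0 < u -> u `^ N * expR (- (b * u)) <= C.
Proof.
move=> N0 b0; set k := Num.trunc N.
have Nk : N <= k.+1%:R by rewrite ltW// truncnS_gt.
pose C := (k.+1)`!%:R / b ^+ k.+1.
have C0 : 0 <= C by rewrite divr_ge0// exprn_ge0// ltW.
exists (1 + C); first by rewrite addr_ge0.
move=> u u0; have bu0 : 0 < b * u by rewrite mulr_gt0.
have [u1|u1] := leP u 1.
  rewrite (@le_trans _ _ 1)//; last by rewrite lerDl.
  rewrite mulr_ile1 ?powR_ge0 ?expR_ge0//.
    rewrite (_ : 1 = 1 `^ N); last by rewrite powR1.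
    by rewrite ge0_ler_powR// nnegrE ltW.
  by rewrite -expR0 ler_expR oppr_le0 ltW.
rewrite (@le_trans _ _ C)//; last by rewrite lerDr.
rewrite expRN ler_pdivrMr ?expR_gt0//.
apply: (@le_trans _ _ (u ^+ k.+1)).
  by rewrite -powR_mulrn ?(ltW u0)// ler_powR// ltW.
have := expR_ge1Dxn k (ltW bu0); rewrite exprMn => H.
have {}H : b ^+ k.+1 * u ^+ k.+1 / (k.+1)`!%:R <= expR (b * u).
  by apply: le_trans H; rewrite lerDr.
move: H; rewrite ler_pdivrMr ?ltr0n ?fact_gt0// => H.
by rewrite /C mulrAC ler_pdivlMr ?exprn_gt0// mulrC (mulrC _%:R).
Qed.

Lemma heat_bound (b c : R) : 0 <= c -> 0 < b ->
  exists2 C, 0 <= C & forall r s, 0 < r -> 0 < s ->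
    expR (- (r ^+ 2 / (b * s))) / s `^ c <= C * r `^ (- (2 * c)).
Proof.
move=> c0 b0; have bi0 : 0 < b^-1 by rewrite invr_gt0.
have [C C0 HC] := powR_expR_bound c0 bi0; exists C => // r s r0 s0.
have u0 : 0 < r ^+ 2 / s by rewrite divr_gt0// exprn_gt0.
have := HC _ u0; rewrite -(ler_pM2r (powR_gt0 (- (2 * c)) r0)).
apply: le_trans.
rewrite (_ : b^-1 * (r ^+ 2 / s) = r ^+ 2 / (b * s)); last first.
  by rewrite invfM; ring.
rewrite -powRN (_ : _ `^ c * _ * _ =
  expR (- (r ^+ 2 / (b * s))) * ((r ^+ 2 / s) `^ c * r `^ (- (2 * c)))); last by ring.
rewrite ler_wpM2l ?expR_ge0// le_eqVlt; apply/orP; left; apply/eqP.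
have si0 : 0 <= s^-1 by rewrite invr_ge0 ltW.
rewrite (powRM c (sqr_ge0 r) si0) -(powR_mulrn 2 (ltW r0)).
rewrite -(powR_inv1 (ltW s0)) -!powRrM mulrAC -powRD ?(gt_eqF r0) ?implybT//.
by rewrite subrr powRr0 mul1r mulN1r.
Qed.

Lemma weighted_Lp_integrable d (T : measurableType d) (nu : {measure set T -> \bar R})
    (D : set T) (w g : T -> R) (M : R) (p : \bar R) :
  measurable D -> measurable_fun setT w -> (forall z, D z -> 0 <= w z <= M) ->
  (\int[nu]_(z in D) (w z)%:E < +oo)%E -> (1 <= p)%E -> g \in Lfun nu p ->
  nu.-integrable D (fun z => (w z * `|g z|)%:E).
Proof.
move=> mD mw w0M wint p1 gLp.
have mg : measurable_fun setT g by move: gLp; rewrite inE => /andP[/[!inE]].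
have mwD : measurable_fun D (fun z => (w z)%:E).
  by apply/measurable_EFinP; exact: measurable_funTS.
have mwg : measurable_fun D (fun z => (w z * `|g z|)%:E).
  apply/measurable_EFinP; apply: measurable_funTS; apply: measurable_funM => //.
  exact: measurableT_comp.
have w0 z : D z -> 0 <= w z by move=> /w0M/andP[].
have iw : nu.-integrable D (fun z => (w z)%:E).
  apply/integrableP; split => //; apply: le_lt_trans wint.
  by apply: ge0_le_integral => // [|z Dz]; rewrite ?lee_fin ?ger0_norm ?w0//;
    exact: measurableT_comp.
case: p p1 gLp => [r|_ gLp|//]; last first.
  apply/integrableP; split => //.
  have [nu0|nu0] := eqVneq (nu setT) 0%E.
    apply: (@le_lt_trans _ _ (\int[nu]_(z in D) 0)%E); last by rewrite integral0 ltry.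
    apply: ae_ge0_le_integral => //; first exact: measurableT_comp.
    by exists setT; split.
  have : (ess_sup nu (abse \o (EFin \o g)) < +oo)%E.
    by move: gLp; rewrite inE => /andP[_]; rewrite inE /finite_norm/= unlock lt0e nu0 measure_ge0.
  move=> sup_lty; have := ess_sup_ge nu (abse \o (EFin \o g)).
  set S := ess_sup _ _ in sup_lty *; move=> gS.
  have S0 : (0 <= S)%E by apply: ess_sup_gee; [rewrite lt0e nu0 measure_ge0|apply: aeW => z; rewrite /= lee_fin].
  have Sfin : S \is a fin_num by rewrite ge0_fin_numE.
  apply: (@le_lt_trans _ _ (\int[nu]_(z in D) (S * (w z)%:E))%E).
    apply: ae_ge0_le_integral => //.
    - by apply: measurableT_comp.
    - by move=> z Dz; rewrite mule_ge0// lee_fin w0.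
    - exact: measurable_funeM.
    - apply: filterS gS => z gz Dz; rewrite /= ger0_norm ?mulr_ge0 ?w0// EFinM muleC.
      by apply: lee_wpmul2r => //; rewrite lee_fin w0.
  have w0E z : D z -> (0 <= (w z)%:E)%E by rewrite lee_fin; exact: w0.
  by rewrite (ge0_integralZl nu mD mwD w0E S0) lte_mul_pinfty.
rewrite lee_fin => r1 gLp.
have ig := Lfun_integrable r1 gLp.
apply: (@le_integrable _ _ _ nu D mD _ (fun z => (w z)%:E + (M * `|g z| `^ r)%:E)%E) => //.
  move=> z Dz; have /andP[wz0 wzM] := w0M _ Dz.
  have M0 : 0 <= M by exact: le_trans wzM.
  rewrite -EFinD lee_fin (@ger0_norm _ (w z * _)) ?mulr_ge0//.
  rewrite (@ger0_norm _ (w z + _)); last by rewrite addr_ge0// mulr_ge0// powR_ge0.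
  have [g1|g1] := leP `|g z| 1.
    apply: (@le_trans _ _ (w z)); first by rewrite ler_piMr.
    by rewrite lerDl mulr_ge0 ?powR_ge0// (le_trans wz0).
  apply: (@le_trans _ _ (M * `|g z| `^ r)); last by rewrite lerDr.
  by apply: ler_pM => //; rewrite -[leLHS]powRr1// ler_powR// ltW.
apply: integrableD => //.
under eq_fun do rewrite EFinM.
by apply: integrableZl => //; apply: integrableS ig.
Qed.

End decay.

Section differentiation.
Context {R : realType}.
Variable m : nat.
Local Notation RT := (measurableTypeR R).
Local Notation mu := (@lebesgue_measure R).
Local Notation n := (m.+1%:R : R).
Local Notation ST := (@spacetime_measure R m).
Implicit Types (a t q : R) (x v : 'rV[R]_m.+1).

Definition decay x (y : m.-tuple RT) : R := (enorm (x - bdry_pt y) ^+ m.+1)^-1.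

Lemma decay_ge0 x y : 0 <= decay x y.
Proof. by rewrite invr_ge0 exprn_ge0// enorm_ge0. Qed.

Lemma measurable_decay x : measurable_fun setT (decay x).
Proof.
apply: (measurableT_comp (@measurable_invr R)); apply: measurable_funX.
exact: measurable_rho.
Qed.

Lemma measurable_decay1 x : measurable_fun setT (fun z : m.-tuple RT * RT => decay x z.1).
Proof. by apply: (measurableT_comp (measurable_decay x)); exact: measurable_fst. Qed.

Lemma decay_le x y : 0 < x 0 ord_max -> decay x y <= (x 0 ord_max ^+ m.+1)^-1.
Proof.
move=> x0; have xr := rho_ge_xn y x0.
have r0 : 0 < enorm (x - bdry_pt y) by exact: lt_le_trans xr.
by rewrite lef_pV2 ?posrE ?exprn_gt0// lerXn2r// nnegrE ltW.
Qed.

Lemma integral_decay x t : 0 < x 0 ord_max -> 0 < t ->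
  (\int[ST]_(z in strip t) (decay x z.1)%:E < +oo)%E.
Proof.
move=> x0 t0; rewrite (integral_strip t (measurable_decay1 x)); last first.
  by move=> z; exact: decay_ge0.
have mI : measurable (`]0%R, t[%classic : set RT) by exact: measurable_itv.
have muI : mu (`]0, t[%classic : set RT) = t%:E.
  by rewrite lebesgue_measure_itv/= lte_fin t0 sube0.
have d0 y : (0 <= (decay x y)%:E)%E by rewrite lee_fin decay_ge0.
have mD : measurable_fun setT (fun y => (decay x y)%:E).
  by apply/measurable_EFinP; exact: measurable_decay.
rewrite (eq_integral (fun y => (t%:E * (decay x y)%:E)%E)); last first.
  move=> y _; apply: (eq_trans (integral_cst mu mI (decay x y)%:E)).
  by rewrite muleC; congr (_ * _)%E; exact: muI.
have t0' : (0 <= t%:E)%E by rewrite lee_fin ltW.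
rewrite (ge0_integralZl _ measurableT mD (fun y _ => d0 y) t0').
apply: lte_mul_pinfty => //.
pose c (i : 'I_m) : R := - x 0 ord_max.
pose d (i : 'I_m) := x 0 (widen_ord (leqnSn m) i).
have c0 i : c i != 0 by rewrite oppr_eq0 gt_eqF.
rewrite -(integral_affine d c0 mD d0); apply: lte_mul_pinfty => //.
  by rewrite lee_fin prodr_ge0.
have mF : measurable_fun setT (fun _ : m.+1.-tuple RT => 1 : R) by exact: measurable_cst.
have mS := @measurable_unit_sphere R m.+1.
have := integral_gnomonic mF (fun=> ler01) (fun=> erefl).
rewrite (integral_cst _ mS 1%E) mul1e => H.
apply: (@le_lt_trans _ _ ((x 0 ord_max ^+ m.+1)^-1%:E * surface_measure m.+1 (unit_sphere m.+1))%E).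
  have mP : measurable_fun setT
      (fun w : m.-tuple RT => (2 * (1 / enorm (to_rV (lift1 w)) ^+ m.+1))%:E).
    apply/measurable_EFinP; apply: measurable_funM => //; apply: measurable_divr => //.
    apply: measurable_funX; apply: (measurableT_comp (@measurable_enorm R m.+1)).
    exact: measurable_lift1.
  have P0 (w : m.-tuple RT) : (0 <= (2 * (1 / enorm (to_rV (lift1 w)) ^+ m.+1))%:E)%E.
    by rewrite lee_fin mulr_ge0// divr_ge0// exprn_ge0// enorm_ge0.
  have x0' : (0 <= ((x 0 ord_max ^+ m.+1)^-1)%:E)%E.
    by rewrite lee_fin invr_ge0 exprn_ge0// ltW.
  rewrite H -(@ge0_integralZl _ _ _ _ _ measurableT _ mP _ (fun w _ => P0 _) x0').
  apply: ge0_le_integral => //.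
  - by apply: (measurableT_comp mD); exact: measurable_affine_tuple.
  - exact: measurable_funeM.
  - move=> w _; rewrite /decay /c /d bdry_affine enormZ (gtr0_norm x0).
    rewrite -EFinM lee_fin exprMn invfM ler_wpM2l ?invr_ge0 ?exprn_ge0 ?(ltW x0)//.
    by rewrite mul1r ler_peMl ?invr_ge0 ?exprn_ge0 ?enorm_ge0// ler1n.
apply: lte_mul_pinfty => //; first by rewrite lee_fin invr_ge0 exprn_ge0// ltW.
rewrite /surface_measure; apply: lte_mul_pinfty => //.
apply: le_lt_trans (@lebesgue_unit_ball_lty R m.+1); apply: le_measure; rewrite ?inE.
- apply: measurableI; first exact: measurable_unit_ball.
  rewrite -[X in measurable X]setTI; exact: measurable_normalize.
- exact: measurable_unit_ball.
- by move=> s [].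
Qed.

Lemma heat_decay_bound x (b c : R) : 0 < x 0 ord_max -> 0 < b -> n <= 2 * c ->
  exists2 C, 0 <= C & forall xi y s, 0 < s -> enorm (xi - x) <= x 0 ord_max / 2 ->
    enorm (xi - bdry_pt y) `^ (2 * c - n) *
    (expR (- (enorm (xi - bdry_pt y) ^+ 2 / (b * s))) / s `^ c) <= C * decay x y.
Proof.
move=> x0 b0 nc; have c0 : 0 <= c.
  by have : 0 <= n by []; lra.
have [C C0 HC] := heat_bound c0 b0.
exists (C * 2 ^+ m.+1); first by rewrite mulr_ge0// exprn_ge0.
move=> xi y s s0 xix; set r := enorm (xi - bdry_pt y); set r0 := enorm (x - bdry_pt y).
have r00 : 0 < r0 by apply: lt_le_trans (rho_ge_xn y x0).
have rr0 : r0 / 2 <= r.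
  have : r0 <= r + enorm (xi - x).
    have -> : enorm (xi - x) = enorm (x - xi) by rewrite -opprB -scaleN1r enormZ normrN1 mul1r.
    rewrite /r0 (_ : x - _ = (xi - bdry_pt y) + (x - xi)) ?ler_enormD//.
    by apply/rowP => j; rewrite !mxE; ring.
  have := rho_ge_xn y x0; rewrite -/r0; lra.
have rp : 0 < r by apply: lt_le_trans rr0; rewrite divr_gt0.
apply: (@le_trans _ _ (r `^ (2 * c - n) * (C * r `^ (- (2 * c))))).
  by rewrite ler_wpM2l ?powR_ge0// HC.
rewrite mulrCA -powRD ?(gt_eqF rp) ?implybT// (_ : _ + _ = - n); last by ring.
rewrite powRN powR_mulrn ?(ltW rp)// -mulrA ler_wpM2l// /decay -/r0.
rewrite -[leRHS]invrK invfM invrK lef_pV2 ?posrE ?exprn_gt0//; last first.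
  by rewrite mulr_gt0 ?invr_gt0 ?exprn_gt0.
by rewrite mulrC -exprVn -exprMn lerXn2r// nnegrE ltW// divr_gt0.
Qed.

Lemma grad_kernel_bound a x t : 0 < a -> 0 < x 0 ord_max ->
  exists2 C, 0 <= C & forall v y s, s < t ->
    `|grad_kernel a x t v (y, s)| <= C * enorm v * decay x y.
Proof.
move=> a0 x0; have b0 : 0 < 4 * a ^+ 2 by rewrite mulr_gt0// exprn_gt0.
have nc : n <= 2 * (n / 2 + 1) by lra.
have [C C0 HC] := heat_decay_bound x0 b0 nc.
have := kernel_const_gt0 m a0 => k0.
pose xn := x 0 ord_max; have xn0 : 0 < xn by [].
exists (kernel_const m a * C / xn); first by rewrite divr_ge0 ?mulr_ge0 ?(ltW k0) ?(ltW xn0).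
move=> v y s st; have ts : 0 < t - s by rewrite subr_gt0.
have xx : enorm (x - x) <= x 0 ord_max / 2.
  by have /eqP -> : enorm (x - x) == 0; rewrite ?enorm_eq0 ?subrr//; apply: divr_ge0; rewrite ?(ltW x0).
have := HC x y _ ts xx; set r := enorm (x - bdry_pt y).
have rx : xn <= r by exact: rho_ge_xn.
have r0 : 0 < r by exact: lt_le_trans rx.
rewrite /grad_kernel /grad_weight /= -/r; set E := expR _ / _ => H.
have E0 : 0 <= E by rewrite divr_ge0 ?expR_ge0 ?powR_ge0.
have kE0 : 0 <= kernel_const m a * E by apply: mulr_ge0 => //; exact: ltW.
rewrite normrM (ger0_norm kE0).
apply: (@le_trans _ _ (kernel_const m a * E * (r * enorm v))).
  apply: ler_wpM2l; last exact: cauchy_schwarz.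
  by apply: mulr_ge0 => //; exact: ltW.
have {}H : r * r * E <= C * decay x y.
  apply: le_trans H; rewrite le_eqVlt; apply/orP; left; apply/eqP; congr (_ * _).
  rewrite (_ : 2 * (n / 2 + 1) - n = 2%:R); last by field.
  by rewrite powR_mulrn ?(ltW r0).
have rE : r * E <= C * decay x y / xn.
  rewrite ler_pdivlMr// mulrC; apply: le_trans H.
  by rewrite mulrA ler_wpM2r// ler_wpM2r// ltW.
rewrite (_ : _ * (r * enorm v) = kernel_const m a * enorm v * (r * E)); last by ring.
rewrite (_ : _ * decay x y = kernel_const m a * enorm v * (C * decay x y / xn)); last by ring.
by rewrite ler_wpM2l// mulr_ge0 ?enorm_ge0 ?(ltW k0).
Qed.

End differentiation.

Section single_layer_gradient.
Context {R : realType}.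
Variable m : nat.
Local Notation RT := (measurableTypeR R).
Local Notation mu := (@lebesgue_measure R).
Local Notation n := (m.+1%:R : R).
Local Notation ST := (@spacetime_measure R m).
Implicit Types (a t q : R) (x v : 'rV[R]_m.+1).

Lemma rho_half x xi (y : m.-tuple RT) : enorm (xi - x) <= x 0 ord_max / 2 ->
  x 0 ord_max / 2 <= enorm (xi - bdry_pt y).
Proof.
move=> xix; have := ler_coord_enorm (xi - bdry_pt y) ord_max.
have := ler_coord_enorm (xi - x) ord_max; rewrite !mxE nth_default ?size_tuple// oppr0 addr0.
have := ler_norm (xi 0 ord_max); rewrite -(normrN (_ - _)) opprB.
have := ler_norm (x 0 ord_max - xi 0 ord_max).
by move: xix; lra.
Qed.

Lemma derive_line x v (f : 'rV[R]_m.+1 -> R) : 'D_v f x = 'D_1 (fun h : R => f (h *: v + x)) 0.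
Proof.
rewrite /derive; set g1 := fun h => h^-1 *: _; set g2 := fun h => h^-1 *: _.
suff -> : g1 = g2 by [].
by apply/funext => h; rewrite /g1 /g2 /= addr0 scale0r add0r [_%:A]mulr1.
Qed.

Lemma rho_line x i h (y : m.-tuple RT) :
  enorm (h *: delta_mx 0 i + x - bdry_pt y) ^+ 2 =
  enorm (x - bdry_pt y) ^+ 2 + 2 * h * (x - bdry_pt y) 0 i + h ^+ 2.
Proof.
rewrite -addrA !enorm_sqr; move: (x - _) => d.
rewrite dotpDl !dotpDr !dotpZl !dotpZr dotp_delta.
rewrite (dotpC (delta_mx 0 i)) !dotp_delta.
have -> : (delta_mx 0 i : 'rV[R]_m.+1) 0 i = 1 by rewrite mxE !eqxx.
by ring.
Qed.

Lemma is_derive_heat (r2 d B k h : R) :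
  is_derive h 1 (fun h : R => expR (- ((r2 + 2 * h * d + h ^+ 2) / B)) * k)
    (- ((2 * d + 2 * h) / B) * (expR (- ((r2 + 2 * h * d + h ^+ 2) / B)) * k)).
Proof.
have dP : is_derive h 1 (fun h : R => (- B^-1) * (r2 + 2 * d * h + h ^+ 2))
    (- B^-1 * (2 * d + 2 * h)).
  apply: is_derive_eq; rewrite /GRing.scale/= !mulr1; ring.
have dE := is_derive1_comp (is_derive_expR _) dP.
rewrite (_ : (fun _ => _) = fun h : R =>
    k * (expR \o (fun h : R => (- B^-1) * (r2 + 2 * d * h + h ^+ 2))) h); last first.
  by apply/funext => z /=; rewrite mulrC; congr (_ * expR _); ring.
apply: (is_derive_eq (is_deriveZ k dE)).
rewrite /GRing.scale/= (_ : - B^-1 * (r2 + 2 * d * h + h ^+ 2) =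
  - ((r2 + 2 * h * d + h ^+ 2) / B)); by ring.
Qed.

Lemma single_layer_derive a x t (p : \bar R) g i :
  0 < a -> 0 < x 0 ord_max -> 0 < t -> (1 <= p)%E -> g \in Lfun ST p ->
  derivable (fun y => single_layer a g y t) x (delta_mx 0 i) /\
  'D_(delta_mx 0 i) (fun y => single_layer a g y t) x =
    \int[ST]_(z in strip t) (grad_kernel a x t (delta_mx 0 i) z * g z).
Proof.
move=> a0 x0 t0 p1 gLp; set e := delta_mx 0 i.
have mg : measurable_fun setT g by move: gLp; rewrite inE => /andP[/[!inE]].
pose xn := x 0 ord_max; have xn0 : 0 < xn by [].
pose b := 4 * a ^+ 2; have b0 : 0 < b by rewrite mulr_gt0// exprn_gt0.
pose f (h : R) (z : m.-tuple RT * RT) : R :=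
  expR (- (enorm (h *: e + x - bdry_pt z.1) ^+ 2 / (b * (t - z.2)))) / (t - z.2) `^ (n / 2) * g z.
pose c1 := - (2 * a ^+ 2 / (4 * a ^+ 2 * pi) `^ (n / 2)).
have SL (h : R) : single_layer a g (h *: e + x) t = c1 * \int[ST]_(z in strip t) f h z by [].
pose df (h : R) (z : m.-tuple RT * RT) : R :=
  - ((2 * (x - bdry_pt z.1) 0 i + 2 * h) / (b * (t - z.2))) * f h z.
have fd (h : R) z : is_derive h 1 (f ^~ z) (df h z).
  have := is_derive_heat (enorm (x - bdry_pt z.1) ^+ 2) ((x - bdry_pt z.1) 0 i)
    (b * (t - z.2)) (((t - z.2) `^ (n / 2))^-1 * g z) h.
  have E (k : R) : expR (- ((enorm (x - bdry_pt z.1) ^+ 2 + 2 * k * (x - bdry_pt z.1) 0 i + k ^+ 2) /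
      (b * (t - z.2)))) * (((t - z.2) `^ (n / 2))^-1 * g z) = f k z.
    by rewrite -rho_line mulrA.
  by under eq_fun do rewrite E; rewrite E.
have mS := @measurable_strip R m t.
have enormh (h : R) : enorm (h *: e + x - x) = `|h|.
  rewrite addrK enormZ (_ : enorm e = 1) ?mulr1//.
  by rewrite /enorm dotp_delta mxE !eqxx sqrtr1.
have mw := @measurable_decay1 R m x.
have iw : ST.-integrable (strip t) (fun z => (decay x z.1 * `|g z|)%:E).
  apply: (weighted_Lp_integrable (M := (xn ^+ m.+1)^-1) (p := p)) => //.
    by move=> z _; rewrite decay_ge0 decay_le.
  exact: integral_decay.
have mf (h : R) : measurable_fun (strip t) (EFin \o f h).
  apply/measurable_EFinP; apply: measurable_funTS; apply: measurable_funM => //.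
  exact: measurable_heat.
have zt z : strip t z -> z.2 < t.
  by move=> [_ /=]; rewrite in_itv/= => /andP[].
have [C0 C00 HC0] : exists2 C, 0 <= C & forall h z, `|h| <= xn / 2 -> strip t z ->
    `|f h z| <= C * (decay x z.1 * `|g z|).
  have nc : n <= 2 * (n / 2) by lra.
  have [C C0 HC] := heat_decay_bound x0 b0 nc; exists C => // h z hx /zt zt'.
  have ts : 0 < t - z.2 by rewrite subr_gt0.
  have := HC (h *: e + x) z.1 _ ts; rewrite enormh => /(_ hx).
  rewrite (_ : 2 * (n / 2) - n = 0); last by field.
  rewrite powRr0 mul1r mulrA normrM => H.
  by rewrite ler_wpM2r// ger0_norm// divr_ge0 ?expR_ge0 ?powR_ge0.
have [C1 C10 HC1] : exists2 C, 0 <= C & forall h z, `|h| <= xn / 2 -> strip t z ->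
    `|df h z| <= C * (decay x z.1 * `|g z|).
  have nc : n <= 2 * (n / 2 + 1) by lra.
  have [C Cge0 HC] := heat_decay_bound x0 b0 nc.
  exists (4 / b / xn * C); first by rewrite !mulr_ge0 ?invr_ge0 ?(ltW b0) ?(ltW xn0).
  move=> h z hx /zt zt'; have ts : 0 < t - z.2 by rewrite subr_gt0.
  have hx' : enorm (h *: e + x - x) <= x 0 ord_max / 2 by rewrite enormh.
  have := HC (h *: e + x) z.1 _ ts hx'; have := rho_half z.1 hx'.
  rewrite /df /f (_ : 2 * (x - _) 0 i + 2 * h = 2 * (h *: e + x - bdry_pt z.1) 0 i); last first.
    rewrite -addrA [(_ + (x - _)) _ _]mxE [(h *: e) _ _]mxE.
    by rewrite (_ : e 0 i = 1); [ring|rewrite mxE !eqxx].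
  have := ler_coord_enorm (h *: e + x - bdry_pt z.1) i.
  set r := enorm _; set di := (_ - bdry_pt _) 0 i; set E := expR _.
  rewrite (_ : 2 * (n / 2 + 1) - n = 2%:R); last by field.
  move=> dir xr; have r0 : 0 < r by apply: lt_le_trans xr; rewrite divr_gt0.
  rewrite powR_mulrn ?(ltW r0)// => H.
  have sE : (t - z.2) `^ (n / 2 + 1) = (t - z.2) * (t - z.2) `^ (n / 2).
    by rewrite powRD ?(gt_eqF ts) ?implybT// powRr1 ?(ltW ts)// mulrC.
  rewrite sE in H; set S := (t - z.2) `^ (n / 2) in H *.
  have S0 : 0 < S by rewrite powR_gt0.
  have E0 : 0 < E by exact: expR_gt0.
  pose Q := 2 / (b * (t - z.2)) * (E / S).
  have Q0 : 0 < Q by rewrite !mulr_gt0// invr_gt0 ?mulr_gt0.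
  rewrite (_ : _ * (_ / S * _) = - Q * di * g z); last by rewrite /Q; ring.
  rewrite !normrM normrN (gtr0_norm Q0) mulrA ler_wpM2r//.
  apply: (@le_trans _ _ (Q * r)); first by rewrite ler_wpM2l// ltW.
  rewrite (_ : Q * r = 2 / b * (r * (E / ((t - z.2) * S)))); last first.
    by rewrite /Q; field; rewrite !gt_eqF.
  rewrite (_ : 4 / b / xn * C * decay x z.1 = 2 / b * (C * decay x z.1 / (xn / 2))); last first.
    by field; rewrite !gt_eqF.
  rewrite ler_wpM2l ?divr_ge0 ?(ltW b0)// ler_pdivlMr ?divr_gt0//.
  apply: le_trans H; rewrite expr2 mulrAC ler_wpM2r ?divr_ge0 ?mulr_ge0 ?(ltW E0) ?(ltW S0) ?(ltW ts)//.
  by rewrite ler_wpM2l// ltW.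
have I0 : `](- (xn / 2)), (xn / 2)[%classic (0 : R).
  by rewrite /= in_itv/= oppr_lt0 divr_gt0.
have Ih h : `](- (xn / 2)), (xn / 2)[%classic h -> `|h| <= xn / 2.
  by rewrite /= in_itv/= => /andP[h1 h2]; rewrite ler_norml !ltW.
have iCw C : ST.-integrable (strip t) (EFin \o (fun z => C * (decay x z.1 * `|g z|))).
  rewrite (_ : _ \o _ = fun z => (C%:E * (decay x z.1 * `|g z|)%:E)%E); last first.
    by apply/funext => z; rewrite /= EFinM.
  exact: integrableZl.
have intf h : `](- (xn / 2)), (xn / 2)[%classic h -> ST.-integrable (strip t) (EFin \o f h).
  move=> /Ih hx; apply: le_integrable (iCw C0) => // z Sz.
  by rewrite /= lee_fin (le_trans (HC0 _ _ hx Sz))// ler_norm.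
pose G z := C1 * (decay x z.1 * `|g z|).
have G0 z : 0 <= G z by rewrite !mulr_ge0// decay_ge0.
have Gub (h : R) z : `](- (xn / 2)), (xn / 2)[%classic h -> strip t z -> `|partial1of2 f h z| <= G z.
  move=> /Ih hx Sz; rewrite partial1of2E; have [_ ->] := fd h z; exact: HC1.
have derf (h : R) z : `](- (xn / 2)), (xn / 2)[%classic h -> strip t z -> derivable (f ^~ z) h 1.
  by move=> _ _; have [] := fd h z.
have dF : derivable (fun h => \int[ST]_(z in strip t) f h z) 0 1.
  apply: (@cvgP _ _ (\int[ST]_(z in strip t) (partial1of2 f ^~ z) 0)).
  under eq_fun do rewrite [_%:A]mulr1.
  exact: (cvg_differentiation_under_integral mS I0 intf derf G0 (iCw C1) Gub).
have EF := differentiation_under_integral mS I0 intf derf G0 (iCw C1) Gub.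
have SLE : (fun h : R => single_layer a g (h *: e + x) t) =
    c1 \*: (fun h => \int[ST]_(z in strip t) f h z) by [].
split; first by apply/derivable1P; rewrite SLE; exact: derivableZ.
rewrite derive_line SLE deriveZ// -derive1E EF /GRing.scale/=.
have idf : ST.-integrable (strip t) (EFin \o partial1of2 f 0).
  apply: le_integrable (iCw C1) => //.
    apply/measurable_EFinP; rewrite (_ : partial1of2 f 0 = df 0); last first.
      by apply/funext => z; rewrite partial1of2E; have [_ ->] := fd 0 z.
    apply: measurable_funTS; apply: measurable_funM.
      apply: measurableT_comp => //; apply: measurable_divr.
        apply: measurable_funD => //; apply: measurable_funM => //.
        under eq_fun do rewrite -dotp_delta.
        by apply: (measurableT_comp (measurable_dotp_bdry x _)); exact: measurable_fst.
      by apply: measurable_funM => //; exact: measurable_funB.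
    by apply: measurable_funM => //; exact: measurable_heat.
  by move=> z Sz; rewrite /= lee_fin (le_trans (Gub _ _ I0 Sz))// ler_norm.
rewrite -RintegralZl//; apply: eq_Rintegral => z; rewrite inE => /zt zt'.
have ts : 0 < t - z.2 by rewrite subr_gt0.
rewrite partial1of2E; have [_ ->] := fd 0 z.
rewrite /df /f /grad_kernel /grad_weight /kernel_const scale0r add0r mulr0 addr0 dotp_delta -/b.
set E := expR _; set di := (_ - bdry_pt _) 0 i.
have sE : (t - z.2) `^ (n / 2 + 1) = (t - z.2) * (t - z.2) `^ (n / 2).
  by rewrite powRD ?(gt_eqF ts) ?implybT// powRr1 ?(ltW ts)// mulrC.
rewrite sE /c1 -/b; set S := (t - z.2) `^ (n / 2).
have S0 : 0 < S by rewrite powR_gt0.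
have K0 : 0 < (b * pi) `^ (n / 2) by rewrite powR_gt0// mulr_gt0// pi_gt0.
rewrite /b in K0 *; field.
by rewrite !gt_eqF.
Qed.

End single_layer_gradient.

Section gradient_pairing.
Context {R : realType}.
Variable m : nat.
Local Notation RT := (measurableTypeR R).
Local Notation ST := (@spacetime_measure R m).
Implicit Types (a t q : R) (x v : 'rV[R]_m.+1) (p : \bar R).

Lemma strip_half t : strip t `<=` @half_spacetime R m.
Proof. by move=> z [_ /=]; rewrite in_itv/= => /andP[z0 _]; split => //=; rewrite in_itv/= z0. Qed.

Lemma single_layer_half a g : single_layer a g =
  single_layer a (g \_ (@half_spacetime R m)).
Proof.
apply/funext => x; apply/funext => t; congr (_ * _); apply: eq_Rintegral => z.
by rewrite inE => /strip_half zh; rewrite patchE mem_set.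
Qed.

Lemma grad_kernel_integrable a x t v p g :
  0 < a -> 0 < x 0 ord_max -> 0 < t -> (1 <= p)%E -> g \in Lfun ST p ->
  ST.-integrable (strip t) (fun z => (grad_kernel a x t v z * g z)%:E).
Proof.
move=> a0 x0 t0 p1 gLp.
have mg : measurable_fun setT g by move: gLp; rewrite inE => /andP[/[!inE]].
have mS := @measurable_strip R m t; have mw := @measurable_decay1 R m x.
have iw : ST.-integrable (strip t) (fun z => (decay x z.1 * `|g z|)%:E).
  apply: (weighted_Lp_integrable (M := (x 0 ord_max ^+ m.+1)^-1) (p := p)) => //.
    by move=> z _; rewrite decay_ge0 decay_le.
  exact: integral_decay.
have [C C0 HC] := grad_kernel_bound t a0 x0.
apply: (@le_integrable _ _ _ ST _ mS _
    (fun z => ((C * enorm v)%:E * (decay x z.1 * `|g z|)%:E)%E)).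
- apply/measurable_EFinP; apply: measurable_funTS; apply: measurable_funM => //.
  exact: measurable_grad_kernel.
- move=> [y s] [_ /=]; rewrite in_itv/= => /andP[_ st].
  rewrite lee_fin (le_trans _ (ler_norm _))// normrM mulrA ler_wpM2r//.
  exact: HC.
exact: integrableZl.
Qed.

Lemma Rintegral_lincomb d (T : measurableType d) (nu : {measure set T -> \bar R})
    (D : set T) k (c : 'I_k -> R) (f : 'I_k -> T -> R) :
  measurable D -> (forall i, nu.-integrable D (EFin \o f i)) ->
  \sum_(i < k) c i * \int[nu]_(z in D) f i z =
  \int[nu]_(z in D) (\sum_(i < k) c i * f i z).
Proof.
move=> mD intf.
have ic i : nu.-integrable D (fun z => (c i * f i z)%:E).
  by under eq_fun do rewrite EFinM; apply: integrableZl => //; exact: intf.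
transitivity (fine (\sum_(i < k) (c i * \int[nu]_(z in D) f i z)%:E)%E).
  by rewrite sumEFin.
rewrite [RHS]/Rintegral; congr fine.
transitivity (\int[nu]_(z in D) \sum_(i <- index_enum 'I_k) (c i * f i z)%:E)%E; last first.
  by apply: eq_integral => z _; rewrite sumEFin.
rewrite (integral_sum mD ic); apply: eq_bigr => i _.
by rewrite -RintegralZl// /Rintegral fineK//; apply: integrable_fin_num => //; exact: ic.
Qed.

Lemma gradient_pairing a x t p g v :
  0 < a -> 0 < x 0 ord_max -> 0 < t -> (1 <= p)%E -> Lp_data p g ->
  dotp (gradient (fun y => single_layer a g y t) x) v =
  \int[ST]_(z in strip t) (grad_kernel a x t v z * g z).
Proof.
move=> a0 x0 t0 p1 gLp; have mS := @measurable_strip R m t.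
have gh z : strip t z -> (g \_ (@half_spacetime R m)) z = g z.
  by move=> /strip_half zh; rewrite patchE mem_set.
rewrite /dotp /gradient single_layer_half.
under eq_bigr => i _.
  rewrite mxE (single_layer_derive i a0 x0 t0 p1 gLp).2 mulrC.
  over.
rewrite (@Rintegral_lincomb _ _ ST _ _ (fun i => v 0 i)
  (fun i z => grad_kernel a x t (delta_mx 0 i) z * (g \_ (@half_spacetime R m)) z))//; last first.
  by move=> i; exact: (grad_kernel_integrable _ a0 x0 t0 p1 gLp).
apply: eq_Rintegral => z; rewrite inE => /gh ->.
transitivity (grad_weight a x t z * g z * dotp (x - bdry_pt z.1) v).
  rewrite [in RHS]/dotp mulr_sumr; apply: eq_bigr => i _.
  by rewrite /grad_kernel dotp_delta; ring.
by rewrite /grad_kernel; ring.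
Qed.

Lemma single_layer_derivable a x t p g i :
  0 < a -> 0 < x 0 ord_max -> 0 < t -> (1 <= p)%E -> Lp_data p g ->
  derivable (fun y => single_layer a g y t) x (delta_mx 0 i).
Proof.
move=> a0 x0 t0 p1 gLp; rewrite single_layer_half.
exact: (single_layer_derive i a0 x0 t0 p1 gLp).1.
Qed.

End gradient_pairing.

(** * Duality *)

Section duality.
Context {R : realType} d (T : measurableType d) (nu : {measure set T -> \bar R}).
Variable D : set T.
Hypothesis mD : measurable D.
Implicit Types (p : \bar R) (q I C : R) (K g : T -> R).

Definition conj_pair p q :=
  (p = +oo%E /\ q = 1) \/ (exists2 r : R, p = r%:E & [/\ 1 < r, 1 < q & r^-1 + q^-1 = 1]).

Lemma conj_pair_ge1 p q : conj_pair p q -> 1 <= q.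
Proof. by move=> [[_ ->//]|[r _ [_ /ltW]]]. Qed.

Lemma conj_pair_p_ge1 p q : conj_pair p q -> (1 <= p)%E.
Proof. by move=> [[-> _]|[r -> [/ltW ? _ _]]]; rewrite ?leey ?lee_fin. Qed.

Lemma integral_patch_abse (h : T -> R) q : 0 < q ->
  (\int[nu]_z (`|(EFin \o (h \_ D)) z| `^ q) = \int[nu]_(z in D) (`|h z| `^ q)%:E)%E.
Proof.
move=> q0; rewrite [RHS]integral_mkcond; apply: eq_integral => z _.
rewrite /= !patchE; case: ifP => _ //=.
by rewrite normr0 powR0// gt_eqF.
Qed.

Lemma Lnorm_patch (h : T -> R) q I : 0 < q ->
  (\int[nu]_(z in D) (`|h z| `^ q)%:E = I%:E)%E ->
  'N[nu]_q%:E[EFin \o (h \_ D)]%E = (I `^ q^-1)%:E.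
Proof. by move=> q0 hI; rewrite unlock /Lnorm integral_patch_abse// hI. Qed.

Lemma measurable_patch g : measurable_fun setT g -> measurable_fun setT (g \_ D).
Proof. by move=> mg; apply/(measurable_restrictT _ mD); exact: measurable_funTS. Qed.

Lemma pairing_le p q K g I : conj_pair p q ->
  measurable_fun setT K -> measurable_fun setT g ->
  (\int[nu]_(z in D) (`|K z| `^ q)%:E = I%:E)%E ->
  nu.-integrable D (fun z => (K z * g z)%:E) ->
  ((`|\int[nu]_(z in D) (K z * g z)|)%:E <= (I `^ q^-1)%:E * 'N[nu]_p[EFin \o (g \_ D)])%E.
Proof.
move=> pq mK mg KI iKg; rewrite EFin_normr_Rintegral//.
apply: (le_trans (le_abse_integral _ mD _)); first by case/integrableP: iKg.
have mKg : measurable_fun setT (fun z => K z * g z) by exact: measurable_funM.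
case: pq => [[-> q1]|[r -> [r1 q1 rq]]].
  have I0 : 0 <= I.
    by rewrite -lee_fin -KI; apply: integral_ge0 => z _; rewrite lee_fin powR_ge0.
  rewrite q1 invr1 powRr1//.
  have [nu0|nu0] := eqVneq (nu setT) 0%E.
    apply: (@le_trans _ _ 0%E); last by rewrite mule_ge0// ?lee_fin// Lnorm_ge0.
    rewrite -[leRHS](integral0 nu D); apply: ae_ge0_le_integral => //.
    - by apply: measurableT_comp => //; apply/measurable_EFinP; exact: measurable_funTS.
    - by exists setT; split.
  set N := 'N[nu]_+oo[_]%E.
  have N0 : (0 <= N)%E by exact: Lnorm_ge0.
  apply: (@le_trans _ _ (\int[nu]_(z in D) ((`|K z|)%:E * N))%E).
    apply: ae_ge0_le_integral => //.
    - by apply: measurableT_comp => //; apply/measurable_EFinP; exact: measurable_funTS.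
    - by move=> z _; rewrite mule_ge0.
    - apply: emeasurable_funM => //; apply/measurable_EFinP; apply: measurable_funTS.
      exact: measurableT_comp.
    have nupos : (0 < nu setT)%E by rewrite lt0e nu0 measure_ge0.
    have := @ess_sup_ge _ _ _ nu (abse \o (EFin \o (g \_ D))).
    apply: filterS => z gz Dz; rewrite /= normrM EFinM lee_wpmul2l ?lee_fin//.
    rewrite /N unlock /Lnorm nupos; apply: le_trans gz.
    by rewrite /= patchE mem_set.
  rewrite ge0_integralZr//; last first.
    by apply/measurable_EFinP; apply: measurable_funTS; exact: measurableT_comp.
  rewrite lee_wpmul2r// -KI q1 le_eqVlt; apply/orP; left; apply/eqP.
  by apply: eq_integral => z _; rewrite powRr1.
have q0 : 0 < q by exact: lt_trans q1.
rewrite -(Lnorm_patch q0 KI).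
have H := @hoelder _ _ _ nu (K \_ D) (g \_ D) q r (measurable_patch mK) (measurable_patch mg)
  q0 (lt_trans ltr01 r1) _.
apply: le_trans (H _); last by rewrite addrC.
rewrite Lnorm1 [leLHS]integral_mkcond le_eqVlt; apply/orP; left; apply/eqP.
apply: eq_integral => z _; rewrite /= !patchE.
by case: ifP => _ //=; rewrite mul0r normr0.
Qed.

Lemma measurable_sgr K : measurable_fun setT K ->
  measurable_fun setT (fun z => Num.sg (K z)).
Proof.
move=> mK; rewrite (_ : (fun z => _) = fun z => K z / `|K z|).
  by apply: measurable_divr => //; exact: measurableT_comp.
apply/funext => z; have [->|K0] := eqVneq (K z) 0; first by rewrite sgr0 mul0r.
by rewrite {2}[K z]numEsg mulfK// normr_eq0.
Qed.

(* The equality case of Hoelder's inequality. *)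
Definition dual_fun q K : T -> R := (fun z => Num.sg (K z) * `|K z| `^ (q - 1)) \_ D.

Lemma measurable_dual_fun q K : measurable_fun setT K -> measurable_fun setT (dual_fun q K).
Proof.
move=> mK; apply: measurable_patch; apply: measurable_funM; first exact: measurable_sgr.
apply: (measurableT_comp (measurable_powR _)); exact: measurableT_comp.
Qed.

Lemma dual_fun_pairing q K z : 1 <= q -> D z -> K z * dual_fun q K z = `|K z| `^ q.
Proof.
move=> q1 Dz; rewrite /dual_fun patchE mem_set// mulrA (mulrC (K z)) -normrEsg.
have q0 : 0 < q by exact: lt_le_trans q1.
have [K0|K0] := eqVneq (K z) 0; first by rewrite K0 normr0 mul0r powR0// gt_eqF.
rewrite -[X in X * _]powRr1// -powRD ?normr_eq0 ?K0 ?implybT//.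
by rewrite addrCA subrr addr0.
Qed.

Lemma dual_fun_norm p q K I : conj_pair p q -> measurable_fun setT K ->
  (\int[nu]_(z in D) (`|K z| `^ q)%:E = I%:E)%E ->
  ('N[nu]_p[EFin \o dual_fun q K] <= (I `^ (1 - q^-1))%:E)%E.
Proof.
move=> pq mK KI.
case: pq => [[-> q1]|[r -> [r1 q1 rq]]].
  rewrite q1 invr1 subrr powRr0 unlock /Lnorm; case: ifPn => // _.
  apply/ess_supP; apply: aeW => z; rewrite /= lee_fin /dual_fun patchE.
  case: ifP => _; last by rewrite normr0.
  by rewrite subrr powRr0 mulr1 normr_sg; case: (_ != _).
have r0 : 0 < r by exact: lt_trans r1.
rewrite /dual_fun (@Lnorm_patch _ r I)//.
  by rewrite -rq addrK.
rewrite -KI; apply: eq_integral => z _; congr EFin.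
have qE : (q - 1) * r = q.
  have q0 : 0 < q by exact: lt_trans q1.
  have r0' : r != 0 by rewrite gt_eqF.
  have q0' : q != 0 by rewrite gt_eqF.
  have : (r * q) * (r^-1 + q^-1) = r * q by rewrite rq mulr1.
  rewrite mulrDr mulrAC divff// mul1r -mulrA divff// mulr1 => E.
  by rewrite mulrBl mul1r -[X in _ - X](addrK q) [r + q]addrC E; ring.
rewrite normrM (ger0_norm (powR_ge0 _ _)).
have [K0|K0] := eqVneq (K z) 0.
  rewrite K0 sgr0 normr0 mul0r !powR0// gt_eqF//.
  exact: lt_trans q1.
by rewrite normr_sg K0 mul1r -powRrM qE.
Qed.

End duality.

Section sharp_constant.
Context {R : realType}.
Variable m : nat.
Local Notation RT := (measurableTypeR R).
Local Notation ST := (@spacetime_measure R m).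
Variables (a t : R) (x : 'rV[R]_m.+1).
Hypotheses (a0 : 0 < a) (x0 : 0 < x 0 ord_max) (t0 : 0 < t).
Implicit Types (q : R) (v : 'rV[R]_m.+1) (p : \bar R).
Local Notation K := (grad_kernel a x t).

Definition kernel_moment q v : R := \int[ST]_(z in strip t) (`|K v z| `^ q).

Let mS := @measurable_strip R m t.

Lemma measurable_moment q v : measurable_fun setT (fun z => `|K v z| `^ q).
Proof.
apply: (measurableT_comp (measurable_powR q)).
by apply: (measurableT_comp (@normr_measurable R setT)); exact: measurable_grad_kernel.
Qed.

Lemma kernel_bounds : exists M J, [/\ 0 < M, 0 < J &
  forall v, (forall z, strip t z -> `|K v z| <= M * enorm v) /\
    (\int[ST]_(z in strip t) (`|K v z|)%:E <= (J * enorm v)%:E)%E].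
Proof.
have [C C0 HC] := grad_kernel_bound t a0 x0.
have mw := @measurable_decay1 R m x.
have mwE : measurable_fun (strip t) (fun z : m.-tuple RT * RT => (decay x z.1)%:E).
  by apply/measurable_EFinP; exact: measurable_funTS.
have I0 : (0 <= \int[ST]_(z in strip t) (decay x z.1)%:E)%E.
  by apply: integral_ge0 => z _; rewrite lee_fin decay_ge0.
have IE : (fine (\int[ST]_(z in strip t) (decay x z.1)%:E))%:E =
    (\int[ST]_(z in strip t) (decay x z.1)%:E)%E.
  by rewrite fineK// ge0_fin_numE// integral_decay.
set I := fine _ in IE.
have Ige0 : 0 <= I by rewrite -lee_fin IE.
have X0 : 0 <= (x 0 ord_max ^+ m.+1)^-1 by rewrite invr_ge0 exprn_ge0// ltW.
have KC v z : strip t z -> `|K v z| <= C * enorm v * decay x z.1.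
  by case: z => y s [_ /=]; rewrite in_itv/= => /andP[_ /HC].
exists (C * (x 0 ord_max ^+ m.+1)^-1 + 1), (C * I + 1); split.
- by rewrite ltr_wpDl// mulr_ge0.
- by rewrite ltr_wpDl// mulr_ge0.
move=> v; have Cv0 : 0 <= C * enorm v by rewrite mulr_ge0// enorm_ge0.
split => [z Sz|].
  apply: le_trans (KC v z Sz) _; rewrite mulrDl mul1r.
  apply: (@le_trans _ _ (C * (x 0 ord_max ^+ m.+1)^-1 * enorm v)); last first.
    by rewrite lerDl enorm_ge0.
  by rewrite [leRHS]mulrAC ler_wpM2l// decay_le.
apply: (@le_trans _ _ (\int[ST]_(z in strip t) ((C * enorm v)%:E * (decay x z.1)%:E))%E).
  apply: ge0_le_integral => //.
  - apply/measurable_EFinP; apply: measurable_funTS; apply: measurableT_comp => //.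
    exact: measurable_grad_kernel.
  - exact: measurable_funeM.
  - by move=> z Sz; rewrite -EFinM lee_fin KC.
rewrite ge0_integralZl//; last by move=> z _; rewrite lee_fin decay_ge0.
by rewrite -IE -EFinM lee_fin mulrDl mul1r mulrAC lerDl enorm_ge0.
Qed.

Lemma kernel_moment_le M J q v : 1 <= q -> 0 < M ->
  {ae ST, forall z, strip t z -> `|K v z| <= M} ->
  (\int[ST]_(z in strip t) (`|K v z|)%:E <= J%:E)%E ->
  (\int[ST]_(z in strip t) (`|K v z| `^ q)%:E <= (M `^ (q - 1) * J)%:E)%E.
Proof.
move=> q1 M0 KM KJ.
have mK1 : measurable_fun (strip t) (fun z => (`|K v z|)%:E).
  apply/measurable_EFinP; apply: measurable_funTS; apply: measurableT_comp => //.
  exact: measurable_grad_kernel.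
rewrite EFinM; apply: (@le_trans _ _
    ((M `^ (q - 1))%:E * \int[ST]_(z in strip t) (`|K v z|)%:E)%E); last first.
  by rewrite lee_wpmul2l// lee_fin powR_ge0.
rewrite -ge0_integralZl//; last by rewrite lee_fin powR_ge0.
apply: ae_ge0_le_integral => //.
- by apply/measurable_EFinP; apply: measurable_funTS; exact: measurable_moment.
- by move=> z _; rewrite mule_ge0// lee_fin powR_ge0.
- exact: measurable_funeM.
apply: filterS KM => z /= KM Sz; rewrite -EFinM lee_fin.
have q0 : 0 < q by exact: lt_le_trans q1.
have [K0|K0] := eqVneq `|K v z| 0.
  by rewrite K0 mulr0 powR0// gt_eqF.
have -> : `|K v z| `^ q = `|K v z| `^ (q - 1) * `|K v z|.
  by rewrite -[X in _ * X]powRr1// -powRD ?K0 ?implybT// subrK.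
by rewrite ler_wpM2r// ge0_ler_powR// ?nnegrE ?subr_ge0 ?(ltW M0)// KM.
Qed.

Lemma kernel_momentE q v : 1 <= q ->
  (\int[ST]_(z in strip t) (`|K v z| `^ q)%:E = (kernel_moment q v)%:E)%E.
Proof.
move=> q1; rewrite /kernel_moment /Rintegral fineK// ge0_fin_numE; last first.
  by apply: integral_ge0 => z _; rewrite lee_fin powR_ge0.
have [M [J [M0 J0 /(_ v)[KM KJ]]]] := kernel_bounds.
apply: le_lt_trans (@kernel_moment_le (M * enorm v + 1) _ q v q1 _ _ KJ) _.
- by rewrite ltr_wpDl// mulr_ge0 ?enorm_ge0// ltW.
- by apply: aeW => z /KM /le_trans; apply; rewrite lerDl.
exact: ltry.
Qed.

Lemma kernel_moment_ge0 q v : 0 <= kernel_moment q v.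
Proof. by apply: Rintegral_ge0 => z _; exact: powR_ge0. Qed.

Lemma strip_gt0 : (0 < ST (strip t))%E.
Proof.
rewrite /strip /spacetime_measure/= product_measure1E//.
apply: mule_gt0; last first.
  have : (0 < @lebesgue_measure R (`]0%R, t[%classic : set R))%E.
    by rewrite lebesgue_measure_itv/= lte_fin t0 sube0 lte_fin.
  by [].
apply: (@lt_le_trans _ _ (lebesgue_tuple R m (box (fun=> `[0%R, 1%R]%classic)))).
  rewrite lebesgue_tuple_boxE; last by move=> i; exact: measurable_itv.
  rewrite (eq_bigr (fun=> 1%:E)) ?prodEFin ?lte_fin ?prodr_gt0// => i _.
  by rewrite lebesgue_measure_itv/= lte_fin ltr01 sube0.
by apply: le_measure; rewrite ?inE//; apply: measurable_box => i; exact: measurable_itv.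
Qed.

Lemma kernel_normal_gt0 z : strip t z -> 0 < K (delta_mx 0 ord_max) z.
Proof.
case: z => y s [_ /=]; rewrite in_itv/= => /andP[_ st].
rewrite /grad_kernel dotp_delta mxE [(- bdry_pt _) _ _]mxE bdry_pt_max subr0 mulr_gt0//.
by rewrite mulr_gt0 ?kernel_const_gt0// divr_gt0 ?expR_gt0// powR_gt0// subr_gt0.
Qed.

Lemma kernel_moment_normal_gt0 q : 1 <= q -> 0 < kernel_moment q (delta_mx 0 ord_max).
Proof.
move=> q1; rewrite lt0r kernel_moment_ge0 andbT; apply/eqP => I0.
have := kernel_momentE (delta_mx 0 ord_max) q1; rewrite I0 => I0'.
have mE : measurable_fun (strip t) (fun z => (`|K (delta_mx 0 ord_max) z| `^ q)%:E).
  by apply/measurable_EFinP; apply: measurable_funTS; exact: measurable_moment.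
have : (\int[ST]_(z in strip t) `|(`|K (delta_mx 0 ord_max) z| `^ q)%:E| = 0)%E.
  by rewrite -[RHS]I0'; apply: eq_integral => z _; rewrite gee0_abs// lee_fin powR_ge0.
move=> /(ae_eq_integral_abs ST mS mE) [N [mN N0 subN]].
have : (ST (strip t) <= ST N)%E.
  apply: le_measure; rewrite ?inE// => z Sz; apply: subN => /(_ Sz)/= [] /eqP.
  by rewrite gt_eqF// powR_gt0// normr_gt0 gt_eqF// kernel_normal_gt0.
by rewrite N0 leNgt strip_gt0.
Qed.

Lemma enorm_delta (i : 'I_m.+1) : enorm (delta_mx 0 i : 'rV[R]_m.+1) = 1.
Proof. by rewrite /enorm dotp_delta mxE !eqxx sqrtr1. Qed.

Lemma data_norm_half p (g : m.-tuple RT * RT -> R) :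
  data_norm p t g = 'N[ST]_p[EFin \o ((g \_ (@half_spacetime R m)) \_ (strip t))]%E.
Proof.
apply: eq_Lnorm => z; rewrite /= !patchE; case: ifPn => //.
by rewrite inE => /strip_half zh; rewrite mem_set.
Qed.

Lemma gradient_bound_of p C : (1 <= p)%E -> 0 <= C ->
  (forall v g, enorm v = 1 -> measurable_fun setT g -> g \in Lfun ST p ->
    ((`|\int[ST]_(z in strip t) (K v z * g z)|)%:E <=
      C%:E * 'N[ST]_p[EFin \o (g \_ (strip t))])%E) ->
  gradient_bound a p x t C.
Proof.
move=> p1 C0 H g gLp; set G := gradient _ _.
have [G0|G0] := eqVneq (enorm G) 0.
  by rewrite G0 mule_ge0 ?lee_fin// Lnorm_ge0.
pose v := (enorm G)^-1 *: G.
have v1 : enorm v = 1.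
  by rewrite enormZ ger0_norm ?invr_ge0 ?enorm_ge0// mulVf.
have -> : enorm G = dotp G v.
  by rewrite dotpZr -enorm_sqr expr2 mulKf.
rewrite (gradient_pairing v a0 x0 t0 p1 gLp) data_norm_half.
have mg : measurable_fun setT (g \_ (@half_spacetime R m)).
  by move: gLp; rewrite /Lp_data inE => /andP[/[!inE]].
apply: le_trans (H _ _ v1 mg gLp); rewrite lee_fin (le_trans (ler_norm _))//.
rewrite le_eqVlt; apply/orP; left; apply/eqP; congr (`| _ |); apply: eq_Rintegral => z.
by rewrite inE => /strip_half zh; rewrite patchE mem_set.
Qed.

Lemma patch_strip_half (h : m.-tuple RT * RT -> R) :
  (h \_ (strip t)) \_ (@half_spacetime R m) = h \_ (strip t).
Proof.
apply/funext => z; rewrite !patchE; case: ifPn => //.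
by rewrite notin_setE => zh; rewrite memNset// => /strip_half.
Qed.

Lemma gradient_bound_test p C v h : (1 <= p)%E -> enorm v = 1 ->
  gradient_bound a p x t C -> measurable_fun setT (h \_ (strip t)) ->
  ('N[ST]_p[EFin \o (h \_ (strip t))] < +oo)%E ->
  ((\int[ST]_(z in strip t) (K v z * h z))%:E <= C%:E * 'N[ST]_p[EFin \o (h \_ (strip t))])%E.
Proof.
move=> p1 v1 HC mh hN.
have hLp : Lp_data p (h \_ (strip t)).
  by rewrite /Lp_data patch_strip_half inE; apply/andP; split; rewrite inE.
have := HC _ hLp; rewrite {1}/data_norm.
have -> : (h \_ (strip t)) \_ (strip t) = h \_ (strip t).
  by apply/funext => z; rewrite !patchE; case: (z \in strip t).
apply: le_trans; rewrite lee_fin.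
have -> : \int[ST]_(z in strip t) (K v z * h z) =
    \int[ST]_(z in strip t) (K v z * (h \_ (strip t)) z).
  by apply: eq_Rintegral => z zS; rewrite patchE zS.
rewrite -(gradient_pairing v a0 x0 t0 p1 hLp).
by rewrite (le_trans (ler_norm _))// (le_trans (cauchy_schwarz _ _))// v1 mulr1.
Qed.

Lemma gradient_boundP p q C : conj_pair p q ->
  gradient_bound a p x t C <->
  (forall v, enorm v = 1 -> kernel_moment q v `^ q^-1 <= C).
Proof.
move=> pq; have q1 := conj_pair_ge1 pq; have p1 := conj_pair_p_ge1 pq.
have q0 : 0 < q by exact: lt_le_trans q1.
split => [HC|HC]; last first.
  have C0 : 0 <= C by apply: le_trans (HC _ (enorm_delta ord0)); exact: powR_ge0.
  apply: gradient_bound_of => // v g v1 mg gLp.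
  apply: le_trans (pairing_le mS pq _ mg (kernel_momentE v q1) _) _.
  - exact: measurable_grad_kernel.
  - exact: (grad_kernel_integrable v a0 x0 t0 p1 gLp).
  by rewrite lee_wpmul2r ?Lnorm_ge0// lee_fin HC.
have test v : enorm v = 1 ->
    exists2 N, 0 <= N <= kernel_moment q v `^ (1 - q^-1) & kernel_moment q v <= C * N.
  move=> v1; have mK := @measurable_grad_kernel R m a x t v.
  have mh := measurable_dual_fun mS q mK.
  have Nle := dual_fun_norm pq mK (kernel_momentE v q1).
  have Nfin : ('N[ST]_p[EFin \o dual_fun (strip t) q (K v)] < +oo)%E.
    by apply: le_lt_trans Nle _; exact: ltry.
  have := @gradient_bound_test p C v (fun z => Num.sg (K v z) * `|K v z| `^ (q - 1)) p1 v1 HC mh Nfin.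
  rewrite -/(dual_fun _ _ _) -/(dual_fun (strip t) q (K v)).
  have Nfin' : 'N[ST]_p[EFin \o dual_fun (strip t) q (K v)]%E \is a fin_num.
    by rewrite ge0_fin_numE// Lnorm_ge0.
  move: Nle Nfin' (Lnorm_ge0 ST p (EFin \o dual_fun (strip t) q (K v))).
  case: ('N[ST]_p[_])%E => // N; rewrite !lee_fin => Nle _ N0 H.
  exists N; first by rewrite N0.
  apply: le_trans H; rewrite le_eqVlt; apply/orP; left; apply/eqP.
  apply: eq_Rintegral => z zS; have Sz := set_mem zS.
  by rewrite -(dual_fun_pairing _ q1 Sz) /dual_fun patchE zS.
have C0 : 0 <= C.
  have [N /andP[N0 _] H] := test _ (enorm_delta ord_max).
  have Ipos := kernel_moment_normal_gt0 q1.
  rewrite leNgt; apply/negP => Cneg.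
  have : C * N <= 0 by rewrite mulr_le0_ge0// ltW.
  by rewrite leNgt (lt_le_trans Ipos H).
move=> v v1; have [N /andP[N0 Nle] H] := test v v1.
have [I0|I0] := eqVneq (kernel_moment q v) 0.
  by rewrite I0 powR0// invr_eq0 gt_eqF.
have Ipos : 0 < kernel_moment q v by rewrite lt0r I0 kernel_moment_ge0.
have Ip : 0 < kernel_moment q v `^ (1 - q^-1) by rewrite powR_gt0.
rewrite -(ler_pM2r Ip) -powRD ?I0 ?implybT// addrCA subrr addr0 powRr1 ?(ltW Ipos)//.
by apply: le_trans H _; rewrite ler_wpM2l.
Qed.

End sharp_constant.

(** * The maximum over unit vectors *)

Section lipschitz.
Context {R : realType}.
Variable k : nat.
Implicit Types v w : 'rV[R]_k.

Lemma coord_le_mx_norm v i : `|v 0 i| <= `|v|.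
Proof.
rewrite [leRHS]mx_normrE; apply/bigmax_geP; right; by exists (ord0, i).
Qed.

Lemma mx_norm_le_enorm v : `|v| <= enorm v.
Proof.
rewrite [leLHS]mx_normrE; apply/bigmax_leP; split; first exact: enorm_ge0.
by move=> [i j] _ /=; rewrite (ord1 i); exact: ler_coord_enorm.
Qed.

Lemma enorm_le_mx_norm v : enorm v <= k%:R * `|v|.
Proof.
rewrite -(ler_pXn2r (_ : (0 < 2)%N)) ?nnegrE ?enorm_ge0 ?mulr_ge0//.
rewrite enorm_sqr exprMn /dotp.
apply: (@le_trans _ _ (\sum_(i < k) `|v| ^+ 2)).
  apply: ler_sum => i _; rewrite -expr2 -real_normK ?num_real//.
  by rewrite lerXn2r ?nnegrE// coord_le_mx_norm.
rewrite sumr_const card_ord -[leLHS]mulr_natl ler_wpM2r ?sqr_ge0//.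
rewrite expr2 -natrM ler_nat; case: (k) => // j; rewrite leq_pmulr//.
Qed.

Lemma lipschitz_continuous (f : 'rV[R]_k -> R) (L : R) :
  (forall v w, f v - f w <= L * enorm (v - w)) -> continuous f.
Proof.
move=> fL v; apply/(@cvgrPdist_le _ _ _ (nbhs v) (nbhs_filter v)) => e e0.
pose L' := (`|L| + 1) * (k%:R + 1).
have L'0 : 0 < L' by rewrite mulr_gt0// ltr_wpDl.
have eL : 0 < e / L' by rewrite divr_gt0.
apply: (@nbhs_normP R 'rV[R]_k v _).2; exists (e / L') => // w /= /ltW vw.
have H u1 u2 : `|u1 - u2| <= e / L' -> f u1 - f u2 <= e.
  move=> u12; apply: le_trans (fL _ _) _.
  apply: (@le_trans _ _ (`|L| * enorm (u1 - u2))).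
    by rewrite ler_wpM2r ?enorm_ge0// ler_norm.
  apply: (@le_trans _ _ (L' * `|u1 - u2|)).
    rewrite -mulrA ler_pM ?enorm_ge0 ?lerDl//.
    by apply: le_trans (enorm_le_mx_norm _) _; rewrite ler_wpM2r// lerDl.
  by rewrite mulrC -ler_pdivlMr.
rewrite ler_norml H// andbT lerNl opprB H//.
by rewrite distrC.
Qed.

Lemma enorm_continuous : continuous (@enorm R k).
Proof.
apply: (@lipschitz_continuous _ 1) => v w.
by rewrite mul1r lerBlDr -{1}(subrK w v) ler_enormD.
Qed.

Lemma enorm_sphere_compact : compact [set v : 'rV[R]_k | enorm v = 1].
Proof.
apply: bounded_closed_compact.
  exists 1; split => // M M1 v /= v1.
  by rewrite (le_trans (mx_norm_le_enorm v))// v1 ltW.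
apply: (@closed_comp _ _ (@enorm R k) [set 1]); first by move=> v _; exact: enorm_continuous.
exact: closed_eq.
Qed.

End lipschitz.

Section max_val.
Context {R : realType}.

Lemma max_valE (A : set R) c : A c -> ubound A c -> max_val A = c.
Proof.
move=> Ac uAc; rewrite /max_val.
have := @xgetPex _ 0 (A `&` ubound A) (ex_intro _ c (conj Ac uAc)).
set y := xget _ _ => -[Ay uAy]; apply/eqP; rewrite eq_le.
by rewrite (uAc _ Ay) (uAy _ Ac).
Qed.

End max_val.

Section exponents.
Context {R : realType}.
Implicit Types (p : \bar R) (q : R).

Lemma conj_pairP p : (1 < p)%E -> conj_pair p (conj_exponent p).
Proof.
case: p => [r|_|//]; last by left; split => //; rewrite /conj_exponent hoelder_conjugatey.
rewrite lte_fin => r1.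
have r0 : 0 < r by exact: lt_trans r1.
right; exists r => //; rewrite conj_exponentE//; split => //.
  by rewrite ltr_pdivlMr ?subr_gt0// mul1r ltrBlDr ltrDl.
by rewrite invf_div mulrBl divff ?gt_eqF// mul1r addrCA subrr addr0.
Qed.

Lemma at_exponent_inv p q (f h : R -> R) : conj_pair p q ->
  (forall r, 1 < r -> f r = h r^-1) -> {for 0, continuous h} ->
  at_exponent f p = h (1 - q^-1).
Proof.
move=> [[-> ->]|[r -> [r1 q1 rq]]] fh ch; last first.
  by rewrite /at_exponent fh//; congr h; rewrite -rq addrK.
rewrite invr1 subrr /at_exponent; apply/cvg_lim => //.
apply: (@cvg_trans _ ((h \o GRing.inv) r @[r --> +oo])).
  by apply: near_eq_cvg; near=> r; rewrite /= fh//.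
apply: (@cvg_comp _ _ _ (@GRing.inv R) h _ (nbhs (0 : R))) => //.
apply/cvgrPdist_le => e e0; near=> r; rewrite sub0r normrN.
rewrite gtr0_norm ?invr_gt0// -[e]invrK lef_pV2 ?posrE ?invr_gt0//.
Unshelve. all: by end_near. Qed.

End exponents.

Section sphere_form.
Context {R : realType}.
Variable m : nat.
Local Notation n := (m.+1%:R : R).

Lemma kernel_const_root (a xn q : R) : 0 < a -> 0 < xn -> 1 <= q ->
  let s := 1 - q^-1 in
  (kernel_const m a `^ q * (q / (4 * a ^+ 2)) `^ (1 - q * (n / 2 + 1))
     * xn `^ (- ((n + 1) * (q - 1))) / 2) `^ q^-1 =
  2 `^ (3 * s - 1) * a `^ (2 * s) / (pi `^ (n / 2) * q `^ (n / 2 + s))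
    / xn `^ ((n + 1) * s).
Proof.
move=> a0 xn0 q1 s.
have q0 : 0 < q by apply: lt_le_trans q1.
have a20 : 0 < a ^+ 2 by rewrite exprn_gt0.
have p0 : 0 < (pi : R) by exact: pi_gt0.
have l4 : ln (4 : R) = 2 * ln 2.
  by rewrite (_ : 4 = 2 ^+ 2) ?lnXn// -?natrX// mulr_natl.
have la : ln (a ^+ 2) = 2 * ln a by rewrite lnXn// mulr_natl.
have b0 : 0 < 4 * a ^+ 2 * pi by rewrite !mulr_gt0.
have c0 : 0 < q / (4 * a ^+ 2) by rewrite divr_gt0// mulr_gt0.
have k0 : 0 < kernel_const m a by exact: kernel_const_gt0.
have lk : ln (kernel_const m a) = - (n / 2 * (2 * ln 2 + 2 * ln a + ln pi)).
  rewrite /kernel_const lnV ?posrE ?powR_gt0// ln_powR.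
  by rewrite lnM ?posrE ?mulr_gt0// lnM ?posrE// l4 la.
have lc : ln (q / (4 * a ^+ 2)) = ln q - (2 * ln 2 + 2 * ln a).
  by rewrite ln_div ?posrE ?mulr_gt0// lnM ?posrE// l4 la.
have lhs0 : 0 < kernel_const m a `^ q * (q / (4 * a ^+ 2)) `^ (1 - q * (n / 2 + 1))
     * xn `^ (- ((n + 1) * (q - 1))) / 2.
  by rewrite divr_gt0 ?mulr_gt0 ?powR_gt0.
rewrite powR_ln// ln_div ?posrE ?mulr_gt0 ?powR_gt0//.
rewrite !lnM ?posrE ?mulr_gt0 ?powR_gt0// !ln_powR lk lc.
rewrite !powR_ln// -!expRD -!expRN -!expRD; congr expR; rewrite /s; field.
by rewrite gt_eqF.
Qed.

End sphere_form.

Section kernel_norm.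
Context {R : realType}.
Variable m : nat.
Local Notation RT := (measurableTypeR R).
Local Notation n := (m.+1%:R : R).
Local Notation ST := (@spacetime_measure R m).
Variables (a t : R) (x : 'rV[R]_m.+1).
Hypotheses (a0 : 0 < a) (x0 : 0 < x 0 ord_max) (t0 : 0 < t).
Implicit Types (q : R) (v : 'rV[R]_m.+1) (p : \bar R).
Local Notation K := (grad_kernel a x t).

Definition kernel_norm q v : R := kernel_moment a t x q v `^ q^-1.

Lemma kernel_normE q v : 1 <= q ->
  (kernel_norm q v)%:E = 'N[ST]_q%:E[EFin \o (K v \_ (strip t))]%E.
Proof.
move=> q1; have q0 : 0 < q by exact: lt_le_trans q1.
by rewrite (Lnorm_patch q0 (kernel_momentE a0 x0 t0 v q1)).
Qed.

Lemma kernel_normD q v w : 1 <= q ->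
  kernel_norm q (v + w) <= kernel_norm q v + kernel_norm q w.
Proof.
move=> q1.
have mK u : measurable_fun setT (K u \_ (strip t)).
  by apply: measurable_patch; [exact: measurable_strip|exact: measurable_grad_kernel].
have KD : EFin \o (K (v + w) \_ (strip t)) =
    EFin \o (K v \_ (strip t) \+ K w \_ (strip t)).
  apply/funext => z /=; congr EFin; rewrite !patchE.
  by case: ifP => _; rewrite ?addr0// /grad_kernel dotpDr mulrDr.
have := minkowski_EFin ST (mK v) (mK w) q1.
rewrite -KD -(kernel_normE v q1) -(kernel_normE w q1) -(kernel_normE (v + w) q1).
by rewrite -EFinD lee_fin.
Qed.

Lemma kernel_norm_le q : 1 <= q -> exists L, forall v, kernel_norm q v <= L * enorm v.
Proof.
move=> q1; have q0 : 0 < q by exact: lt_le_trans q1.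
have [M [J [M0 J0 MJ]]] := kernel_bounds a0 x0 t0.
exists ((M `^ (q - 1) * J) `^ q^-1) => v; have [KM KJ] := MJ v.
have [v0|v0] := eqVneq (enorm v) 0.
  have := @kernel_moment_le R m a t x M _ q v q1 M0 _ KJ.
  rewrite kernel_momentE// v0 !mulr0 lee_fin => H.
  rewrite /kernel_norm (_ : kernel_moment _ _ _ _ _ = 0) ?powR0 ?invr_eq0 ?gt_eqF//.
  apply/eqP; rewrite eq_le kernel_moment_ge0 H//; apply: aeW => z /KM /le_trans; apply.
  by rewrite v0 mulr0 ltW.
have ev0 : 0 < enorm v by rewrite lt0r v0 enorm_ge0.
have Mv0 : 0 < M * enorm v by rewrite mulr_gt0.
have := @kernel_moment_le R m a t x _ _ q v q1 Mv0 (aeW _ KM) KJ.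
rewrite kernel_momentE// lee_fin => H.
have -> : enorm v = (enorm v `^ q) `^ q^-1.
  by rewrite -powRrM divff ?gt_eqF// powRr1 ?enorm_ge0.
rewrite -powRM ?powR_ge0 ?mulr_ge0 ?powR_ge0 ?(ltW J0)//.
rewrite ge0_ler_powR ?nnegrE ?invr_ge0 ?(ltW q0) ?kernel_moment_ge0 ?mulr_ge0 ?powR_ge0 ?(ltW J0)//.
apply: le_trans H _; rewrite powRM ?enorm_ge0 ?(ltW M0)//.
rewrite le_eqVlt; apply/orP; left; apply/eqP.
have -> : enorm v `^ q = enorm v `^ (q - 1) * enorm v.
  by rewrite -[X in _ * X]powRr1 ?(ltW ev0)// -powRD ?v0 ?implybT// subrK.
ring.
Qed.

Lemma kernel_norm_continuous q : 1 <= q -> continuous (kernel_norm q).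
Proof.
move=> q1; have [L HL] := kernel_norm_le q1.
apply: (@lipschitz_continuous _ _ _ L) => v w; apply: le_trans (HL _).
by rewrite lerBlDr -{1}(subrK w v) kernel_normD.
Qed.

Lemma kernel_norm_max q : 1 <= q ->
  exists2 v, enorm v = 1 & forall w, enorm w = 1 -> kernel_norm q w <= kernel_norm q v.
Proof.
move=> q1.
have [] := @EVT_max_rV R m.+1 (kernel_norm q) [set v | enorm v = 1].
- by exists (delta_mx 0 ord0); exact: enorm_delta.
- exact: enorm_sphere_compact.
- by apply: continuous_subspaceT => v; exact: kernel_norm_continuous.
move=> v /set_mem v1 vmax; exists v => [|w w1]; first exact: v1.
by apply: vmax; apply/mem_set.
Qed.

End kernel_norm.

Section exponent_values.
Context {R : realType}.
Variables (p : \bar R) (q : R).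
Hypothesis pq : conj_pair p q.

Lemma continuous_affine0 (c d : R) : continuous (fun s : R => c * s + d).
Proof. by move=> s; apply: cvgD; [apply: cvgM; [exact: cvg_cst|exact: cvg_id]|exact: cvg_cst]. Qed.

Lemma at_exponent_affine (f : R -> R) c d : (forall r, 1 < r -> f r = c * r^-1 + d) ->
  at_exponent f p = c * (1 - q^-1) + d.
Proof.
move=> fE; apply: (@at_exponent_inv _ _ _ _ (fun s => c * s + d) pq) => //.
exact: continuous_affine0.
Qed.

Lemma at_exponent_powR (f : R -> R) b c d : 0 < b ->
  (forall r, 1 < r -> f r = b `^ (c * r^-1 + d)) ->
  at_exponent f p = b `^ (c * (1 - q^-1) + d).
Proof.
move=> b0 fE; apply: (@at_exponent_inv _ _ _ _ (fun s => b `^ (c * s + d)) pq) => //.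
rewrite (_ : (fun s => _) = expR \o (fun s => (c * ln b) * s + d * ln b)); last first.
  by apply/funext => s /=; rewrite powR_ln//; congr expR; ring.
apply: continuous_comp; [exact: continuous_affine0|exact: continuous_expR].
Qed.

Lemma at_exponent_conj : at_exponent (fun r => r / (r - 1)) p = q.
Proof.
rewrite (@at_exponent_inv _ _ _ _ (fun s => (1 - s)^-1) pq).
- by rewrite opprB addrCA subrr addr0 invrK.
- by move=> r r1; field; rewrite subr_eq0 !gt_eqF// (lt_trans ltr01 r1).
apply: cvgV; first by rewrite subr0 oner_neq0.
by apply: cvgB; [exact: cvg_cst|exact: cvg_id].
Qed.

Lemma at_exponent_weight (n : R) :
  at_exponent (fun r => (n - r + 2) / (r - 1)) p = (n + 1) * (q - 1) - 1.
Proof.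
have q0 : q != 0 by rewrite gt_eqF// (lt_le_trans ltr01 (conj_pair_ge1 pq)).
rewrite (@at_exponent_inv _ _ _ _ (fun s => ((n + 2) * s + - 1) / (1 - s)) pq).
- by field; rewrite q0 opprB addrCA subrr addr0 oner_neq0.
- by move=> r r1; field; rewrite subr_eq0 !gt_eqF// (lt_trans ltr01 r1).
apply: cvgM; first exact: continuous_affine0.
apply: cvgV; first by rewrite subr0 oner_neq0.
by apply: cvgB; [exact: cvg_cst|exact: cvg_id].
Qed.

End exponent_values.

Section sphere_form.
Context {R : realType}.
Variable m : nat.
Hypothesis m0 : (0 < m)%N.
Local Notation n := (m.+1%:R : R).
Variables (a t : R) (x : 'rV[R]_m.+1).
Hypotheses (a0 : 0 < a) (x0 : 0 < x 0 ord_max) (t0 : 0 < t).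
Implicit Types (q : R) (v : 'rV[R]_m.+1) (p : \bar R).

Definition sphere_integral q v : R :=
  \int[surface_measure m.+1]_(s in unit_sphere m.+1)
    sphere_integrand (q * x 0 ord_max ^+ 2 / (4 * a ^+ 2 * t)) ((n + 2) * q / 2 - 2)
      ((n + 1) * (q - 1) - 1) q v s.

Lemma kernel_norm_const q v : 1 <= q ->
  let s := 1 - q^-1 in
  kernel_norm a t x q v =
  2 `^ (3 * s - 1) * a `^ (2 * s) / (pi `^ (n / 2) * q `^ (n / 2 + s))
    / x 0 ord_max `^ ((n + 1) * s) * sphere_integral q v `^ q^-1.
Proof.
move=> q1 s; rewrite -(kernel_const_root m a0 x0 q1).
have q0 : 0 < q by exact: lt_le_trans q1.
have c0 : 0 < q / (4 * a ^+ 2) by rewrite divr_gt0// mulr_gt0// exprn_gt0.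
have := integral_grad_kernel v m0 a0 x0 t0 q1; cbv zeta.
rewrite (kernel_momentE a0 x0 t0 v q1).
set C := (_ / 2)%R.
have C0 : 0 < C by rewrite divr_gt0 ?mulr_gt0 ?powR_gt0// kernel_const_gt0.
have -> : sphere_integral q v = fine (\int[surface_measure m.+1]_(s in unit_sphere m.+1)
     (sphere_integrand (q * x 0 ord_max ^+ 2 / (4 * a ^+ 2 * t)) ((n + 2) * q / 2 - 2)
        ((n + 1) * (q - 1) - 1) q v s)%:E)%E by [].
have : (0 <= \int[surface_measure m.+1]_(s in unit_sphere m.+1)
     (sphere_integrand (q * x 0 ord_max ^+ 2 / (4 * a ^+ 2 * t)) ((n + 2) * q / 2 - 2)
        ((n + 1) * (q - 1) - 1) q v s)%:E)%E.
  by apply: integral_ge0 => w _; rewrite lee_fin; exact: sphere_integrand_ge0.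
set I := (\int[_]_(_ in _) _)%E.
case: I => [I| |//]; last by rewrite gt0_muley ?lte_fin.
rewrite lee_fin -EFinM => I0 [ME]; rewrite [fine _]/=.
by rewrite /kernel_norm ME powRM// ltW.
Qed.

Lemma k_coefE p : conj_pair p (conj_exponent p) ->
  let q := conj_exponent p in let s := 1 - q^-1 in
  k_coef m a p = 2 `^ (3 * s - 1) * a `^ (2 * s) / (pi `^ (n / 2) * q `^ (n / 2 + s)).
Proof.
move=> pq q s; rewrite /k_coef.
rewrite (@at_exponent_powR _ _ _ pq _ 2 3 (- 1))//; last first.
  by move=> r r1; congr powR; rewrite mulrBl divff// gt_eqF// (lt_trans ltr01 r1).
rewrite (@at_exponent_powR _ _ _ pq _ a 2 0)//; last by move=> r r1; rewrite addr0.
rewrite (@at_exponent_affine _ _ _ pq _ 1 0); last by move=> r r1; rewrite mul1r addr0.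
by rewrite mul1r !addr0.
Qed.

Lemma kernel_norm_sphere p v : (1 < p)%E ->
  kernel_norm a t x (conj_exponent p) v =
  k_coef m a p / x 0 ord_max `^ at_exponent (fun r => (n + 1) / r) p
    * sphere_functional a p x t v.
Proof.
move=> p1; have pq := conj_pairP p1; have q1 := conj_pair_ge1 pq.
rewrite (kernel_norm_const v q1) (k_coefE pq) /sphere_functional.
rewrite (at_exponent_conj pq) (at_exponent_weight pq).
rewrite (@at_exponent_affine _ _ _ pq _ (n + 1) 0); last by move=> r r1; rewrite addr0.
rewrite (@at_exponent_affine _ _ _ pq _ (- 1) 1); last first.
  by move=> r r1; rewrite mulrBl divff ?mulN1r ?mul1r 1?addrC// gt_eqF// (lt_trans ltr01 r1).
rewrite addr0 (_ : - 1 * (1 - (conj_exponent p)^-1) + 1 = (conj_exponent p)^-1); last by ring.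
reflexivity.
Qed.

Lemma N_formulaE p v : (1 < p)%E -> enorm v = 1 ->
  (forall w, enorm w = 1 -> kernel_norm a t x (conj_exponent p) w <=
    kernel_norm a t x (conj_exponent p) v) ->
  N_formula a p x t = kernel_norm a t x (conj_exponent p) v.
Proof.
move=> p1 v1 vmax; have pq := conj_pairP p1.
rewrite (kernel_norm_sphere v p1) /N_formula.
have c0 : 0 < k_coef m a p / x 0 ord_max `^ at_exponent (fun r => (n + 1) / r) p.
  rewrite divr_gt0 ?powR_gt0// (k_coefE pq).
  rewrite divr_gt0 ?mulr_gt0 ?powR_gt0 ?pi_gt0//.
  by rewrite (lt_le_trans ltr01)// (conj_pair_ge1 pq).
rewrite (@max_valE _ _ (sphere_functional a p x t v)); first reflexivity.
- by exists v.
move=> _ [w w1 <-]; have := vmax w w1.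
rewrite (kernel_norm_sphere w p1) (kernel_norm_sphere v p1) ler_pM2l; first exact: id.
exact: c0.
Qed.

Lemma sharp_of_max p v : (1 < p)%E -> enorm v = 1 ->
  (forall w, enorm w = 1 -> kernel_norm a t x (conj_exponent p) w <=
    kernel_norm a t x (conj_exponent p) v) ->
  sharp_coefficient a p x t (kernel_norm a t x (conj_exponent p) v).
Proof.
move=> p1 v1 vmax; have pq := conj_pairP p1.
split; first by apply/(gradient_boundP a0 x0 t0 _ pq) => w w1; exact: vmax.
by move=> C' /(gradient_boundP a0 x0 t0 _ pq); apply.
Qed.

Lemma sharp_N_formula p : (1 < p)%E -> sharp_coefficient a p x t (N_formula a p x t).
Proof.
move=> p1; have [v v1 vmax] := kernel_norm_max a0 x0 t0 (conj_pair_ge1 (conj_pairP p1)).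
by rewrite (N_formulaE p1 v1 vmax); exact: sharp_of_max.
Qed.

End sphere_form.

(** * The exponent p = 1 *)

Section superlevel.
Context {R : realType} d (T : measurableType d) (nu : {measure set T -> \bar R}).

Lemma superlevel_null (D : set T) (f : T -> R) c :
  measurable D -> measurable_fun setT f ->
  (forall k, nu (D `&` [set z | c + k.+1%:R^-1 < f z]) = 0%E) ->
  {ae nu, forall z, D z -> f z <= c}.
Proof.
move=> mD mf H.
have mE k : measurable (D `&` [set z | c + k.+1%:R^-1 < f z]).
  rewrite (_ : [set z | _] = f @^-1` `]c + k.+1%:R^-1, +oo[%classic).
    by apply: measurableI => //; rewrite -[X in measurable X]setTI; exact: mf.
  by apply/seteqP; split => z /=; rewrite in_itv/= andbT.
have : nu.-negligible (\bigcup_k (D `&` [set z | c + k.+1%:R^-1 < f z])).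
  apply: negligible_bigcup => k; apply/negligibleP; [exact: mE|exact: H].
apply: negligibleS => z /= /not_implyP[Dz /negP]; rewrite -ltNge => /ltr_add_invr[k ck].
by exists k.
Qed.

End superlevel.

Section endpoint.
Context {R : realType}.
Variable m : nat.
Local Notation RT := (measurableTypeR R).
Local Notation ST := (@spacetime_measure R m).
Variables (a t : R) (x : 'rV[R]_m.+1).
Hypotheses (a0 : 0 < a) (x0 : 0 < x 0 ord_max) (t0 : 0 < t).
Implicit Types (q th : R) (v : 'rV[R]_m.+1).
Local Notation K := (grad_kernel a x t).

Let mS := @measurable_strip R m t.

Definition kernel_superlevel th v : set (m.-tuple RT * RT) :=
  strip t `&` [set z | th < `|K v z|].

Lemma measurable_kernel_superlevel th v : measurable (kernel_superlevel th v).
Proof.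
rewrite /kernel_superlevel.
have mK : measurable_fun setT (fun z => `|K v z|).
  by apply: measurableT_comp => //; exact: measurable_grad_kernel.
rewrite (_ : [set z | _] = (fun z => `|K v z|) @^-1` `]th, +oo[%classic).
  by apply: measurableI => //; rewrite -[X in measurable X]setTI; exact: mK.
by apply/seteqP; split => z /=; rewrite in_itv/= andbT.
Qed.

(* The supremum of these levels is the essential supremum of [|K v z|] over [z] in
   the strip and unit [v]. *)
Definition kernel_levels : set R :=
  [set th | 0 < th /\ exists2 v, enorm v = 1 & (0 < ST (kernel_superlevel th v))%E].

Definition kernel_sup : R := sup kernel_levels.

Lemma kernel_levels_has_sup : has_sup kernel_levels.
Proof.
split; last first.
  have [M [J [M0 _ MJ]]] := kernel_bounds a0 x0 t0.
  exists M => th [th0 [v v1 Epos]]; rewrite leNgt; apply/negP => Mth.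
  move: Epos; rewrite (_ : kernel_superlevel th v = set0) ?measure0 ?ltxx//.
  apply/seteqP; split => // z [Sz /= thK].
  have [/(_ z Sz) KM _] := MJ v; move: KM; rewrite v1 mulr1 leNgt.
  by rewrite (lt_trans Mth).
apply: contrapT => A0.
have H k : ST (strip t `&` [set z | 0 + k.+1%:R^-1 < `|K (delta_mx 0 ord_max) z|]) = 0%E.
  apply/eqP; apply: contrapT => /negP Epos; apply: A0; exists k.+1%:R^-1; split => //.
  exists (delta_mx 0 ord_max); first exact: enorm_delta.
  rewrite lt0e measure_ge0 andbT; move: Epos.
  by rewrite add0r.
have mK : measurable_fun setT (fun z => `|K (delta_mx 0 ord_max) z|).
  by apply: measurableT_comp => //; exact: measurable_grad_kernel.
have [N [mN N0 subN]] := superlevel_null mS mK H.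
have : (ST (strip t) <= ST N)%E.
  apply: le_measure; rewrite ?inE// => z Sz; apply: subN => /(_ Sz).
  by rewrite leNgt normr_gt0 gt_eqF// kernel_normal_gt0.
by rewrite N0 leNgt strip_gt0.
Qed.

Lemma kernel_sup_gt0 : 0 < kernel_sup.
Proof.
have [[th thA] _] := kernel_levels_has_sup; have [th0 _] := thA.
by apply: lt_le_trans th0 _; exact: (sup_upper_bound kernel_levels_has_sup).
Qed.

Lemma kernel_le_sup v : enorm v = 1 -> {ae ST, forall z, strip t z -> `|K v z| <= kernel_sup}.
Proof.
move=> v1; apply: superlevel_null => //.
  by apply: measurableT_comp => //; exact: measurable_grad_kernel.
move=> k; apply/eqP; apply: contrapT => /negP Epos.
have : kernel_sup + k.+1%:R^-1 <= kernel_sup.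
  apply: (sup_upper_bound kernel_levels_has_sup); split.
    by rewrite addr_gt0// kernel_sup_gt0.
  by exists v => //; rewrite lt0e Epos measure_ge0.
by rewrite gerDl leNgt invr_gt0 ltr0n.
Qed.

(* [th * |E| <= int_E |K| < +oo] *)
Lemma kernel_superlevel_fin th v : 0 < th ->
  ST (kernel_superlevel th v) \is a fin_num.
Proof.
move=> th0; have [M [J [_ _ MJ]]] := kernel_bounds a0 x0 t0; have [_ KJ] := MJ v.
have mE := measurable_kernel_superlevel th v.
have mK1 : measurable_fun (strip t) (fun z => (`|K v z|)%:E).
  apply/measurable_EFinP; apply: measurable_funTS; apply: measurableT_comp => //.
  exact: measurable_grad_kernel.
have : (th%:E * ST (kernel_superlevel th v) <= (J * enorm v)%:E)%E.
  apply: le_trans KJ; rewrite -integral_cst//.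
  apply: (@le_trans _ _ (\int[ST]_(z in kernel_superlevel th v) (`|K v z|)%:E)%E).
    apply: ge0_le_integral => //.
    - by move=> z _; rewrite lee_fin ltW.
    - by apply: measurable_funS mK1 => // z [].
    - by move=> z [_ /= /ltW]; rewrite lee_fin.
  by apply: ge0_subset_integral => // z [].
rewrite ge0_fin_numE ?measure_ge0//.
move: (measure_ge0 ST (kernel_superlevel th v)); case: (ST _) => // [r|].
  by move=> _ _; rewrite ltry.
by move=> _; rewrite gt0_muley ?lte_fin.
Qed.

Lemma kernel_superlevel_gt0 th v : 0 < th -> (0 < ST (kernel_superlevel th v))%E ->
  0 < fine (ST (kernel_superlevel th v)).
Proof. by move=> th0 E0; rewrite -lte_fin fineK ?kernel_superlevel_fin. Qed.

Lemma gradient_bound_sup : gradient_bound a 1%E x t kernel_sup.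
Proof.
have S0 := ltW kernel_sup_gt0.
apply: gradient_bound_of => // v g v1 mg gLp.
have mKg : measurable_fun (strip t) (fun z => (`|K v z * g z|)%:E).
  apply/measurable_EFinP; apply: measurable_funTS; apply: measurableT_comp => //.
  by apply: measurable_funM => //; exact: measurable_grad_kernel.
have mg1 : measurable_fun (strip t) (fun z => (`|g z|)%:E).
  by apply/measurable_EFinP; apply: measurable_funTS; exact: measurableT_comp.
rewrite EFin_normr_Rintegral//; last exact: (grad_kernel_integrable v a0 x0 t0 _ gLp).
apply: (le_trans (le_abse_integral _ mS _)).
  by have /integrableP[] := grad_kernel_integrable v a0 x0 t0 (lexx _) gLp.
have -> : 'N[ST]_1[EFin \o (g \_ (strip t))]%E = (\int[ST]_(z in strip t) (`|g z|)%:E)%E.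
  rewrite Lnorm1 [RHS]integral_mkcond; apply: eq_integral => z _.
  by rewrite /= !patchE; case: ifP => _ //=; rewrite normr0.
rewrite -ge0_integralZl//.
apply: ae_ge0_le_integral => //.
- by move=> z _; rewrite mule_ge0.
- exact: measurable_funeM.
apply: filterS (kernel_le_sup v1) => z /= KS Sz.
by rewrite -EFinM lee_fin normrM ler_wpM2r// KS.
Qed.

Lemma gradient_bound_sup_le C : gradient_bound a 1%E x t C -> kernel_sup <= C.
Proof.
move=> HC; apply: sup_le_ub; first by case: kernel_levels_has_sup.
move=> th [th0 [v v1 Epos]].
set E := kernel_superlevel th v in Epos.
have mE : measurable E := measurable_kernel_superlevel th v.
have e0 := kernel_superlevel_gt0 th0 Epos.
have eE : (fine (ST E))%:E = ST E by rewrite fineK// kernel_superlevel_fin.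
set e := fine (ST E) in e0 eE.
have mK := @measurable_grad_kernel R m a x t v.
pose h z : R := Num.sg (K v z) * \1_E z.
have mh0 : measurable_fun setT h.
  by apply: measurable_funM; [exact: measurable_sgr|exact: measurable_indic].
have mh := measurable_patch mS mh0.
have mh1 : measurable_fun (strip t) (fun z => (`|h z| `^ 1)%:E).
  apply/measurable_EFinP; apply: measurable_funTS; apply: (measurableT_comp (measurable_powR 1)).
  exact: measurableT_comp.
have hE : (\int[ST]_(z in strip t) (`|h z| `^ 1)%:E = e%:E)%E.
  rewrite eE -[RHS](_ : ST (E `&` strip t) = _); last by rewrite setIidl// => z [].
  rewrite -integral_indic//; apply: eq_integral => z _; congr EFin.
  rewrite powRr1// normrM normr_sg indicE.
  have [zE|zE] := boolP (z \in E); last by rewrite mulr0n normr0 mulr0.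
  have [_ /= thK] := set_mem zE.
  by rewrite mulr1n normr1 mulr1 (_ : K v z != 0)// -normr_gt0 (lt_trans th0).
have hN : 'N[ST]_1[EFin \o (h \_ (strip t))]%E = e%:E.
  by rewrite (Lnorm_patch ltr01 hE) invr1 powRr1// ltW.
have := @gradient_bound_test R m a t x a0 x0 t0 1%E C v h (lexx _) v1 HC mh.
rewrite hN ltry => /(_ isT); rewrite -EFinM lee_fin => /(le_trans _) H.
rewrite -(ler_pM2r e0); apply: H.
have KhE z : K v z * h z = `|K v z| * \1_E z by rewrite mulrA (mulrC (K v z)) -normrEsg.
have [M [J [_ _ MJ]]] := kernel_bounds a0 x0 t0; have [_ KJ] := MJ v.
have mKE : measurable_fun (strip t) (fun z => (`|K v z| * \1_E z)%:E).
  apply/measurable_EFinP; apply: measurable_funTS; apply: measurable_funM => //.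
  exact: measurableT_comp.
have mK1 : measurable_fun (strip t) (fun z => (`|K v z|)%:E).
  by apply/measurable_EFinP; apply: measurable_funTS; exact: measurableT_comp.
have -> : \int[ST]_(z in strip t) (K v z * h z) =
    \int[ST]_(z in strip t) (`|K v z| * \1_E z).
  by apply: eq_Rintegral => z _; exact: KhE.
have le1 : (\int[ST]_(z in strip t) (`|K v z| * \1_E z)%:E <= (J * enorm v)%:E)%E.
  apply: le_trans KJ; apply: ge0_le_integral => //.
  - by move=> z _; rewrite lee_fin ler_piMr// indicE; case: (_ \in _).
rewrite -lee_fin /Rintegral fineK; last first.
  rewrite ge0_fin_numE ?(le_lt_trans le1) ?ltry//.
  by apply: integral_ge0 => z _; rewrite lee_fin mulr_ge0.
rewrite EFinM -hE -ge0_integralZl ?lee_fin ?(ltW th0)//.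
apply: ge0_le_integral => //.
- by move=> z _; rewrite -EFinM lee_fin mulr_ge0 ?(ltW th0) ?powR_ge0.
- exact: measurable_funeM.
move=> z _; rewrite -EFinM lee_fin powRr1// normrM normr_sg indicE.
have [zE|zE] := boolP (z \in E); last by rewrite mulr0n normr0 !mulr0.
have [_ /= thK] := set_mem zE.
by rewrite mulr1n normr1 !mulr1 (_ : K v z != 0) ?mulr1 ?(ltW thK)// -normr_gt0 (lt_trans th0).
Qed.

Lemma kernel_norm_ge_level q th v : 1 <= q -> 0 < th ->
  th * fine (ST (kernel_superlevel th v)) `^ q^-1 <= kernel_norm a t x q v.
Proof.
move=> q1 th0; have q0 : 0 < q by exact: lt_le_trans q1.
have mE := measurable_kernel_superlevel th v.
have mP : measurable_fun (strip t) (fun z => (`|K v z| `^ q)%:E).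
  by apply/measurable_EFinP; apply: measurable_funTS; exact: measurable_moment.
have : ((th `^ q)%:E * ST (kernel_superlevel th v) <= (kernel_moment a t x q v)%:E)%E.
  rewrite -(kernel_momentE a0 x0 t0 v q1) -integral_cst//.
  apply: (@le_trans _ _ (\int[ST]_(z in kernel_superlevel th v) (`|K v z| `^ q)%:E)%E).
    apply: ge0_le_integral => //.
    - by move=> z _; rewrite lee_fin powR_ge0.
    - by apply: measurable_funS mP => // z [].
    - move=> z [_ /= thK]; rewrite lee_fin ge0_ler_powR ?nnegrE ?(ltW q0) ?(ltW th0)//.
      exact: ltW.
  by apply: ge0_subset_integral => // z [].
rewrite -[ST _]fineK ?kernel_superlevel_fin// -EFinM lee_fin => H.
rewrite -[X in X * _](powRr1 (ltW th0)) -(divff (_ : q != 0)) ?gt_eqF// powRrM.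
rewrite -powRM ?powR_ge0//.
by rewrite ge0_ler_powR ?nnegrE ?invr_ge0 ?(ltW q0) ?kernel_moment_ge0 ?mulr_ge0 ?powR_ge0.
Qed.

Lemma kernel_norm_le_sup q J v : 1 <= q -> enorm v = 1 -> 0 <= J ->
  (\int[ST]_(z in strip t) (`|K v z|)%:E <= J%:E)%E ->
  kernel_norm a t x q v <= kernel_sup `^ (1 - q^-1) * J `^ q^-1.
Proof.
move=> q1 v1 J0 KJ; have q0 : 0 < q by exact: lt_le_trans q1.
have := kernel_moment_le q1 kernel_sup_gt0 (kernel_le_sup v1) KJ.
rewrite (kernel_momentE a0 x0 t0 v q1) lee_fin => H.
have -> : 1 - q^-1 = (q - 1) * q^-1 by field; rewrite gt_eqF.
rewrite powRrM -powRM ?powR_ge0//.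
by rewrite ge0_ler_powR ?nnegrE ?invr_ge0 ?(ltW q0) ?kernel_moment_ge0 ?mulr_ge0 ?powR_ge0.
Qed.

Lemma continuous_conj_powR (b c d : R) : 0 < b ->
  (b `^ (c * ((r - 1) / r) + d)) @[r --> (1 : R)^'+] --> b `^ d.
Proof.
move=> b0; apply: cvg_at_right_filter.
rewrite (_ : (fun r => _) = fun r => expR ((c * ((r - 1) / r) + d) * ln b)); last first.
  by apply/funext => r; rewrite powR_ln.
rewrite powR_ln// -{2}[d]add0r -[X in (X + d)](mulr0 c) -[X in c * X](mul0r 1^-1) -[X in X / 1](subrr 1).
apply: continuous_cvg; first exact: continuous_expR.
apply: cvgM; last exact: cvg_cst.
apply: cvgD; last exact: cvg_cst.
apply: cvgM; first exact: cvg_cst.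
apply: cvgM; first by apply: cvgB; [exact: cvg_id|exact: cvg_cst].
by apply: cvgV => //; exact: oner_neq0.
Qed.

(* If [e] is the measure of the superlevel set at [th], then
   [th * e `^ q^-1 <= N <= S `^ (1 - q^-1) * J `^ q^-1] with [q^-1 = (r - 1) / r --> 0]. *)
Lemma N_formula_cvg_sup : (0 < m)%N ->
  N_formula a r%:E x t @[r --> (1 : R)^'+] --> kernel_sup.
Proof.
move=> m0.
have squeeze (S N B e th : R) : N <= S + e -> B <= N -> th - e / 2 <= B ->
    S - e / 2 < th -> `|S - N| <= e.
  by move=> *; rewrite ler_norml; apply/andP; split; lra.
have [M [J [_ J0 MJ]]] := kernel_bounds a0 x0 t0.
have S0 := kernel_sup_gt0.
have norm r : 1 < r -> exists2 v, enorm v = 1 &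
    N_formula a r%:E x t = kernel_norm a t x (r / (r - 1)) v /\
    forall w, enorm w = 1 -> kernel_norm a t x (r / (r - 1)) w <= N_formula a r%:E x t.
  move=> r1; have r1' : (1 < r%:E)%E by rewrite lte_fin.
  have [v v1 vmax] := kernel_norm_max a0 x0 t0 (conj_pair_ge1 (conj_pairP r1')).
  have := N_formulaE m0 a0 x0 t0 r1' v1 vmax.
  by rewrite conj_exponentE// in vmax * => ->; exists v.
have q1 (r : R) : 1 < r -> 1 <= r / (r - 1).
  by move=> r1; rewrite ler_pdivlMr ?subr_gt0// mul1r lerBlDr lerDl.
apply/cvgrPdist_le => e e0.
have e20 : 0 < e / 2 by rewrite divr_gt0.
have [th [th0 [v v1 Epos]] thS] := sup_adherent e20 kernel_levels_has_sup.
have c0 := kernel_superlevel_gt0 th0 Epos.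
set c := fine _ in c0.
have lo := @continuous_conj_powR _ 1 0 c0.
have hiS := @continuous_conj_powR _ (- 1) 1 S0.
have hiJ := @continuous_conj_powR _ 1 0 J0.
have lo' : (th * c `^ (1 * ((r - 1) / r) + 0)) @[r --> (1 : R)^'+] --> th.
  suff : (th * c `^ (1 * ((r - 1) / r) + 0)) @[r --> (1 : R)^'+] --> th * c `^ 0.
    by rewrite powRr0 mulr1.
  by apply: cvgM; [exact: cvg_cst|exact: lo].
have hi' : (kernel_sup `^ (- 1 * ((r - 1) / r) + 1) * J `^ (1 * ((r - 1) / r) + 0))
    @[r --> (1 : R)^'+] --> kernel_sup.
  suff : (kernel_sup `^ (- 1 * ((r - 1) / r) + 1) * J `^ (1 * ((r - 1) / r) + 0))
    @[r --> (1 : R)^'+] --> kernel_sup `^ 1 * J `^ 0.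
    by rewrite powRr0 mulr1 powRr1// ltW.
  by apply: cvgM; [exact: hiS|exact: hiJ].
near=> r.
have r1 : 1 < r by near: r; exact: nbhs_right_gt.
have [w w1 [NE Nmax]] := norm r r1.
have H1 : kernel_norm a t x (r / (r - 1)) w <= kernel_sup + e.
  have := MJ w; rewrite w1 !mulr1 => -[_ KJ].
  apply: le_trans (kernel_norm_le_sup (q1 r r1) w1 (ltW J0) KJ) _.
  rewrite invf_div.
  have : `|kernel_sup - kernel_sup `^ (- 1 * ((r - 1) / r) + 1) * J `^ (1 * ((r - 1) / r) + 0)| <= e.
    by near: r; move/cvgrPdist_le : hi'; exact.
  rewrite addr0 mul1r mulN1r [X in kernel_sup `^ X]addrC.
  by move: (_ * _) => Y; rewrite ler_norml => /andP[+ _]; lra.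
have H2 : th - e / 2 <= kernel_norm a t x (r / (r - 1)) v.
  apply: le_trans (kernel_norm_ge_level v (q1 r r1) th0).
  rewrite invf_div -/c.
  have : `|th - th * c `^ (1 * ((r - 1) / r) + 0)| <= e / 2.
    by near: r; move/cvgrPdist_le : lo'; exact.
  rewrite addr0 mul1r; move: (_ * _) => Y; rewrite ler_norml => /andP[_]; lra.
by rewrite -NE in H1; exact: (squeeze _ _ _ _ _ H1 (Nmax v v1) H2 thS).
Unshelve. all: by end_near. Qed.

Lemma sharp_endpoint : (0 < m)%N -> exists2 N,
  N_formula a r%:E x t @[r --> (1 : R)^'+] --> N & sharp_coefficient a 1%E x t N.
Proof.
move=> m0; exists kernel_sup; first exact: N_formula_cvg_sup.
by split; [exact: gradient_bound_sup|exact: gradient_bound_sup_le].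
Qed.

End endpoint.

(** * The maximum at e_n *)

Section sphere_symmetry.
Context {R : realType}.
Variable m : nat.
Local Notation RT := (measurableTypeR R).
Local Notation L := (lebesgue_tuple R m.+1).
Local Notation sphere_int F :=
  (\int[surface_measure m.+1]_(s in unit_sphere m.+1) (F s)%:E)%E.
Implicit Types (F : m.+1.-tuple RT -> R) (s : m.+1.-tuple RT) (z : 'rV[R]_m.+1).

Definition sphere_sym (T : m.+1.-tuple RT -> m.+1.-tuple RT) :=
  forall F, measurable_fun setT F -> (forall s, 0 <= F s) ->
    sphere_int (fun s => F (T s)) = sphere_int F.

Lemma sphere_symI (T : m.+1.-tuple RT -> m.+1.-tuple RT) :
  measurable_fun setT T ->
  (forall f : m.+1.-tuple RT -> \bar R, measurable_fun setT f -> (forall s, 0 <= f s)%E ->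
     (\int[L]_s f (T s) = \int[L]_s f s)%E) ->
  (forall s, enorm (to_rV (T s)) = enorm (to_rV s)) ->
  (forall s, normalize (T s) = T (normalize s)) -> sphere_sym T.
Proof.
move=> mT TL Te Tn F mF F0.
rewrite (integral_sphere (measurableT_comp mF mT) (fun s => F0 (T s))) (integral_sphere mF F0).
suff -> : (\int[L]_(v in unit_ball m.+1) (F (T (normalize v)))%:E =
    \int[L]_(v in unit_ball m.+1) (F (normalize v))%:E)%E by [].
rewrite [LHS]integral_mkcond [RHS]integral_mkcond.
have mB : measurable (unit_ball m.+1 : set (m.+1.-tuple RT)) := @measurable_unit_ball R m.+1.
have mG : measurable_fun setT ((fun v => (F (normalize v))%:E) \_ (unit_ball m.+1)).
  apply/(measurable_restrictT _ mB).
  apply: measurable_funTS.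
  by apply/measurable_EFinP; apply: (measurableT_comp mF); exact: measurable_normalize.
have G0 v : (0 <= ((fun v => (F (normalize v))%:E) \_ (unit_ball m.+1)) v)%E.
  by rewrite patchE; case: ifP => _ //; rewrite lee_fin.
rewrite -(TL _ mG G0); apply: eq_integral => v _; rewrite !patchE Tn.
have -> : (T v \in unit_ball m.+1) = (v \in unit_ball m.+1); last by [].
by apply/idP/idP => /set_mem h; apply/mem_set; move: h; rewrite /unit_ball/= Te.
Qed.

Definition flip (i : 'I_m.+1) : m.+1.-tuple RT -> m.+1.-tuple RT :=
  affine (fun j => if j == i then -1 else 1) (fun=> 0).

Lemma tnth_flip i s j : tnth (flip i s) j = (if j == i then -1 else 1) * tnth s j.
Proof. by rewrite tnth_mktuple addr0. Qed.

Lemma sphere_sym_flip i : sphere_sym (flip i).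
Proof.
apply: sphere_symI.
- exact: measurable_affine_tuple.
- move=> f mf f0; rewrite -(integral_affine (c := fun j => if j == i then -1 else 1) (fun=> 0) _ mf f0).
    rewrite big1 ?mul1e// => j _; by case: ifP; rewrite ?normrN normr1.
  by move=> j; case: ifP; rewrite ?oppr_eq0 oner_neq0.
- move=> s; rewrite /enorm; congr Num.sqrt; apply: eq_bigr => j _.
  by rewrite !mxE tnth_flip; case: ifP => _; rewrite ?mul1r// mulN1r mulrNN.
- move=> s; apply: eq_from_tnth => j.
  have Te : enorm (to_rV (flip i s)) = enorm (to_rV s).
    rewrite /enorm; congr Num.sqrt; apply: eq_bigr => k _.
    by rewrite !mxE tnth_flip; case: ifP => _; rewrite ?mul1r// mulN1r mulrNN.
  by rewrite [LHS]tnth_mktuple Te !tnth_flip tnth_mktuple mulrA.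
Qed.

Lemma sphere_sym_permute (p : {perm 'I_m.+1}) : sphere_sym (permute p).
Proof.
have Te s : enorm (to_rV (permute p s)) = enorm (to_rV s).
  rewrite /enorm; congr Num.sqrt; rewrite /dotp [RHS](reindex_inj (@perm_inj _ p)) /=.
  by apply: eq_bigr => j _; rewrite !mxE tnth_mktuple.
apply: sphere_symI => //.
- exact: measurable_permute.
- by move=> f mf f0; exact: integral_permute.
- by move=> s; apply: eq_from_tnth => j; rewrite !tnth_mktuple Te.
Qed.

Lemma integral_sphere_avg F T : measurable_fun setT T -> sphere_sym T ->
  measurable_fun setT F -> (forall s, 0 <= F s) ->
  sphere_int F = sphere_int (fun s => (F s + F (T s)) / 2).
Proof.
move=> mT sT mF F0.
have mh (G : m.+1.-tuple RT -> R) : measurable_fun setT G -> measurable_fun setT (fun s : m.+1.-tuple RT => G s / 2 : R).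
  by move=> mG; apply: measurable_funM.
have G0 s : 0 <= F s / 2 by rewrite mulr_ge0.
have mE (G : m.+1.-tuple RT -> R) : measurable_fun setT G ->
    measurable_fun (unit_sphere m.+1) (fun s : m.+1.-tuple RT => (G s : R)%:E).
  by move=> mG; apply/measurable_EFinP; exact: measurable_funTS.
have D (G H : m.+1.-tuple RT -> R) : measurable_fun setT G -> measurable_fun setT H ->
    (forall s, 0 <= G s) -> (forall s, 0 <= H s) ->
    sphere_int (fun s => G s + H s) = (sphere_int G + sphere_int H)%E.
  move=> mG mH GG HH; rewrite -ge0_integralD.
  - by apply: eq_integral => s _.
  - exact: measurable_unit_sphere.
  - by move=> s _; rewrite lee_fin.
  - exact: mE.
  - by move=> s _; rewrite lee_fin.
  - exact: mE.
have E1 : sphere_int F = sphere_int (fun s => F s / 2 + F s / 2).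
  by apply: eq_integral => s _; congr EFin; rewrite [LHS]splitr.
have E2 : sphere_int (fun s => (F s + F (T s)) / 2) = sphere_int (fun s => F s / 2 + F (T s) / 2).
  by apply: eq_integral => s _; congr EFin; rewrite mulrDl.
have mFT := measurableT_comp mF mT.
rewrite E1 E2 (D _ _ (mh _ mF) (mh _ mF) G0 G0) (D _ _ (mh _ mF) (mh _ mFT) G0 (fun s => G0 (T s))).
by rewrite (sT _ (mh _ mF) G0).
Qed.

End sphere_symmetry.

Section sphere_quadratic.
Context {R : realType}.
Variable m : nat.
Local Notation RT := (measurableTypeR R).
Local Notation sphere_int F :=
  (\int[surface_measure m.+1]_(s in unit_sphere m.+1) (F s)%:E)%E.
Variable W : R -> R.
Hypotheses (mW : measurable_fun setT W) (W0 : forall u, 0 <= W u)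
  (Wmono : forall u v, `|u| <= `|v| -> W u <= W v).
Implicit Types (s : m.+1.-tuple RT) (z : 'rV[R]_m.+1).

Let Q z := sphere_int (fun s => W (tnth s ord_max) * dotp (to_rV s) z ^+ 2).

Let mcoord (i : 'I_m.+1) : measurable_fun setT (fun s : m.+1.-tuple RT => W (tnth s i)).
Proof. by apply: (measurableT_comp mW); exact: measurable_tnth. Qed.

Let mQ (i : 'I_m.+1) z :
  measurable_fun setT (fun s : m.+1.-tuple RT => W (tnth s i) * dotp (to_rV s) z ^+ 2).
Proof.
by apply: measurable_funM; [exact: mcoord|apply: measurable_funX; exact: measurable_dotp].
Qed.

Let Q0 (i : 'I_m.+1) z s : 0 <= W (tnth s i) * dotp (to_rV s) z ^+ 2.
Proof. by rewrite mulr_ge0// sqr_ge0. Qed.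

Let mT (i : 'I_m.+1) : measurable_fun setT (@flip R m i).
Proof. exact: measurable_affine_tuple. Qed.

Let dotp_to_rV_delta s i : dotp (to_rV s) (delta_mx 0 i) = tnth s i.
Proof. by rewrite dotp_delta mxE. Qed.

(* Averaging over the reflection of the [i]-th coordinate removes the cross terms. *)
Lemma quadratic_split (i : 'I_m.+1) z :
  Q z = (Q (z - z 0 i *: delta_mx 0 i)%R + ((z 0 i)%R ^+ 2)%:E * Q (delta_mx 0 i)%R)%E.
Proof.
rewrite /Q (integral_sphere_avg (mT i) (@sphere_sym_flip R m i) (mQ _ _) (Q0 _ _)).
rewrite -ge0_integralZl; last first.
- by rewrite lee_fin sqr_ge0.
- by move=> s _; rewrite lee_fin Q0.
- by apply/measurable_EFinP; apply: measurable_funTS; exact: mQ.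
- exact: measurable_unit_sphere.
rewrite -ge0_integralD; last first.
- by apply: measurable_funeM; apply/measurable_EFinP; apply: measurable_funTS; exact: mQ.
- by move=> s _; rewrite mule_ge0 ?lee_fin ?sqr_ge0 ?Q0.
- by apply/measurable_EFinP; apply: measurable_funTS; exact: mQ.
- by move=> s _; rewrite lee_fin Q0.
- exact: measurable_unit_sphere.
apply: eq_integral => s _; rewrite -EFinM -EFinD; congr EFin.
have -> : W (tnth (flip i s) ord_max) = W (tnth s ord_max).
  have e : `|tnth (flip i s) ord_max| = `|tnth s ord_max|.
    by rewrite tnth_flip; case: ifP => _; rewrite ?mul1r// mulN1r normrN.
  by apply/eqP; rewrite eq_le !Wmono ?e.
have -> : dotp (to_rV (flip i s)) z =
    dotp (to_rV s) (z - z 0 i *: delta_mx 0 i) - z 0 i * tnth s i.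
  rewrite dotpDr -scaleNr dotpZr dotp_to_rV_delta mulNr -addrA -opprD.
  rewrite /dotp (bigD1 i)//= [in RHS](bigD1 i)//= !mxE tnth_flip eqxx.
  rewrite (eq_bigr (fun j => to_rV s 0 j * z 0 j)); last first.
    by move=> j ji; rewrite !mxE tnth_flip (negbTE ji) mul1r.
  ring.
have -> : dotp (to_rV s) z = dotp (to_rV s) (z - z 0 i *: delta_mx 0 i) + z 0 i * tnth s i.
  by rewrite dotpDr -scaleNr dotpZr dotp_to_rV_delta mulNr subrK.
by rewrite dotp_to_rV_delta; field.
Qed.

(* Averaging over the exchange of the coordinates [i] and [n] leaves
   [(W s_n - W s_i) * (s_n ^+ 2 - s_i ^+ 2) >= 0]. *)
Lemma quadratic_coord_le (i : 'I_m.+1) :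
  (Q (delta_mx 0 i)%R <= Q (delta_mx 0 ord_max)%R)%E.
Proof.
pose p := tperm i (@ord_max m).
rewrite /Q (integral_sphere_avg (measurable_permute p) (@sphere_sym_permute R m p) (mQ _ _) (Q0 _ _)).
rewrite [leRHS](integral_sphere_avg (measurable_permute p) (@sphere_sym_permute R m p) (mQ _ _) (Q0 _ _)).
have mA z : measurable_fun (unit_sphere m.+1) (fun s : m.+1.-tuple RT =>
    ((W (tnth s ord_max) * dotp (to_rV s) z ^+ 2 +
      W (tnth (permute p s) ord_max) * dotp (to_rV (permute p s)) z ^+ 2) / 2)%:E).
  apply/measurable_EFinP; apply: measurable_funTS; apply: measurable_funM => //.
  apply: measurable_funD; first exact: mQ.
  exact: (measurableT_comp (mQ _ _) (measurable_permute p)).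
have A0 z s : (unit_sphere m.+1) s -> (0 <= ((W (tnth s ord_max) * dotp (to_rV s) z ^+ 2 +
      W (tnth (permute p s) ord_max) * dotp (to_rV (permute p s)) z ^+ 2) / 2)%:E)%E.
  by move=> _; rewrite lee_fin mulr_ge0// addr_ge0.
apply: ge0_le_integral.
- exact: measurable_unit_sphere.
- exact: A0.
- exact: mA.
- exact: mA.
move=> s _; rewrite lee_fin !dotp_to_rV_delta !tnth_mktuple tpermL tpermR ler_wpM2r//.
rewrite -subr_ge0.
have -> : W (tnth s ord_max) * tnth s ord_max ^+ 2 + W (tnth s i) * tnth s i ^+ 2 -
   (W (tnth s ord_max) * tnth s i ^+ 2 + W (tnth s i) * tnth s ord_max ^+ 2) =
   (W (tnth s ord_max) - W (tnth s i)) * (tnth s ord_max ^+ 2 - tnth s i ^+ 2) by ring.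
have [h|h] := leP `|tnth s i| `|tnth s ord_max|.
  rewrite mulr_ge0// subr_ge0 ?Wmono//.
  by rewrite -[tnth s i ^+ 2]real_normK ?num_real// -[leRHS]real_normK ?num_real// lerXn2r ?nnegrE.
rewrite mulr_le0// subr_le0 ?Wmono ?(ltW h)//.
by rewrite -[leLHS]real_normK ?num_real// -[leRHS]real_normK ?num_real// lerXn2r ?nnegrE ?(ltW h).
Qed.

Lemma quadratic_le z : (Q z <= (dotp z z)%:E * Q (delta_mx 0 ord_max)%R)%E.
Proof.
have Qn0 : (0 <= Q (delta_mx 0 ord_max)%R)%E.
  by apply: integral_ge0 => s _; rewrite lee_fin Q0.
suff : forall (r : seq 'I_m.+1) (w : 'rV[R]_m.+1), (forall i, i \notin r -> w 0 i = 0) ->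
    (Q w <= (dotp w w)%:E * Q (delta_mx 0 ord_max)%R)%E.
  by move=> /(_ (enum 'I_m.+1) z); apply=> i; rewrite mem_enum.
elim=> [|i r IH] w wr.
  have -> : w = 0 by apply/rowP => i; rewrite wr// mxE.
  rewrite /Q (eq_integral (cst 0%E)) ?integral0 ?mule_ge0 ?lee_fin ?dotp_ge0// => s _.
  by rewrite /dotp big1 ?expr2 ?mulr0 ?mulr0 // => j _; rewrite [X in _ * X]mxE mulr0.
set w' := w - w 0 i *: delta_mx 0 i.
have w'E : dotp w w = dotp w' w' + w 0 i ^+ 2.
  rewrite /dotp (bigD1 i)//= [in RHS](bigD1 i)//= !mxE !eqxx mulr1 subrr mulr0 add0r.
  rewrite addrC expr2; congr (_ + _); apply: eq_bigr => j ji.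
  by rewrite !mxE (negbTE ji) andbF mulr0 subr0.
rewrite (quadratic_split i) w'E EFinD ge0_muleDl ?lee_fin ?dotp_ge0 ?sqr_ge0//.
apply: leeD.
  apply: IH => j jr; rewrite !mxE eqxx /=; have [->|ji] := eqVneq j i.
    by rewrite mulr1 subrr.
  by rewrite mulr0 subr0 wr// in_cons negb_or ji.
by rewrite lee_wpmul2l ?lee_fin ?sqr_ge0 ?quadratic_coord_le.
Qed.

End sphere_quadratic.

Section normal_max.
Context {R : realType}.
Variable m : nat.
Local Notation RT := (measurableTypeR R).
Local Notation n := (m.+1%:R : R).
Implicit Types (q : R) (s : m.+1.-tuple RT) (z : 'rV[R]_m.+1).
Local Notation e_n := (delta_mx 0 ord_max : 'rV[R]_m.+1).

Lemma powR_bernoulli (th y : R) : 0 < th <= 1 -> 0 <= y -> y `^ th <= th * y + (1 - th).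
Proof.
move=> /andP[th0 th1] y0; have [->|thn1] := eqVneq th 1.
  by rewrite powRr1// subrr addr0 mul1r.
have th1' : 0 < 1 - th by rewrite subr_gt0 lt_neqAle thn1.
have := @conjugate_powR R (y `^ th) 1 th^-1 (1 - th)^-1 (powR_ge0 _ _) ler01.
rewrite !invr_gt0 !invrK th0 th1' => /(_ isT isT); rewrite addrCA subrr addr0 => /(_ erefl).
by rewrite mulr1 -powRrM divff ?gt_eqF// powRr1// powR1 mul1r mulrC.
Qed.

Variables (kap lam q : R).
Hypotheses (kap0 : 0 <= kap) (lam0 : 0 <= lam) (q12 : 0 < q <= 2).
Hypothesis qn : 2 <= (n + 2) * (q - 1).
Local Notation bet := ((n + 1) * (q - 1) - 1).
Local Notation SI z := (sphere_integrand kap lam bet q z).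

Let W (u : R) : R := omega kap lam u * `|u| `^ (bet + q - 2).

Let gam0 : 0 <= bet + q - 2.
Proof. by move: qn; lra. Qed.

Let W0 u : 0 <= W u.
Proof. by rewrite mulr_ge0 ?omega_ge0 ?powR_ge0. Qed.

Let Wmono u v : `|u| <= `|v| -> W u <= W v.
Proof.
move=> uv; have [u0|u0] := eqVneq u 0.
  by rewrite {1}/W {1}/omega u0 eqxx mul0r.
have v0 : v != 0.
  by rewrite -normr_gt0 (lt_le_trans _ uv)// normr_gt0.
rewrite /W ler_pM ?omega_ge0 ?powR_ge0//; last by rewrite ge0_ler_powR ?nnegrE.
have sq : u ^+ 2 <= v ^+ 2.
  by rewrite -[leLHS]real_normK ?num_real// -[leRHS]real_normK ?num_real// lerXn2r ?nnegrE.
have u20 : 0 < u ^+ 2 by rewrite lt0r sqrf_eq0 u0 sqr_ge0.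
rewrite /omega (negbTE u0) (negbTE v0); apply: upper_gamma_anti => //.
  by rewrite divr_ge0// sqr_ge0.
by rewrite ler_wpM2l// lef_pV2 ?posrE// (lt_le_trans u20).
Qed.

Let mW : measurable_fun setT W.
Proof.
apply: measurable_funM; first exact: measurable_omega.
exact: (measurableT_comp (measurable_powR _) (@normr_measurable R setT)).
Qed.

Lemma sphere_integrand_normalE s :
  SI e_n s = W (tnth s ord_max) * dotp (to_rV s) e_n ^+ 2.
Proof.
rewrite /sphere_integrand /W dotp_delta mxE; set u := tnth s ord_max.
have [u0|u0] := eqVneq u 0; first by rewrite /omega u0 eqxx !mul0r.
rewrite -!mulrA -real_normK ?num_real//; congr (_ * _).
rewrite -powR_mulrn// -!powRD ?normr_eq0 ?u0 ?implybT//; congr powR.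
by rewrite [RHS]subrK.
Qed.

(* Young's inequality; the excess weight [|s_n| `^ (bet + q - 2)] is put into [W]. *)
Lemma sphere_integrand_le z s : SI z s <=
  q / 2 * (W (tnth s ord_max) * dotp (to_rV s) z ^+ 2)
  + (1 - q / 2) * (W (tnth s ord_max) * dotp (to_rV s) e_n ^+ 2).
Proof.
have [q0 q2] := andP q12.
rewrite /sphere_integrand /W dotp_delta mxE; set u := tnth s ord_max.
have [u0|u0] := eqVneq u 0; first by rewrite /omega u0 eqxx !(mul0r, mulr0) addr0.
set w := dotp _ z.
have yw : `|w| `^ q = `|u| `^ q * ((w / u) ^+ 2) `^ (q / 2).
  rewrite -[_ ^+ 2]real_normK ?num_real// -powR_mulrn// -powRrM.
  rewrite (_ : 2%:R * (q / 2) = q); last by field.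
  by rewrite -powRM// -normrM mulrC divfK.
rewrite yw.
have := @powR_bernoulli (q / 2) ((w / u) ^+ 2) _ (sqr_ge0 _).
rewrite divr_gt0//= ler_pdivrMr// mul1r q2 => /(_ isT) B.
have uu : `|u| `^ bet * `|u| `^ q = `|u| `^ (bet + q - 2) * u ^+ 2.
  rewrite -real_normK ?num_real// -powR_mulrn// -!powRD ?normr_eq0 ?u0 ?implybT//.
  by rewrite [in RHS]subrK.
have -> : q / 2 * (omega kap lam u * `|u| `^ (bet + q - 2) * w ^+ 2) +
    (1 - q / 2) * (omega kap lam u * `|u| `^ (bet + q - 2) * u ^+ 2) =
    omega kap lam u * (`|u| `^ bet * `|u| `^ q) * (q / 2 * (w / u) ^+ 2 + (1 - q / 2)).
  by rewrite uu; field.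
rewrite mulrA -(mulrA (omega _ _ _)).
by rewrite ler_wpM2l ?mulr_ge0 ?omega_ge0 ?powR_ge0// (le_trans B).
Qed.

Lemma sphere_normal_max z : enorm z = 1 ->
  (\int[surface_measure m.+1]_(s in unit_sphere m.+1) (SI z s)%:E <=
   \int[surface_measure m.+1]_(s in unit_sphere m.+1) (SI e_n s)%:E)%E.
Proof.
move=> z1; have [q0 q2] := andP q12.
have mS := @measurable_unit_sphere R m.+1.
pose A (z : 'rV[R]_m.+1) (s : m.+1.-tuple RT) := W (tnth s ord_max) * dotp (to_rV s) z ^+ 2.
have mA w : measurable_fun (unit_sphere m.+1) (fun s => (A w s)%:E).
  apply/measurable_EFinP; apply: measurable_funTS; apply: measurable_funM.
    by apply: (measurableT_comp mW); exact: measurable_tnth.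
  by apply: measurable_funX; exact: measurable_dotp.
have A0 w s : (0 <= (A w s)%:E)%E by rewrite lee_fin mulr_ge0// sqr_ge0.
have q20 : (0 <= (q / 2)%:E)%E by rewrite lee_fin divr_ge0// ltW.
have q21 : (0 <= (1 - q / 2)%:E)%E by rewrite lee_fin subr_ge0 ler_pdivrMr// mul1r.
have Qle := quadratic_le mW W0 Wmono z.
have zz : dotp z z = 1 by rewrite -enorm_sqr z1 expr1n.
rewrite zz mul1e in Qle.
rewrite [leRHS](_ : _ = (\int[surface_measure m.+1]_(s in unit_sphere m.+1) (A e_n s)%:E)%E);
  last by apply: eq_integral => s _; rewrite sphere_integrand_normalE.
apply: (@le_trans _ _ (\int[surface_measure m.+1]_(s in unit_sphere m.+1)
    ((q / 2)%:E * (A z s)%:E + (1 - q / 2)%:E * (A e_n s)%:E))%E).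
  apply: ge0_le_integral.
  - exact: mS.
  - by move=> s _; rewrite lee_fin sphere_integrand_ge0.
  - apply/measurable_EFinP; apply: measurable_funTS; exact: measurable_sphere_integrand.
  - by apply: emeasurable_funD; apply: measurable_funeM; exact: mA.
  - by move=> s _; rewrite -!EFinM -EFinD lee_fin sphere_integrand_le.
rewrite ge0_integralD; last first.
- by apply: measurable_funeM; exact: mA.
- by move=> s _; rewrite mule_ge0 ?A0.
- by apply: measurable_funeM; exact: mA.
- by move=> s _; rewrite mule_ge0 ?A0.
- exact: mS.
rewrite (ge0_integralZl (surface_measure m.+1) mS (mA z) (fun s _ => A0 z s) q20).
rewrite (ge0_integralZl (surface_measure m.+1) mS (mA e_n) (fun s _ => A0 e_n s) q21).
apply: (@le_trans _ _ ((q / 2)%:E * \int[surface_measure m.+1]_(s in unit_sphere m.+1) (A e_n s)%:E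
   + (1 - q / 2)%:E * \int[surface_measure m.+1]_(s in unit_sphere m.+1) (A e_n s)%:E)%E).
  by apply: leeD2r; rewrite lee_wpmul2l.
rewrite -ge0_muleDl// -EFinD addrCA subrr addr0 mul1e.
exact: lexx.
Qed.

End normal_max.

Section normal_integral.
Context {R : realType}.
Local Notation RT := (measurableTypeR R).
Local Notation mu := (@lebesgue_measure R).
Variables (k : nat) (kap lam bet q : R).
Hypotheses (kap0 : 0 < kap) (lam0 : 0 <= lam).
Local Notation e_n := (delta_mx 0 ord_max : 'rV[R]_k.+2).

Let h (r : R) : R :=
  2 * (upper_gamma lam (kap * (r ^+ 2 + 1)) * (r ^+ 2 + 1) `^ (- ((bet + q + k.+2%:R) / 2))).

Let h0 r : 0 <= h r.
Proof. by rewrite /h !mulr_ge0 ?upper_gamma_ge0 ?powR_ge0. Qed.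

Let mh : measurable_fun setT h.
Proof.
have ms : measurable_fun setT (fun r : R => r ^+ 2 + 1).
  by apply: measurable_funD => //; exact: measurable_funX.
rewrite (_ : h = fun r => 2 * (upper_gamma lam (Num.max (kap * (r ^+ 2 + 1)) 0) *
    (r ^+ 2 + 1) `^ (- ((bet + q + k.+2%:R) / 2)))); last first.
  by apply/funext => r; rewrite max_l// mulr_ge0 ?(ltW kap0)// addr_ge0 ?sqr_ge0.
apply: measurable_funM => //; apply: measurable_funM.
  apply: (measurableT_comp (measurable_upper_gamma lam0)).
  exact: measurable_funM.
exact: (measurableT_comp (measurable_powR _) ms).
Qed.

Let continuous_h r : {for r, continuous h}.
Proof.
have s0 : 0 < r ^+ 2 + 1 by rewrite ltr_wpDl// sqr_ge0.
have cs : {for r, continuous (fun r : R => r ^+ 2 + 1)}.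
  by apply: cvgD; [exact: exprn_continuous|exact: cvg_cst].
apply: cvgM; first exact: cvg_cst.
apply: cvgM.
  apply: (@continuous_comp _ _ _ (fun r : R => kap * (r ^+ 2 + 1)) (upper_gamma lam)).
    by apply: cvgM; [exact: cvg_cst|exact: cs].
  by apply: continuous_upper_gamma => //; rewrite mulr_gt0.
rewrite (_ : (fun r => _) = fun r : R =>
    expR (- ((bet + q + k.+2%:R) / 2) * ln (r ^+ 2 + 1))); last first.
  by apply/funext => y; rewrite powR_ln// ltr_wpDl// sqr_ge0.
rewrite powR_ln//; apply: continuous_cvg; first exact: continuous_expR.
apply: cvgM; first exact: cvg_cst.
by apply: (@continuous_comp _ _ _ (fun r : R => r ^+ 2 + 1) (@ln R)); [exact: cs|exact: continuous_ln].
Qed.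

Lemma sphere_normal_integral :
  (\int[surface_measure k.+2]_(s in unit_sphere k.+2)
     (sphere_integrand kap lam bet q e_n s)%:E =
   (sphere_area k.+1)%:E * \int[mu]_(theta in `]0%R, (pi / 2)%R[)
     (2 * (upper_gamma lam (kap / cos theta ^+ 2) * cos theta `^ (bet + q)
       * sin theta ^+ k))%:E)%E.
Proof.
rewrite integral_gnomonic; last 3 first.
- by apply: measurable_sphere_integrand => //; exact: ltW.
- by move=> s; exact: sphere_integrand_ge0.
- by move=> s; exact: sphere_integrand_even.
have hE : (fun w : k.+1.-tuple RT => (2 * (sphere_integrand kap lam bet q e_n
    (normalize (lift1 w)) / enorm (to_rV (lift1 w)) ^+ k.+2))%:E) =
    (fun w => (h (enorm (to_rV w)))%:E).
  apply/funext => w; congr EFin; rewrite /h -enorm_lift1_sqr.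
  have r0 : 0 < enorm (to_rV (lift1 w)) by exact: lt_le_trans (enorm_lift1_ge1 w).
  rewrite /sphere_integrand !dotp_delta !mxE !tnth_mktuple tnth_snoc_max /=.
  set r := enorm _ in r0 *; rewrite mul1r /omega invr_eq0 (gt_eqF r0).
  rewrite gtr0_norm ?invr_gt0// exprVn invrK -!mulrA; congr (_ * (_ * _)).
  rewrite -[r ^+ k.+2]powR_mulrn ?(ltW r0)// !powR_ln ?invr_gt0 ?exprn_gt0//.
  rewrite lnV ?posrE// lnXn// -expRN -!expRD -mulr_natl; congr expR.
  by field.
rewrite hE (integral_radial k mh h0) sphere_areaE; congr (_ * _)%E.
have mH : measurable_fun setT (fun r : R => h r * r ^+ k).
  by apply: measurable_funM => //; exact: measurable_funX.
have cH (r : R) : 0 < r -> {for r, continuous (fun r : R => h r * r ^+ k)}.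
  by move=> _; apply: cvgM; [exact: continuous_h|exact: exprn_continuous].
have H0 (r : R) : 0 < r -> 0 <= h r * r ^+ k.
  by move=> r0; rewrite mulr_ge0// exprn_ge0// ltW.
rewrite (integral_tan mH cH H0); apply: eq_integral => th.
rewrite inE /= in_itv/= => /andP[th0 thpi]; congr EFin.
have c0 : 0 < cos th by rewrite cos_gt0_pihalf// thpi andbT (lt_trans _ th0)// oppr_lt0 divr_gt0 ?pi_gt0.
have cN : cos th != 0 by rewrite gt_eqF.
rewrite /h addrC -cos2_tan2// /tan -!mulrA; congr (_ * _).
rewrite -powR_inv1 ?exprn_ge0 ?(ltW c0)// -(powR_mulrn _ (ltW c0)) -!powRrM.
have -> : 2%:R * -1 * - ((bet + q + k.+2%:R) / 2) = bet + q + k.+2%:R by field.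
congr (_ * _).
have -> : cos th `^ (2%:R * -1) = (cos th ^+ 2)^-1.
  by rewrite powRrM powR_mulrn ?(ltW c0)// powR_inv1 ?exprn_ge0// ltW.
rewrite powRD ?cN ?implybT// powR_mulrn ?(ltW c0)// expr_div_n.
rewrite -[k.+2]addn2 exprD; field.
by rewrite cN expf_neq0.
Qed.

End normal_integral.

Section special_case.
Context {R : realType}.
Variable m : nat.
Hypothesis m0 : (0 < m)%N.
Local Notation RT := (measurableTypeR R).
Local Notation mu := (@lebesgue_measure R).
Local Notation n := (m.+1%:R : R).
Variables (a t : R) (x : 'rV[R]_m.+1).
Hypotheses (a0 : 0 < a) (x0 : 0 < x 0 ord_max) (t0 : 0 < t).
Local Notation e_n := (delta_mx 0 ord_max : 'rV[R]_m.+1).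
Implicit Types (p q : R).

Lemma fine_EFinM (c : R) (y : \bar R) : (0 <= y)%E -> fine (c%:E * y) = c * fine y.
Proof.
case: y => // _; have [c0|c0|->] := ltgtP c 0; last by rewrite mul0e mul0r.
  by rewrite lt0_muley ?lte_fin ?mulr0.
by rewrite gt0_muley ?lte_fin ?mulr0.
Qed.

Lemma measurable_theta_integrand (lam kap d : R) (k : nat) : 0 <= lam -> 0 <= kap ->
  measurable_fun setT (fun theta : R =>
    upper_gamma lam (kap / cos theta ^+ 2) * cos theta `^ d * sin theta ^+ k).
Proof.
move=> lam0 kap0.
have mc : measurable_fun setT (@cos R).
  by apply: continuous_measurable_fun; exact: continuous_cos.
have ms : measurable_fun setT (@sin R).
  by apply: continuous_measurable_fun; exact: continuous_sin.
rewrite (_ : (fun _ => _) = fun theta : R =>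
    upper_gamma lam (Num.max (kap / cos theta ^+ 2) 0) * cos theta `^ d * sin theta ^+ k); last first.
  by apply/funext => th; rewrite max_l// divr_ge0// sqr_ge0.
apply: measurable_funM; last exact: measurable_funX.
apply: measurable_funM; last exact: (measurableT_comp (measurable_powR _) mc).
apply: (measurableT_comp (measurable_upper_gamma lam0)).
by apply: measurable_divr => //; exact: measurable_funX.
Qed.

Lemma Rintegral_sphere_normal (kap lam bet q : R) : 0 < kap -> 0 <= lam ->
  \int[surface_measure m.+1]_(s in unit_sphere m.+1) sphere_integrand kap lam bet q e_n s =
  2 * sphere_area m * \int[mu]_(theta in `[0, pi / 2])
    (upper_gamma lam (kap / cos theta ^+ 2) * cos theta `^ (bet + q) * sin theta ^+ (m.+1 - 2)).
Proof.
case: m m0 => // k _ kap0 lam0; rewrite !subSS subn0.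
have mG := @measurable_theta_integrand lam kap (bet + q) k lam0 (ltW kap0).
set G := (fun theta : R => _) in mG *.
have mE (D : set RT) : measurable_fun D (fun th : RT => (G th)%:E).
  by apply/measurable_EFinP; exact: measurable_funTS.
have G0 (th : R) : th \in `]0, (pi / 2)[ -> 0 <= G th.
  rewrite in_itv/= => /andP[th0 thpi].
  have s0 : 0 < sin th by rewrite sin_gt0_pi// th0 (lt_trans thpi)// ltr_pdivrMr// ltr_pMr ?pi_gt0// ltr1n.
  by rewrite !mulr_ge0 ?upper_gamma_ge0 ?powR_ge0// exprn_ge0// ltW.
rewrite /Rintegral (sphere_normal_integral k bet q kap0 lam0).
rewrite (@integral_itv_bndoo R 0 (pi / 2) (fun th => (G th)%:E) true false (mE _)).
have I0 : (0 <= \int[mu]_(theta in `]0%R, (pi / 2)%R[) (G theta)%:E)%E.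
  by apply: integral_ge0 => th thI; rewrite lee_fin G0.
have -> : (\int[mu]_(theta in `]0%R, (pi / 2)%R[) (2 * G theta)%:E =
    2%:E * \int[mu]_(theta in `]0%R, (pi / 2)%R[) (G theta)%:E)%E.
  by rewrite -ge0_integralZl ?lee_fin.
by rewrite muleA -EFinM fine_EFinM// (mulrC 2).
Qed.

Lemma kernel_norm_le_normal q v : 1 < q <= 2 -> 2 <= (n + 2) * (q - 1) -> enorm v = 1 ->
  kernel_norm a t x q v <= kernel_norm a t x q e_n.
Proof.
move=> /andP[q1 q2] qn v1; have q0 : 0 < q by exact: lt_trans q1.
have q1' := ltW q1.
have kap0 : 0 <= q * x 0 ord_max ^+ 2 / (4 * a ^+ 2 * t).
  by apply: ltW; rewrite divr_gt0 ?mulr_gt0// exprn_gt0.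
have H := @sphere_normal_max R m _ _ q kap0 (conj_lambda_ge0 m0 q1') _ qn v v1.
rewrite q0 q2 in H.
have := integral_grad_kernel v m0 a0 x0 t0 q1'; cbv zeta.
have := integral_grad_kernel e_n m0 a0 x0 t0 q1'; cbv zeta.
rewrite (kernel_momentE a0 x0 t0 v q1') (kernel_momentE a0 x0 t0 e_n q1').
set C := (_ / 2)%R => Ee Ev.
have C0 : (0 <= C%:E)%E by rewrite lee_fin !mulr_ge0 ?invr_ge0 ?powR_ge0.
have le : kernel_moment a t x q v <= kernel_moment a t x q e_n.
  by have := lee_wpmul2l C0 (H isT); rewrite -Ee -Ev lee_fin.
by rewrite /kernel_norm ge0_ler_powR ?nnegrE ?invr_ge0 ?(ltW q0) ?kernel_moment_ge0.
Qed.

Lemma N_specialE p : 1 < p -> N_special a p x t = kernel_norm a t x (conj_exponent p%:E) e_n.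
Proof.
move=> p1; have p1' : (1 < p%:E)%E by rewrite lte_fin.
have q1 := conj_pair_ge1 (conj_pairP p1').
have q0 : 0 < conj_exponent p%:E by exact: lt_le_trans q1.
have kap0 : 0 < kappa a p%:E x t.
  by rewrite /kappa divr_gt0 ?mulr_gt0// exprn_gt0.
have lam0 : 0 <= lambda m p%:E by exact: conj_lambda_ge0.
rewrite (kernel_norm_sphere m0 a0 x0 t0 e_n p1') /N_special.
suff -> : sphere_functional a p%:E x t e_n =
    (2 * sphere_area m
     * \int[mu]_(theta in `[0, pi / 2])
         (upper_gamma (((n - 2) * p + 4) / (2 * (p - 1)))
            (conj_exponent p%:E * x 0 ord_max ^+ 2
               / (4 * a ^+ 2 * t * cos theta ^+ 2))
          * cos theta `^ ((n + 2) / (p - 1)) * sin theta ^+ (m.+1 - 2)))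
    `^ ((p - 1) / p) by [].
have := @Rintegral_sphere_normal _ _ ((n - p + 2) / (p - 1)) (p / (p - 1)) kap0 lam0.
rewrite /sphere_functional /sphere_integrand /at_exponent => ->.
set I1 := \int[mu]_(_ in _) _; set I2 := \int[mu]_(_ in _) _.
suff -> : I1 = I2 by [].
apply: eq_Rintegral => th _; rewrite -lambdaE// /kappa invfM mulrA; congr (_ * _ `^ _ * _).
  by rewrite !invfM !mulrA.
by rewrite -mulrDl; congr (_ / _); ring.
Qed.

Lemma sharp_N_special p : 2 <= p <= (n + 4) / 2 ->
  sharp_coefficient a p%:E x t (N_special a p x t).
Proof.
move=> /andP[p2 pn]; have p1 : 1 < p by apply: lt_le_trans p2; rewrite ltr1n.
have p1' : (1 < p%:E)%E by rewrite lte_fin.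
have p10 : 0 < p - 1 by rewrite subr_gt0.
rewrite (N_specialE p1); apply: (sharp_of_max a0 x0 t0 p1'); first exact: enorm_delta.
move=> w; apply: kernel_norm_le_normal; rewrite conj_exponentE//.
  rewrite ltr_pdivlMr// mul1r gtrBl ltr01/= ler_pdivrMr//; lra.
have -> : p / (p - 1) - 1 = (p - 1)^-1 by field; rewrite gt_eqF.
rewrite ler_pdivlMr//; lra.
Qed.

Lemma k_coef2 : k_coef m a 2%:E = a / (2 `^ (n / 2) * pi `^ (n / 2)).
Proof.
have p2 : (1 < 2%:E :> \bar R)%E by rewrite lte_fin ltr1n.
rewrite (k_coefE m a0 (conj_pairP p2)) conj_exponentE ?ltr1n//.
have pi0 := pi_gt0 R.
rewrite (_ : 2 / (2 - 1) = 2 :> R); last by field.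
rewrite !powR_ln// -{2}[a]lnK ?posrE// -!expRD -!expRN -!expRD; congr expR.
by field.
Qed.

Lemma Gamma_half_gt0 : 0 < Gamma (m%:R / 2 : R).
Proof.
have aG := @sphere_area_Gamma R m.-1; rewrite prednK// in aG.
have rp0 : 0 < 2 * Num.sqrt (pi : R) ^+ m by rewrite mulr_gt0// exprn_gt0// sqrtr_gt0 pi_gt0.
have G0 : 0 <= Gamma (m%:R / 2 : R) by exact: upper_gamma_ge0.
by rewrite lt0r G0 andbT; apply/eqP => G00; move: rp0; rewrite -aG G00 mulr0 ltxx.
Qed.

Lemma sphere_area_half : sphere_area m = 2 * Num.sqrt (pi : R) ^+ m / Gamma (m%:R / 2).
Proof.
have aG := @sphere_area_Gamma R m.-1; rewrite prednK// in aG.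
by rewrite -aG mulfK// gt_eqF// Gamma_half_gt0.
Qed.

Lemma sphere_area_gt0 : 0 < sphere_area m :> R.
Proof.
rewrite sphere_area_half divr_gt0 ?Gamma_half_gt0// mulr_gt0// exprn_gt0//.
by rewrite sqrtr_gt0 pi_gt0.
Qed.

Lemma b_coefE : b_coef m a = k_coef m a 2%:E * Num.sqrt (2 * sphere_area m).
Proof.
have pi0 := pi_gt0 R.
have nE : (n - 1) / 2 = m%:R / 2 by rewrite -natr1 addrK.
have Gpos := Gamma_half_gt0; have G0 := ltW Gpos.
have nm : n = m%:R + 1 by rewrite natr1.
have -> : Num.sqrt (2 * sphere_area m) =
    expR (ln 2 + m%:R / 4 * ln pi - 2^-1 * ln (Gamma (m%:R / 2 : R))).
  have P0 : 0 < (pi `^ 2^-1) `^ m%:R :> R by rewrite !powR_gt0.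
  rewrite sphere_area_half -(powR_mulrn _ (sqrtr_ge0 _)) -(powR12_sqrt (ltW pi0)).
  rewrite -powR12_sqrt ?mulr_ge0 ?invr_ge0 ?(ltW P0)//.
  rewrite powR_ln ?mulr_gt0 ?invr_gt0//; congr expR.
  rewrite lnM ?posrE ?mulr_gt0 ?invr_gt0// lnM ?posrE ?mulr_gt0 ?invr_gt0//.
  rewrite lnM ?posrE// lnV ?posrE// !ln_powR.
  by field.
rewrite k_coef2 /b_coef nE -(powR12_sqrt G0) !powR_ln// -!expRD -!mulrA -!expRN -expRD.
congr (_ * expR _); rewrite nm.
by field.
Qed.

Lemma N_twoE : N_two a x t = N_special a 2 x t.
Proof.
have pi0 := pi_gt0 R.
have area0 := sphere_area_gt0.
rewrite /N_two /N_special.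
set I2 := \int[_]_(_ in _) _.
set Ip := \int[_]_(_ in _) _.
have -> : Ip = I2.
  apply: eq_Rintegral => th; rewrite inE/= in_itv/= => /andP[th0 thpi].
  have c0 : 0 <= cos th.
    by rewrite cos_ge0_pihalf// thpi andbT (le_trans _ th0)// oppr_le0 divr_ge0 ?(ltW pi0).
  rewrite -lambdaE ?ltr1n// /lambda conj_exponentE ?ltr1n//.
  rewrite (_ : 2 / (2 - 1) = 2 :> R); last by field.
  rewrite (_ : (n + 2) / (2 - 1) = (m.+1 + 2)%:R); last by rewrite natrD; field.
  rewrite powR_mulrn// (_ : (n + 2) * 2 / 2 - 2 = n); last by field.
  have [c00|c00] := eqVneq (cos th) 0.
    by rewrite c00 addn2 !expr0n/= !mulr0 !mul0r.
  by congr (upper_gamma _ _ * _ * _); field; rewrite c00 (gt_eqF a0) (gt_eqF t0).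
have I0 : 0 <= I2.
  apply: Rintegral_ge0 => th; rewrite /= in_itv/= => /andP[th0 thpi].
  rewrite !mulr_ge0 ?upper_gamma_ge0// exprn_ge0//.
    by rewrite cos_ge0_pihalf// thpi andbT (le_trans _ th0)// oppr_le0 divr_ge0 ?(ltW pi0).
  by rewrite sin_ge0_pi// th0 (le_trans thpi)// ler_pdivrMr// ler_peMr ?(ltW pi0)// ler1n.
rewrite (_ : (2 - 1) / 2 = 2^-1 :> R); last by field.
rewrite powR12_sqrt ?mulr_ge0 ?(ltW area0)// [in RHS]sqrtrM ?mulr_ge0 ?(ltW area0)//.
rewrite b_coefE; set k := k_coef _ _ _; set y := _ `^ ((n + 1) / 2).
ring.
Qed.

End special_case.

Theorem proposition3 (R : realType) (m : nat) (hm : (0 < m)%N) (a : R)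
    (ha : 0 < a) (x : 'rV[R]_m.+1) (hx : 0 < x 0 ord_max) (t : R) (ht : 0 < t) :
  [/\ (forall p : \bar R, (1 <= p)%E -> forall g, Lp_data p g ->
         forall i, derivable (fun y => single_layer a g y t) x (delta_mx 0 i)),
      (forall p : \bar R, (1 < p)%E ->
         sharp_coefficient a p x t (N_formula a p x t)),
      (exists2 N, N_formula a r%:E x t @[r --> (1 : R)^'+] --> N &
         sharp_coefficient a 1%E x t N),
      (forall p : R, 2 <= p <= (m.+1%:R + 4) / 2 ->
         sharp_coefficient a p%:E x t (N_special a p x t)) &
      sharp_coefficient a 2%:E x t (N_two a x t)].
Proof.
split.
- by move=> p p1 g gLp i; exact: (single_layer_derivable ha hx ht p1 gLp).
- by move=> p p1; exact: (sharp_N_formula hm ha hx ht p1).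
- exact: (sharp_endpoint ha hx ht hm).
- by move=> p p2; exact: (sharp_N_special hm ha hx ht p2).
have n2 : 2 <= (2 : R) <= (m.+1%:R + 4) / 2.
  by rewrite lexx ler_pdivlMr// -natrM -natrD ler_nat leq_addl.
by rewrite (N_twoE hm x ha ht); exact: (sharp_N_special hm ha hx ht n2).
Qed.
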